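(* Let $p\in\mathbb{C}[z_1,z_2]$ be scattering stable with $\tilde p(0,0)=0$. (i) If $v\in\mathbb{C}[z_1,z_2]$ satisfies $\deg v\le\deg\tilde p$, $v(0,0)=0$, $v=\tilde v$, and $p+v$ and $p-v$ have no zeros in $\mathbb{D}^2$, then $v/p\in L^2(\mathbb{T}^2)$. (ii) If $p$ is not $\mathbb{T}^2$-saturated, then there exists a nonzero $v\in\mathbb{C}[z_1,z_2]$ such that $v/p\in L^2(\mathbb{T}^2)$, $\deg v\le\deg\tilde p$, $v=\tilde v$, and $v(0,0)=0$.
   Context: $\mathbb{D}$ is the open unit disk, $\mathbb{T}$ the unit circle, and $L^2(\mathbb{T}^2)$ is taken with respect to normalized Lebesgue measure. $\deg$ denotes bidegree and inequalities between bidegrees are componentwise. Let $n=(n_1,n_2)$ be the bidegree of $p$ (which equals that of $\tilde p$ here). For $q$ of bidegree at most $n$, the reflection is $\tilde q(z)=z_1^{n_1}z_2^{n_2}\overline{q(1/\bar z_1,1/\bar z_2)}$; both $\tilde p$ and $\tilde v$ are taken at this same $n$. $p$ is scattering stable if $p$ has no zeros in $\mathbb{D}^2$ and $p,\tilde p$ have no nonconstant common factor. A scattering stable $p$ of bidegree $(n_1,n_2)$ is $\mathbb{T}^2$-saturated if $p$ and $\tilde p$ have $2n_1n_2$ common zeros on $\mathbb{T}^2$, counted with intersection multiplicity, i.e. $\sum_{\zeta\in\mathbb{T}^2}I_\zeta(p,\tilde p)=2n_1n_2$, where $I_\zeta(p,q)=\dim_{\mathbb{C}}\mathcal{O}_\zeta/(p,q)\mathcal{O}_\zeta$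 and $\mathcal{O}_\zeta$ is the ring of rational functions with denominators nonvanishing at $\zeta$. *)

(* Defs.v *)
From mathcomp Require Import all_boot all_order all_algebra fraction polyXY.
From mathcomp Require Import complex ring.
From mathcomp Require Import all_classical all_reals all_analysis.

Set Implicit Arguments.
Unset Strict Implicit.
Unset Printing Implicit Defensive.
Import Order.TTheory GRing.Theory Num.Theory.
Import numFieldNormedType.Exports.
Local Open Scope classical_set_scope.
Local Open Scope ring_scope.
Local Open Scope complex_scope.

(* A polynomial in C[z_1, z_2] is an element of {poly {poly C}}: z_1 is the
   outer variable 'X and z_2 is the inner one 'Y, so that the value at
   (z_1, z_2) is the library's q.[z_1, z_2]. *)
Notation "{ 'bipoly' R }" := {poly {poly R[i]}} (format "{ 'bipoly'  R }").

Section Bivariate.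
Variable R : realType.
Local Notation "x %:F" := (tofrac x).
Implicit Types (p q v : {bipoly R}) (z : R[i] * R[i]) (n : nat * nat).

Definition eval2 q z : R[i] := q.[z.1, z.2].

Definition bidegree q : nat * nat := ((size q).-1, (sizeY q).-1).

Definition bidegree_le m n : bool := (m.1 <= n.1)%N && (m.2 <= n.2)%N.

(* At the level of coefficients, z_1^n_1 z_2^n_2 conj(q(1/conj z_1, 1/conj z_2))
   has conj(q_(n_1-i, n_2-j)) in front of z_1^i z_2^j; see [eval2_reflection]. *)
Definition reflection n q : {bipoly R} :=
  \poly_(i < n.1.+1) \poly_(j < n.2.+1) conjc q`_(n.1 - i)`_(n.2 - j).

Definition bidisk : set (R[i] * R[i]) :=
  [set z | `|z.1| < 1 /\ `|z.2| < 1].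

Definition torus : set (R[i] * R[i]) :=
  [set z | `|z.1| = 1 /\ `|z.2| = 1].

Definition no_zeros_in_bidisk q : Prop :=
  forall z, bidisk z -> eval2 q z != 0.

Definition no_nonconstant_common_factor p q : Prop :=
  forall d a b, p = a * d -> q = b * d -> exists c : R[i], d = c%:P%:P.

Definition scattering_stable p : Prop :=
  no_zeros_in_bidisk p /\
  no_nonconstant_common_factor p (reflection (bidegree p) p).

Definition local_ring z : set {fraction {bipoly R}} :=
  [set f | exists a b : {bipoly R}, eval2 b z != 0 /\ f = a%:F / b%:F].

Definition local_ideal p q z : set {fraction {bipoly R}} :=
  [set f | exists a b, [/\ local_ring z a, local_ring z b &
                           f = a * p%:F + b * q%:F]].

(* Dimension over C of the quotient space V / W (W a subspace of V), as the
   supremum in [0, +oo] of the sizes of the finite families of elements of V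
   that are linearly independent modulo W. *)
Definition quotient_dim (V W : set {fraction {bipoly R}}) : \bar R :=
  ereal_sup [set k%:R%:E | k in [set k : nat |
    exists f : 'I_k -> {fraction {bipoly R}},
      (forall i, V (f i)) /\
      (forall c : 'I_k -> R[i],
         W (\sum_(i < k) (c i)%:P%:P%:F * f i) -> forall i, c i = 0)]].

Definition intersection_multiplicity p q z : \bar R :=
  quotient_dim (local_ring z) (local_ideal p q z).

Definition torus_saturated p : Prop :=
  let n := bidegree p in
  (\esum_(z in torus) intersection_multiplicity p (reflection n p) z =
   ((2 * n.1 * n.2)%N)%:R%:E)%E.

(* The torus is parametrised by the unit square, which carries normalised
   Lebesgue measure on the torus to plain Lebesgue measure on the square. *)
Definition unit_circle (t : R) : R[i] :=
  cos (2 * pi * t) +i* sin (2 * pi * t).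

Local Notation mR := (measurableTypeR R).

Definition torus_param (t : mR * mR) : R[i] * R[i] :=
  (unit_circle t.1, unit_circle t.2).

Definition unit_square : set (mR * mR) := `[0, 1] `*` `[0, 1].

Definition L2_torus (f : R[i] * R[i] -> R[i]) : Prop :=
  let g := f \o torus_param in
  [/\ measurable_fun unit_square (fun t : mR * mR => complex.Re (g t)),
      measurable_fun unit_square (fun t : mR * mR => complex.Im (g t)) &
      (\int[lebesgue_measure \x lebesgue_measure]_(t in unit_square)
         ((ComplexField.Normc.normc (g t)) ^+ 2)%:E < +oo)%E].

Lemma eval2_coef (m n : nat) q z : bidegree_le (bidegree q) (m, n) ->
  eval2 q z = \sum_(i < m.+1) \sum_(j < n.+1) q`_i`_j * z.2 ^+ j * z.1 ^+ i.
Proof.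
case/andP=> /= qm qn.
have szq : (size q <= m.+1)%N by rewrite -ltnS in qm; case: (size q) qm.
have szY i : (size (q`_i)%R <= n.+1)%N.
  apply: leq_trans (max_size_coefXY _ _) _.
  by rewrite -ltnS in qn; case: (sizeY q) qn.
rewrite /eval2 (horner_coef_wide _ szq) horner_sum; apply: eq_bigr => i _.
rewrite hornerM -polyC_exp hornerC (horner_coef_wide _ (szY i)) mulr_suml.
by [].
Qed.

Lemma eval2_reflection n q z :
  bidegree_le (bidegree q) n -> z.1 != 0 -> z.2 != 0 ->
  eval2 (reflection n q) z =
  z.1 ^+ n.1 * z.2 ^+ n.2 * conjc (eval2 q ((conjc z.1)^-1, (conjc z.2)^-1)).
Proof.
case: n => m n qn z1 z2.
rewrite (eval2_coef _ qn) /eval2 horner_poly horner_sum /= rmorph_sum mulr_sumr.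
rewrite [RHS](reindex_inj rev_ord_inj); apply: eq_bigr => i _ /=.
rewrite hornerM -polyC_exp hornerC horner_poly mulr_suml rmorph_sum mulr_sumr.
rewrite [RHS](reindex_inj rev_ord_inj); apply: eq_bigr => j _ /=.
rewrite !subSS !rmorphM /= !rmorphXn /= !conjc_inv !conjcK.
have im : (i <= m)%N by rewrite -ltnS.
have jn : (j <= n)%N by rewrite -ltnS.
have -> : z.1 ^+ m = z.1 ^+ i * z.1 ^+ (m - i) by rewrite -exprD subnKC.
have -> : z.2 ^+ n = z.2 ^+ j * z.2 ^+ (n - j) by rewrite -exprD subnKC.
rewrite !exprVn.
have h1 : z.1 ^+ (m - i) != 0 by rewrite expf_neq0.
have h2 : z.2 ^+ (n - j) != 0 by rewrite expf_neq0.
by field; rewrite h1 h2.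
Qed.

End Bivariate.

(* Main.v *)
Require Import Defs.
From mathcomp Require Import all_boot all_order all_algebra fraction polyXY perm.
From mathcomp Require Import complex ring lra zify.
From mathcomp Require Import all_classical all_reals all_analysis measurable_realfun.

Set Implicit Arguments.
Unset Strict Implicit.
Unset Printing Implicit Defensive.
Import Order.TTheory GRing.Theory Num.Theory.
Import numFieldNormedType.Exports.
Local Open Scope classical_set_scope.
Local Open Scope ring_scope.

(* Part (i).  Given points Z_i of the bidisk and weights c_i, let H(f) be the sum
   of c_i f(Z_i) conj(c_j f(Z_j)) S(Z_i, Z_j), where S is the Szego kernel.  If q
   has no zeros in the bidisk then H(q~) <= H(q).  For q = p + v and q = p - v,
   and after adding the origin, where v and p~ vanish, to the points, this gives
   |sum_i c_i v(Z_i)|^2 <= H(p).  On a dilated grid of roots of unity and for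
   c_i = conj(v/p)/p it bounds the grid averages of |v/p|^2, and Fatou's lemma
   concludes.

   Part (ii).  Let B(y) be the Bezoutian matrix of p(., y) and p~(., y).  On the
   circle y^-n2 B(y) is positive semidefinite, so the roots of det B on the circle
   can be divided out two at a time.  Each pair costs one linear condition on a
   polynomial vector x(y) for x x^* to be bounded by a multiple of y^-n2 B(y), and
   this bound makes (sum_j x_j(z_2) z_1^j) / p square integrable.  If det B, whose
   degree is at most 2 n1 n2, has fewer than 2 n1 n2 roots on the circle, there
   are fewer than n1 n2 conditions, and a nonzero solution of bidegree less than
   (n1, n2) exists, from which v is obtained by symmetrization.  Otherwise det B
   has degree 2 n1 n2 and all its roots on the circle; then all common zeros of p
   and p~ lie on the torus and C[z_1, z_2] / (p, p~) has dimension 2 n1 n2, so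
   that p is saturated. *)

(** * Stable polynomials *)

Section OneVariable.
Variable C : numClosedFieldType.
Implicit Types (f g : {poly C}) (a b c x z : C) (n : nat).

(** Since [p] may vanish on the torus, boundary values of p~/p and v/p are replaced by dilations and
    finite grid sums; integration enters only through Fatou's lemma. The inequality H(q~) <= H(q)
    reflects the bound |q~/q| <= 1 on the bidisk. To reach it with polynomials, r^(n1+n2) q~(z/r) /
    q(rz), which is unimodular on the torus, is approximated by replacing 1/q(rz) with a polynomial;
    a von Neumann type inequality, proved with Parseval's identity on roots of unity, then applies.
    Both parts rest on one duality: a quadratic bound on a linear functional, tested with weights
    conj(f/p)/p at grid points, compares the square of the sum of |f/p|^2 with a multiple of that
    same sum, and so bounds it. In part (ii) the threshold is a dimension count: polynomials of
    degree below n1 in z_1 and below n2 in z_2 have n1 n2 coefficients, and positivity makes the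
    roots of det B on the circle come in pairs, so 2 n1 n2 of them are needed to use up all
    coefficients. *)

Definition stable1 f := forall x, `|x| < 1 -> f.[x] != 0.

Definition crev n f : {poly C} := \poly_(i < n.+1) (f`_(n - i))^*.

(** A root z of a stable polynomial has |z| >= 1, so X - z is -z (1 - a X) with a = 1/z in the
    closed disk. Here n is a formal degree: the constant case is required for every n, which absorbs
    polynomials of lower degree. *)
Lemma stable1_ind (P : nat -> {poly C} -> Prop) :
  (forall n c, P n c%:P) ->
  (forall n a g, `|a| <= 1 -> (size g <= n.+1)%N -> P n g ->
     P n.+1 ((1 - a *: 'X) * g)) ->
  forall n f, (size f <= n.+1)%N -> stable1 f -> P n f.
Proof.
move=> P0 PS; elim=> [|n IHn] f szf stf.
  by rewrite (size1_polyC szf); apply: P0.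
have [/size1_polyC -> //|sz1] := leqP (size f) 1.
have [z /rootP fz] : exists z, root f z.
  by apply/closed_rootP; apply/eqP => szf1; rewrite szf1 in sz1.
have z1 : 1 <= `|z|.
  rewrite real_leNgt ?realE ?normr_ge0 ?ler01 //.
  by apply/negP => /stf; rewrite fz eqxx.
have z0 : z != 0 by rewrite -normr_gt0 (lt_le_trans ltr01).
have /factor_theorem [g fE] : root f z by apply/rootP.
have {}fE : f = (1 - z^-1 *: 'X) * (- z *: g).
  rewrite fE -scalerAr mulrBl mul1r scalerBr -scalerAl scalerA mulNr mulfV //.
  by rewrite scaleN1r opprK mulrBr mulrC [g * _%:P]mulrC mul_polyC scaleNr addrC.
have g0 : g != 0.
  apply: contraTneq (stf 0 _) => [g0|]; last by rewrite normr0 ltr01.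
  by rewrite fE g0 scaler0 mulr0 horner0 eqxx.
have szg : (size (- z *: g)%R <= n.+1)%N.
  rewrite size_scale ?oppr_eq0 // -ltnS; apply: leq_trans szf.
  rewrite fE -scalerAr size_scale ?oppr_eq0 // -opprB mulNr size_polyN.
  have -> : z^-1 *: 'X - 1 = z^-1 *: ('X - z%:P) :> {poly C}.
    by rewrite scalerBr -[z^-1 *: z%:P]mul_polyC -polyCM mulVf.
  by rewrite -scalerAl size_scale ?invr_eq0 // size_monicM ?monicXsubC // size_XsubC.
rewrite {1}fE; apply: PS => //; first by rewrite normfV invf_le1 // normr_gt0.
apply: IHn => [|x x1]; first exact: szg.
by apply: contraNneq (stf x x1) => E; rewrite fE hornerM E mulr0.
Qed.

(** A Harnack-type comparison, factor by factor: |1 - a x| >= 1 - |x| and |1 - a b| <= 1 + |b| when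
    |a| <= 1. The point b is arbitrary, which later lets a single interior zero of a limit force
    vanishing everywhere. *)
Lemma stable1_lower n f x b : (size f <= n.+1)%N -> stable1 f -> `|x| <= 1 ->
  `|f.[b]| * (1 - `|x|) ^+ n <= `|f.[x]| * (1 + `|b|) ^+ n.
Proof.
move=> szf stf x1.
pose P n f := `|f.[b]| * (1 - `|x|) ^+ n <= `|f.[x]| * (1 + `|b|) ^+ n.
have x0 : 0 <= 1 - `|x| by rewrite subr_ge0.
have b0 : 0 <= 1 + `|b| by rewrite addr_ge0.
apply: (@stable1_ind P) => // {n f szf stf}; rewrite /P.
  move=> n c; rewrite !hornerC ler_wpM2l // (@le_trans _ _ 1) //.
    by rewrite exprn_ile1 // gerBl.
  by rewrite exprn_ege1 // lerDl.
move=> n a g a1 szg Pg.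
rewrite !hornerM !normrM !exprS mulrACA [leRHS]mulrACA mulrC [leRHS]mulrC.
apply: ler_pM => //; rewrite ?mulr_ge0 ?exprn_ge0 //.
rewrite !hornerE mulrC; apply: ler_pM => //.
  rewrite (le_trans _ (lerB_normD _ _)) // normr1 normrN normrM.
  by rewrite lerD2l lerN2 ler_piMl.
rewrite (le_trans (ler_normB _ _)) // normr1 normrM lerD2l ler_piMl //.
Qed.

Lemma crev_coef n f i : (i <= n)%N -> (crev n f)`_i = (f`_(n - i))^*.
Proof. by move=> le_in; rewrite coef_poly ltnS le_in. Qed.

Lemma crev_size n f : (size (crev n f) <= n.+1)%N.
Proof. exact: size_poly. Qed.

Lemma crevS n a g : (size g <= n.+1)%N ->
  crev n.+1 ((1 - a *: 'X) * g) = ('X - (a^*)%:P) * crev n g.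
Proof.
move=> szg; apply/polyP => i; rewrite !mulrBl !mul1r coefB mul_polyC coefZ.
rewrite coefXM !coef_poly -scalerAl coefB coefZ coefXM.
case: i => [|i] /=.
  by rewrite !subn0 (nth_default _ szg) /= !sub0r rmorphN rmorphM.
rewrite ltnS subSS subn_eq0; case: ltngtP => [lt_in|lt_ni|->] /=.
- rewrite !ltnS rmorphB rmorphM /= leqNgt; case: ltnP => [lt|ge] /=.
    by rewrite subnS.
  by rewrite rmorph0.
- have -> : (i.+1 < n.+1)%N = false by lia.
  by rewrite mulr0 subr0.
- have -> : (n.+2 < n.+1)%N = false by lia.
  by rewrite mulr0 subr0.
Qed.

Lemma sqrnB_swap a u w :
  `|u - a * w| ^+ 2 - `|w - a^* * u| ^+ 2 =
  (1 - `|a| ^+ 2) * (`|u| ^+ 2 - `|w| ^+ 2).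
Proof. by rewrite !normCK !(rmorphB, rmorphM) /= conjCK; ring. Qed.

(** The Schur-Cohn inequality in functional form. One factor 1 - a X is absorbed into [ell]; the
    remaining difference of the two sums telescopes through [sqrnB_swap], and its far end vanishes
    because [ell] kills multiples of X^N. *)
Lemma crev_contract (ell : {poly C} -> C) N n f :
  scalar ell -> (forall l h, (N <= l)%N -> ell ('X^l * h) = 0) ->
  (size f <= n.+1)%N -> stable1 f ->
  \sum_(l < N) `|ell ('X^l * crev n f)| ^+ 2 <=
  \sum_(l < N) `|ell ('X^l * f)| ^+ 2.
Proof.
move=> ellL ellN szf stf.
(* The functional is quantified inside [P] because the inductive step applies the hypothesis to h
   |-> ell ((1 - a X) h). *)
pose P n f := forall ell, scalar ell ->
  (forall l h, (N <= l)%N -> ell ('X^l * h) = 0) ->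
  \sum_(l < N) `|ell ('X^l * crev n f)| ^+ 2 <=
  \sum_(l < N) `|ell ('X^l * f)| ^+ 2.
have ZD e : scalar e -> forall a u, e (a *: u) = a * e u.
  move=> eL a u; rewrite -[a *: u]addr0 eL.
  suff -> : e 0 = 0 by rewrite addr0.
  by apply/(@addrI _ (e 0)); rewrite addr0 -[e 0 as X in X + _]mul1r -eL scale1r addr0.
apply: (@stable1_ind P) => // {n f szf stf ell ellL ellN}.
- move=> n c ell ellL ellN.
  have -> : crev n c%:P = c^* *: 'X^n.
    apply/polyP => i; rewrite coef_poly coefZ coefXn coefC ltnS.
    case: (ltngtP i n) => [lt|gt|->]; rewrite ?mulr0 //.
      by rewrite subn_eq0 leqNgt lt rmorph0.
    by rewrite subnn mulr1.
  have -> : \sum_(l < N) `|ell ('X^l * c%:P)| ^+ 2 =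
    \sum_(l < n + N) `|c| ^+ 2 * `|ell 'X^l| ^+ 2.
    rewrite addnC big_split_ord /= [X in _ = _ + X]big1 ?addr0; last first.
      move=> i _; rewrite -[X in ell X]mulr1 ellN ?leq_addr //.
      by rewrite normr0 expr0n mulr0.
    by apply: eq_bigr => i _; rewrite mulrC mul_polyC ZD // normrM exprMn.
  rewrite big_split_ord /=; apply: ler_wpDl.
    by apply: sumr_ge0 => i _; rewrite mulr_ge0 ?exprn_ge0.
  apply: ler_sum => i _.
  by rewrite -scalerAr ZD // normrM exprMn norm_conjC -exprD addnC.
move=> n a g a1 szg Pg ell ellL ellN; rewrite crevS //.
pose b h := ell ((1 - a *: 'X) * h).
apply: (@le_trans _ _ (\sum_(l < N) `|b ('X^l * crev n g)| ^+ 2)); last first.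
  have := Pg b; rewrite /b => H.
  under [leRHS]eq_bigr => l _ do rewrite mulrCA.
  apply: H => [k u w|l h leN]; last by rewrite mulrCA ellN.
  by rewrite mulrDr -scalerAr ellL.
rewrite -subr_ge0 -sumrB /b.
pose u l := ell ('X^l * crev n g).
have E (l : 'I_N) : `|ell ((1 - a *: 'X) * ('X^l * crev n g))| ^+ 2 -
   `|ell ('X^l * (('X - (a^*)%:P) * crev n g))| ^+ 2 =
   (1 - `|a| ^+ 2) * (`|u l| ^+ 2 - `|u l.+1| ^+ 2).
  have -> : ell ((1 - a *: 'X) * ('X^l * crev n g)) = u l - a * u l.+1.
    rewrite mulrBl mul1r -scalerAl -scaleNr [X in ell X]addrC ellL mulrA -exprS.
    by rewrite mulNr addrC.
  have -> : ell ('X^l * (('X - (a^*)%:P) * crev n g)) = u l.+1 - a^* * u l.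
    rewrite mulrCA mulrBl -mulNr -polyCN mul_polyC [X in ell X]addrC ellL mulrA -exprS.
    by rewrite mulNr addrC.
  exact: sqrnB_swap.
rewrite (eq_bigr _ (fun l _ => E l)) -mulr_sumr.
rewrite mulr_ge0 ?subr_ge0 ?exprn_ile1 //.
rewrite -(big_mkord xpredT (fun l => `|u l| ^+ 2 - `|u l.+1| ^+ 2)).
have -> : \sum_(0 <= l < N) (`|u l| ^+ 2 - `|u l.+1| ^+ 2) = `|u 0%N| ^+ 2 - `|u N| ^+ 2.
  elim: (N) => [|k IHk]; first by rewrite big_nil subrr.
  by rewrite big_nat_recr //= IHk addrA subrK.
by rewrite [u N]ellN // normr0 expr0n subr0 exprn_ge0.
Qed.

End OneVariable.

Lemma bernoulli (F : numDomainType) (x : F) n : 0 <= x -> 1 + n%:R * x <= (1 + x) ^+ n.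
Proof.
move=> x0; elim: n => [|n IH]; first by rewrite mul0r addr0.
have n0 : 0 <= n%:R :> F by rewrite ler0n.
rewrite exprS; apply: le_trans (ler_wpM2l (addr_ge0 ler01 x0) IH); rewrite -natr1.
have -> : (1 + x) * (1 + n%:R * x) = 1 + (n%:R + 1) * x + n%:R * x * x by ring.
by rewrite lerDl !mulr_ge0.
Qed.

Section TwoVariables.
Variable C : numClosedFieldType.
Implicit Types (f g : {poly C}) (p q : {poly {poly C}}) (a b c x y z t : C).

Definition stable2 q := forall x y, `|x| < 1 -> `|y| < 1 -> q.[x, y] != 0.

Definition slice y q : {poly C} := map_poly (horner_eval y) q.

Lemma horner_slice q x y : (slice y q).[x] = q.[x, y].
Proof. by rewrite /slice -horner_swapXY horner2_swapXY. Qed.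

Lemma size_slice y q : (size (slice y q) <= size q)%N.
Proof. exact: size_poly. Qed.

Lemma coef_slice y q i : (slice y q)`_i = (q`_i).[y].
Proof. by rewrite coef_map. Qed.

Definition dilate s t q : {poly {poly C}} :=
  map_poly (comp_poly (t *: 'X)) q \Po (s%:P *: 'X).

Lemma horner_dilate s t q x y : (dilate s t q).[x, y] = q.[s * x, t * y].
Proof.
rewrite /dilate horner_comp hornerZ hornerX -polyCM.
have /= := horner_map (comp_poly (t *: 'X)) q (s * x)%:P.
by rewrite comp_polyC => ->; rewrite horner_comp hornerZ hornerX.
Qed.

Lemma horner_bound f (r : C) : 0 <= r ->
  exists2 K : C, 0 <= K & forall x, `|x| <= r -> `|f.[x]| <= K.
Proof.
move=> r0; elim/poly_ind: f => [|f c [K K0 IH]].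
  by exists 0 => // x _; rewrite horner0 normr0.
exists (K * r + `|c|) => [|x xr]; first by rewrite addr_ge0 ?mulr_ge0.
by rewrite !hornerE (le_trans (ler_normD _ _)) // lerD2r normrM ler_pM ?IH.
Qed.

Lemma horner2_bound q (r : C) : 0 <= r ->
  exists2 K : C, 0 <= K &
    forall x y, `|x| <= r -> `|y| <= r -> `|q.[x, y]| <= K.
Proof.
move=> r0; elim/poly_ind: q => [|q c [K K0 IH]].
  by exists 0 => // x y _ _; rewrite !horner0 normr0.
have [L L0 cL] := horner_bound c r0.
exists (K * r + L) => [|x y xr yr]; first by rewrite addr_ge0 ?mulr_ge0.
rewrite !hornerE (le_trans (ler_normD _ _)) // lerD ?cL // normrM.
by rewrite ler_pM ?IH.
Qed.

Lemma horner_lipschitz f (r : C) : 0 <= r ->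
  exists2 K : C, 0 <= K & forall x y, `|x| <= r -> `|y| <= r ->
    `|f.[x] - f.[y]| <= K * `|x - y|.
Proof.
move=> r0; elim/poly_ind: f => [|f c [K K0 IH]].
  by exists 0 => // x y _ _; rewrite !horner0 subrr normr0 mul0r.
have [L L0 fL] := horner_bound f r0.
exists (K * r + L) => [|x y xr yr]; first by rewrite addr_ge0 ?mulr_ge0.
rewrite !hornerE.
have -> : f.[x] * x + c - (f.[y] * y + c) = (f.[x] - f.[y]) * x + f.[y] * (x - y).
  by ring.
rewrite (le_trans (ler_normD _ _)) // !normrM [leRHS]mulrDl lerD //.
  by rewrite mulrAC ler_pM ?IH.
by rewrite ler_wpM2r ?fL.
Qed.

Lemma horner2_lipschitz q (r : C) : 0 <= r ->
  exists2 K : C, 0 <= K & forall x y x' y',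
    `|x| <= r -> `|y| <= r -> `|x'| <= r -> `|y'| <= r ->
    `|q.[x, y] - q.[x', y']| <= K * (`|x - x'| + `|y - y'|).
Proof.
move=> r0; elim/poly_ind: q => [|q c [K K0 IH]].
  by exists 0 => // x y x' y' _ _ _ _; rewrite !horner0 subrr normr0 mul0r.
have [L L0 qL] := horner2_bound q r0.
have [M M0 cM] := horner_lipschitz c r0.
exists (K * r + L + M) => [|x y x' y' xr yr xr' yr'].
  by rewrite !addr_ge0 ?mulr_ge0.
rewrite !hornerE.
have -> : q.[x, y] * x + c.[y] - (q.[x', y'] * x' + c.[y']) =
  (q.[x, y] - q.[x', y']) * x + q.[x', y'] * (x - x') + (c.[y] - c.[y']) by ring.
rewrite (le_trans (ler_normD _ _)) // [leRHS]mulrDl lerD //; last first.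
  by rewrite (le_trans (cM _ _ _ _)) // ler_wpM2l // lerDr.
rewrite (le_trans (ler_normD _ _)) // !normrM [leRHS]mulrDl lerD //.
  by rewrite mulrAC ler_pM ?IH.
by rewrite ler_pM ?qL // lerDl.
Qed.

(** Stands in for letting d tend to 0, with an explicit linear error, over any
    [numClosedFieldType]. *)
Lemma le_of_lt1_slack (a b K : C) : a \is Num.real -> b \is Num.real -> 0 <= K ->
  (forall d, 0 < d -> d < 1 -> a <= b + K * d) -> a <= b.
Proof.
move=> ar br K0 H; rewrite real_leNgt //; apply/negP => ltba.
have [e e0 eE] : exists2 e, 0 < e & e = a - b by exists (a - b); rewrite ?subr_gt0.
(* This choice makes K d smaller than the gap e = a - b and keeps d below 1. *)
pose d := e / (e + e + K + K).
have s0 : 0 < e + e + K + K by do 2 apply: ltr_wpDr => //; apply: addr_gt0.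
have d1 : d < 1.
  by rewrite /d ltr_pdivrMr // mul1r -!addrA ltrDl; apply: ltr_wpDr => //; apply: addr_ge0.
have := H d (divr_gt0 e0 s0) d1; rewrite addrC -lerBlDr -eE.
rewrite /d mulrA ler_pdivlMr // mulrC ler_pM2r // => Hle.
have : e + e + K + K <= K + 0 by rewrite addr0.
have s1 : 0 < e + e + K by apply: ltr_wpDr => //; apply: addr_gt0.
by rewrite addrC lerD2l => /(lt_le_trans s1); rewrite ltxx.
Qed.

Lemma slice_stable q y : stable2 q -> `|y| < 1 -> stable1 (slice y q).
Proof. by move=> st y1 x x1; rewrite horner_slice st. Qed.

Lemma slice_swapXY q x : slice x (swapXY q) = q.[x%:P].
Proof. by rewrite horner_polyC. Qed.

(* Hurwitz' theorem at a boundary point of one variable; the quantitative lower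
   bound of [stable1_lower] replaces compactness. *)
Lemma slice_torus_stable q y : stable2 q -> `|y| = 1 ->
  slice y q = 0 \/ stable1 (slice y q).
Proof.
move=> st y1; set f := slice y q.
have [|f0] := eqVneq f 0; [by left|right] => x x1.
apply: contraNneq f0 => fx0.
have fb b : f.[b] = 0.
  pose n := (size q).-1.
  have szq t : (size (slice t q) <= n.+1)%N.
    exact: leq_trans (size_slice _ _) (leqSpred _).
  pose r := 1 + `|b|.
  have r0 : 0 <= r by rewrite addr_ge0.
  have [K K0 qK] := horner2_lipschitz q r0.
  have x1' := ltW x1; have xr : `|x| <= r by rewrite (le_trans x1') // lerDl.
  have br : `|b| <= r by rewrite lerDr.
  apply/eqP; rewrite -normr_le0.
  have c0 : 0 < (1 - `|x|) ^+ n by rewrite exprn_gt0 // subr_gt0.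
  rewrite -(pmulr_lle0 _ c0) mulrC.
  pose A := (1 - `|x|) ^+ n; pose B := (1 + `|b|) ^+ n.
  have A0 : 0 <= A by exact: ltW.
  have B0 : 0 <= B by rewrite exprn_ge0.
  apply: (@le_of_lt1_slack _ _ (K * A + K * B)).
  - by rewrite realE mulr_ge0.
  - exact: real0.
  - by rewrite addr_ge0 ?mulr_ge0.
  move=> d d0 d1.
  have dd : `|(1 - d) * y| = 1 - d.
    by rewrite normrM y1 mulr1 ger0_norm // subr_ge0 ltW.
  have dy1 : `|(1 - d) * y| < 1 by rewrite dd gtrBl.
  have ydy : `|y - (1 - d) * y| = d.
    rewrite mulrBl mul1r opprB addrC subrK normrM y1 mulr1 ger0_norm //.
    exact: ltW.
  have lo := stable1_lower b (szq _) (slice_stable st dy1) x1'.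
  rewrite !horner_slice -/A -/B in lo.
  have yr : `|y| <= r by rewrite y1 lerDl.
  have dyr : `|(1 - d) * y| <= r by rewrite (le_trans (ltW dy1)) // lerDl.
  have := qK _ _ _ _ br yr br dyr; rewrite subrr normr0 add0r ydy => H1.
  have := qK _ _ _ _ xr yr xr dyr; rewrite subrr normr0 add0r ydy => H2.
  have {}H1 : `|f.[b]| <= `|q.[b, (1 - d) * y]| + K * d.
    rewrite horner_slice -lerBlDl; apply: le_trans H1.
    exact: lerB_dist.
  have {}H2 : `|q.[x, (1 - d) * y]| <= K * d.
    by move: H2; rewrite -[q.[x, y]]horner_slice fx0 sub0r normrN.
  rewrite add0r mulrDl mulrC; apply: le_trans (ler_wpM2r A0 H1) _.
  rewrite mulrDl addrC [K * d * A]mulrAC lerD2l (le_trans lo) //.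
  by rewrite [K * B * d]mulrAC ler_wpM2r.
apply/eqP/polyP => i; rewrite coef0.
have [f0|f0] := eqVneq f 0; first by rewrite f0 coef0.
suff : ~ (exists z : C, ~~ root f z) by case; apply/closed_nonrootP.
by case=> z; rewrite rootE fb eqxx.
Qed.

(** [stable1_lower] with b = 0 is used twice: in the first variable on the slice at y, then in the
    second variable on the line x = 0. *)
Lemma stable2_lower q n1 n2 (r x y : C) : stable2 q ->
  (size q <= n1.+1)%N -> (sizeY q <= n2.+1)%N -> r < 1 ->
  `|x| <= r -> `|y| <= r ->
  `|q.[0, 0]| * (1 - r) ^+ (n1 + n2) <= `|q.[x, y]|.
Proof.
move=> st sz1 sz2 r1 xr yr.
have x1 := le_lt_trans xr r1; have y1 := le_lt_trans yr r1.
have r1' : 0 <= 1 - r by rewrite subr_ge0 ltW.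
have szs : (size (slice y q) <= n1.+1)%N by apply: leq_trans (size_slice _ _) _.
have := stable1_lower 0 szs (slice_stable st y1) (ltW x1).
rewrite !horner_slice normr0 addr0 expr1n mulr1; apply: le_trans.
have sz0 : (size (slice 0 (swapXY q)) <= n2.+1)%N.
  by apply: leq_trans (size_slice _ _) _; rewrite -sizeYE.
have st0 : stable1 (slice 0 (swapXY q)).
  by move=> z z1; rewrite slice_swapXY st ?normr0 ?ltr01.
have := stable1_lower 0 sz0 st0 (ltW y1).
rewrite slice_swapXY normr0 addr0 expr1n mulr1 => H.
rewrite exprD mulrCA mulrC; apply: ler_pM => //.
- by rewrite mulr_ge0 ?exprn_ge0.
- by rewrite exprn_ge0.
- apply: le_trans H; rewrite ler_wpM2l // lerXn2r // ?nnegrE //.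
    by rewrite subr_ge0 ltW.
  by rewrite lerD2l lerN2.
rewrite lerXn2r // ?nnegrE ?subr_ge0 ?(ltW x1) //.
by rewrite lerD2l lerN2.
Qed.

Hypothesis archC : forall x : C, exists n : nat, `|x| <= n%:R.

Lemma expr_lt_eps (r e : C) : 0 <= r -> r < 1 -> 0 < e ->
  exists n, forall m, (n <= m)%N -> r ^+ m <= e.
Proof.
move=> r0 r1 e0.
suff [n rn] : exists n, r ^+ n <= e.
  exists n => m nm; apply: le_trans rn; rewrite -(subnK nm) exprD.
  by rewrite ler_piMl ?exprn_ge0 // exprn_ile1 // ltW.
have [r00|rn0] := eqVneq r 0.
  by exists 1%N; rewrite r00 expr1 ltW.
have {}r0 : 0 < r by rewrite lt_def rn0.
pose h := r^-1 - 1.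
have h0 : 0 < h by rewrite subr_gt0 invf_gt1.
have [n hn] := archC ((e * h)^-1).
exists n; rewrite -[r]invrK exprVn -[e]invrK lef_pV2 ?posrE ?invr_gt0 ?exprn_gt0 ?invr_gt0 //.
have -> : r^-1 = 1 + h by rewrite /h addrC subrK.
have eh0 : 0 < e * h by rewrite mulr_gt0.
apply: (@le_trans _ _ (n%:R * h)); last first.
  by apply: le_trans (bernoulli n (ltW h0)); rewrite lerDr.
move: hn; rewrite ger0_norm ?invr_ge0 ?(ltW eh0) //.
by rewrite invfM ler_pdivrMr.
Qed.

(* The reciprocal is approximated along the path [t -> q (t x, t y)]: closeness
   to an inverse is an open condition, with a step size uniform in [t]. *)
Lemma approx_inverse q n1 n2 (r e : C) : stable2 q ->
  (size q <= n1.+1)%N -> (sizeY q <= n2.+1)%N -> 0 <= r -> r < 1 -> 0 < e ->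
  exists Q : {poly {poly C}}, forall x y, `|x| <= 1 -> `|y| <= 1 ->
    `|1 - q.[r * x, r * y] * Q.[x, y]| <= e.
Proof.
move=> st sz1 sz2 r0 r1 e0.
pose m := `|q.[0, 0]| * (1 - r) ^+ (n1 + n2).
have m0 : 0 < m by rewrite mulr_gt0 ?normr_gt0 ?st ?normr0 ?ltr01 // exprn_gt0 ?subr_gt0.
have low t x y : 0 <= t -> t <= r -> `|x| <= 1 -> `|y| <= 1 -> m <= `|q.[t * x, t * y]|.
  move=> t0 tr x1 y1; apply: stable2_lower => //.
    by rewrite normrM ger0_norm // (le_trans _ tr) // ler_piMr.
  by rewrite normrM ger0_norm // (le_trans _ tr) // ler_piMr.
have [K0 K00 lip0] := horner2_lipschitz q (@ler01 C).
pose K := K0 + 1; have K1 : 0 < K by rewrite ltr_wpDl.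
have lip t t' x y : 0 <= t -> t <= 1 -> 0 <= t' -> t' <= 1 -> `|x| <= 1 -> `|y| <= 1 ->
    `|q.[t' * x, t' * y] - q.[t * x, t * y]| <= K * (`|t' - t| *+ 2).
  move=> t0 t1 t0' t1' x1 y1.
  have b s z : 0 <= s -> s <= 1 -> `|z| <= 1 -> `|s * z| <= 1.
    by move=> s0 s1 z1; rewrite normrM ger0_norm // mulr_ile1.
  apply: (le_trans (lip0 _ _ _ _ _ _ _ _)); rewrite ?b //.
  rewrite -!mulrBl !normrM ler_pM ?addr_ge0 ?mulr_ge0 ?lerDl //.
  by rewrite mulr2n lerD // ler_piMr.
pose P t := exists Q : {poly {poly C}}, forall x y, `|x| <= 1 -> `|y| <= 1 ->
    `|1 - q.[t * x, t * y] * Q.[x, y]| <= 2^-1.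
have half0 : 0 <= 2^-1 :> C by rewrite invr_ge0 ler0n.
(* The error 1/2 is first squared to 1/4, which gives |Q'| <= (5/4)/m. Moving t by eta changes q by
   at most 2 K eta = m/5, hence q Q' by at most 1/4, and the error is again at most 1/2. *)
pose eta := m / (K * 10%:R).
have eta0 : 0 < eta by rewrite divr_gt0 // mulr_gt0 // ltr0n.
have step t t' : 0 <= t -> t <= r -> 0 <= t' -> t' <= r -> `|t' - t| <= eta -> P t -> P t'.
  move=> t0 tr t0' tr' tt' [Q HQ].
  (* A Newton step for the inverse: 1 - q Q' = (1 - q Q)^2. *)
  pose Q' := Q * (2%:P%:P - dilate t t q * Q).
  exists Q' => x y x1 y1.
  have HQ' : `|1 - q.[t * x, t * y] * Q'.[x, y]| <= 4^-1.
    have -> : 1 - q.[t * x, t * y] * Q'.[x, y] = (1 - q.[t * x, t * y] * Q.[x, y]) ^+ 2.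
      by rewrite /Q' !(hornerM, hornerD, hornerN, hornerC) horner_dilate; ring.
    have -> : 4^-1 = 2^-1 ^+ 2 :> C by rewrite expr2 -invfM -natrM.
    by rewrite normrX lerXn2r ?nnegrE ?HQ.
  have lt0 := low _ _ _ t0 tr x1 y1.
  have Q'm : m * `|Q'.[x, y]| <= 5 / 4.
    apply: le_trans (ler_wpM2r (normr_ge0 _) lt0) _; rewrite -normrM.
    have -> : q.[t * x, t * y] * Q'.[x, y] = 1 - (1 - q.[t * x, t * y] * Q'.[x, y]) by ring.
    rewrite (le_trans (ler_normB _ _)) // normr1.
    have -> : 5 / 4 = 1 + 4^-1 :> C by field.
    by rewrite lerD2l.
  have -> : 1 - q.[t' * x, t' * y] * Q'.[x, y] = 1 - q.[t * x, t * y] * Q'.[x, y] -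
     (q.[t' * x, t' * y] - q.[t * x, t * y]) * Q'.[x, y] by ring.
  rewrite (le_trans (ler_normB _ _)) //.
  have -> : 2^-1 = 4^-1 + 4^-1 :> C by field.
  rewrite lerD // normrM.
  have lt' := lip t t' x y t0 (le_trans tr (ltW r1)) t0' (le_trans tr' (ltW r1)) x1 y1.
  apply: le_trans (ler_wpM2r (normr_ge0 _) lt') _.
  have : K * (`|t' - t| *+ 2) <= m / 5%:R.
    have -> : m / 5%:R = K * (eta *+ 2).
      rewrite /eta; field; rewrite gt_eqF //=; apply/andP; split => //; exact: lt0r_neq0.
    by rewrite ler_wpM2l ?(ltW K1) // lerMn2r.
  move/(ler_wpM2r (normr_ge0 Q'.[x, y]))/le_trans; apply.
  rewrite mulrAC ler_pdivrMr ?ltr0n // (le_trans Q'm) //.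
  by have -> : 4^-1 * 5 = 5 / 4 :> C by field.
have P0 : P 0.
  exists (q.[0, 0])^-1%:P%:P => x y _ _; rewrite !hornerC !mul0r mulfV ?subrr ?normr0 //.
  by rewrite st // normr0.
have [N hN] := archC (r / eta).
have etaN : r <= N.+1%:R * eta.
  have hr : `|r / eta| = r / eta by rewrite ger0_norm // divr_ge0 // ltW.
  move: hN; rewrite hr ler_pdivrMr // => /le_trans; apply.
  by rewrite ler_wpM2r ?(ltW eta0) // ler_nat.
have N0 : 0 < N.+1%:R :> C by rewrite ltr0n.
have Pj j : (j <= N.+1)%N -> P (j%:R * (r / N.+1%:R)).
  elim: j => [|j IH] jN; first by rewrite mul0r.
  have b i : (i <= N.+1)%N -> 0 <= i%:R * (r / N.+1%:R) <= r.
    move=> iN; rewrite mulr_ge0 ?divr_ge0 ?ler0n //= mulrA ler_pdivrMr // mulrC.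
    by rewrite ler_wpM2l // ler_nat.
  have /andP[b1 b2] := b _ (ltnW jN); have /andP[b3 b4] := b _ jN.
  apply: (step _ _ b1 b2 b3 b4) (IH (ltnW jN)).
  rewrite -mulrBl -natrB // subSnn mul1r ger0_norm ?divr_ge0 ?ler0n //.
  by rewrite ler_pdivrMr // mulrC.
have [Q HQ] : P r by have := Pj _ (leqnn N.+1); rewrite mulrC divfK // gt_eqF.
have half1 : 2^-1 < 1 :> C by rewrite invf_lt1 ?ltr0n // ltr1n.
have [k hk] := expr_lt_eps half0 half1 e0.
(* Partial sums of the Neumann series started from Q have an error that is an exact power. *)
suff [Qk HQk] : exists Qk : {poly {poly C}}, forall x y,
    1 - q.[r * x, r * y] * Qk.[x, y] = (1 - q.[r * x, r * y] * Q.[x, y]) ^+ k.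
  exists Qk => x y x1 y1; rewrite HQk normrX.
  by apply: le_trans (hk _ (leqnn k)); rewrite lerXn2r ?nnegrE ?HQ.
elim: (k) => [|j [Qj HQj]]; first by exists 0 => x y; rewrite !horner0 mulr0 subr0 expr0.
exists (Qj + (1 - dilate r r q * Qj) * Q) => x y.
by rewrite exprSr -HQj !(hornerM, hornerD, hornerN, hornerC) horner_dilate; ring.
Qed.

End TwoVariables.

(** * Parseval's identity and the Szego form *)

Section Parseval.
Variable C : numClosedFieldType.

Lemma sqr_norm_sum (I : finType) (F : I -> C) :
  `|\sum_i F i| ^+ 2 = \sum_i \sum_j F i * (F j)^*.
Proof.
rewrite normCK rmorph_sum mulr_suml; apply: eq_bigr => i _.
by rewrite mulr_sumr.
Qed.

Lemma cauchy_schwarz (I : finType) (u v : I -> C) :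
  `|\sum_i u i * v i| ^+ 2 <= (\sum_i `|u i| ^+ 2) * (\sum_i `|v i| ^+ 2).
Proof.
set P := \sum_i u i * v i; set U := \sum_i `|u i| ^+ 2.
set V := \sum_i `|v i| ^+ 2.
have V0 : 0 <= V by apply: sumr_ge0 => i _; rewrite exprn_ge0.
have [V00|Vn0] := eqVneq V 0.
  have v0 i : v i = 0.
    apply/eqP; rewrite -normr_eq0 -sqrf_eq0.
    by have /psumr_eq0P -> := V00 => // j _; rewrite exprn_ge0.
  rewrite V00 mulr0 /P big1 ?normr0 ?expr0n // => i _.
  by rewrite v0 mulr0.
have {}V0 : 0 < V by rewrite lt_def Vn0.
rewrite -(ler_pM2r V0) -subr_ge0.
have -> : U * V * V - `|P| ^+ 2 * V = \sum_i `|V * u i - P * (v i)^*| ^+ 2.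
  have VR : V^* = V by rewrite conj_Creal // realE ltW.
  have E i : `|V * u i - P * (v i)^*| ^+ 2 =
     V * V * `|u i| ^+ 2 - V * P^* * (u i * v i) - V * P * (u i * v i)^*
       + P * P^* * `|v i| ^+ 2.
    rewrite !normCK !(rmorphB, rmorphM) /= conjCK VR; ring.
  rewrite (eq_bigr _ (fun i _ => E i)) !big_split /= -!mulr_sumr.
  rewrite -/U -/V !sumrN -!mulr_sumr -/P -rmorph_sum -/P normCK; ring.
by apply: sumr_ge0 => i _; rewrite exprn_ge0.
Qed.

Variables (N : nat) (w : C).
Hypothesis prim_w : N.-primitive_root w.

Lemma prim_root_gt0 : (0 < N)%N.
Proof. exact: prim_order_gt0 prim_w. Qed.

Lemma norm_prim_root : `|w| = 1.
Proof.
have := congr1 (fun x => `|x|) (prim_expr_order prim_w).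
rewrite normrX normr1 => /eqP; rewrite pexpr_eq1 ?prim_root_gt0 //.
by move/eqP.
Qed.

Lemma sum_prim_root (a b : 'I_N) :
  \sum_(k < N) w ^+ (a * k) * (w ^+ (b * k))^* = (a == b)%:R * N%:R.
Proof.
pose u := w ^+ a * (w ^+ b)^*.
have w0 : w != 0 by rewrite -normr_gt0 norm_prim_root ltr01.
have cw : w^* = w^-1 by rewrite invC_norm norm_prim_root expr1n invr1 mul1r.
have -> : \sum_(k < N) w ^+ (a * k) * (w ^+ (b * k))^* = \sum_(k < N) u ^+ k.
  by apply: eq_bigr => k _; rewrite /u !exprM exprMn rmorphXn.
have uN : u ^+ N = 1.
  by rewrite /u exprMn rmorphXn /= -!exprM !(mulnC _ N) !exprM cw exprVn (prim_expr_order prim_w) invr1 !expr1n mulr1.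
have [ab|ab] := eqVneq a b.
  have -> : u = 1.
    by rewrite /u ab rmorphXn /= cw exprVn mulfV // expf_neq0.
  by rewrite mul1r; under eq_bigr do rewrite expr1n; rewrite sumr_const card_ord.
have u1 : u != 1.
  apply: contra ab; rewrite /u rmorphXn /= cw exprVn => /eqP E.
  have /eqP : w ^+ a = w ^+ b.
    by rewrite -[LHS]mulr1 -(mulVf (expf_neq0 b w0)) mulrA E mul1r.
  by rewrite (eq_prim_root_expr prim_w) !modn_small.
have /eqP : (u - 1) * (\sum_(k < N) u ^+ k) = 0 by rewrite -subrX1 uN subrr.
by rewrite mulf_eq0 subr_eq0 (negPf u1) /= => /eqP ->; rewrite mul0r.
Qed.

Lemma parseval (h : 'I_N -> C) :
  \sum_(k < N) `|\sum_(a < N) h a * w ^+ (a * k)| ^+ 2 =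
  N%:R * \sum_(a < N) `|h a| ^+ 2.
Proof.
under eq_bigr => k _ do rewrite sqr_norm_sum.
rewrite exchange_big /= mulr_sumr; apply: eq_bigr => a _.
rewrite exchange_big /= (bigD1 a) //= [X in _ + X]big1 ?addr0.
  under eq_bigr => k _ do rewrite rmorphM mulrACA.
  by rewrite -mulr_sumr sum_prim_root eqxx mul1r mulrC normCK.
move=> b ab; under eq_bigr => k _ do rewrite rmorphM mulrACA.
by rewrite -mulr_sumr sum_prim_root eq_sym (negPf ab) mul0r mulr0.
Qed.

Lemma parseval2 (h : 'I_N -> 'I_N -> C) :
  \sum_(k < N) \sum_(l < N)
    `|\sum_(a < N) \sum_(b < N) h a b * w ^+ (b * l) * w ^+ (a * k)| ^+ 2 =
  N%:R ^+ 2 * \sum_(a < N) \sum_(b < N) `|h a b| ^+ 2.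
Proof.
rewrite exchange_big /=.
under eq_bigr => l _.
  under eq_bigr => k _ do under eq_bigr => a _ do rewrite -mulr_suml.
  rewrite (parseval (fun a => \sum_(b < N) h a b * w ^+ (b * l))).
over.
rewrite -mulr_sumr exchange_big /= expr2 -mulrA; congr (_ * _).
rewrite mulr_sumr; apply: eq_bigr => a _; exact: parseval.
Qed.

Lemma horner2_coef (q : {poly {poly C}}) m n x y :
  (size q <= m)%N -> (sizeY q <= n)%N ->
  q.[x, y] = \sum_(i < m) \sum_(j < n) q`_i`_j * y ^+ j * x ^+ i.
Proof.
move=> qm qn; rewrite (horner_coef_wide _ qm) horner_sum; apply: eq_bigr => i _.
rewrite hornerM -polyC_exp hornerC mulrC.
rewrite (horner_coef_wide _ (leq_trans (max_size_coefXY _ _) qn)) mulr_sumr.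
by apply: eq_bigr => j _; rewrite mulrC.
Qed.

Lemma parseval_horner2 (q : {poly {poly C}}) : (size q <= N)%N -> (sizeY q <= N)%N ->
  \sum_(k < N) \sum_(l < N) `|q.[w ^+ k, w ^+ l]| ^+ 2 =
  N%:R ^+ 2 * \sum_(i < N) \sum_(j < N) `|q`_i`_j| ^+ 2.
Proof.
move=> s1 s2; rewrite -(parseval2 (fun i j => q`_i`_j)).
apply: eq_bigr => k _; apply: eq_bigr => l _; congr (`|_| ^+ 2).
rewrite (horner2_coef _ _ s1 s2); apply: eq_bigr => i _; apply: eq_bigr => j _.
by rewrite -!exprM ![(_ * nat_of_ord i)%N]mulnC ![(_ * nat_of_ord j)%N]mulnC.
Qed.

End Parseval.

(** * Multiplication by a bounded polynomial contracts the Szego form *)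

Section SzegoForm.
Variable C : numClosedFieldType.
Hypothesis archC : forall x : C, exists n : nat, `|x| <= n%:R.
Hypothesis prim_root_ex : forall N, (0 < N)%N -> exists w : C, N.-primitive_root w.

Section Form.
Variables (I : finType) (X Y : I -> C).
Implicit Types (c : I -> C) (P : {poly {poly C}}).

(** The squared norm of the functional f |-> sum_i c_i f(X_i, Y_i) on polynomials of degree below L
    in each variable, monomials being orthonormal. It is also [szego_form] with both geometric
    series cut at order L. *)
Definition trunc_form L c : C :=
  \sum_(k < L) \sum_(l < L) `|\sum_i c i * (X i ^+ k * Y i ^+ l)| ^+ 2.

Definition szego i j : C := ((1 - X i * (X j)^*) * (1 - Y i * (Y j)^*))^-1.

Definition szego_form c : C := \sum_i \sum_j c i * (c j)^* * szego i j.

(** Duality: the polynomial m whose coefficients are the conjugated values of the functional on P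
    x^k y^l satisfies lam (P m) = S and has squared coefficient norm S. Cauchy-Schwarz bounds S^2 by
    the squared norm of P m times the form of order L + d, and Parseval bounds that norm by M^2
    S. *)
Lemma trunc_form_contract P (d L : nat) (M : C) c : 0 <= M ->
  (size P <= d.+1)%N -> (sizeY P <= d.+1)%N ->
  (forall x y, `|x| = 1 -> `|y| = 1 -> `|P.[x, y]| <= M) ->
  trunc_form L (fun i => c i * P.[X i, Y i]) <= M ^+ 2 * trunc_form (L + d) c.
Proof.
move=> M0 s1 s2 PM; case: L => [|L].
  rewrite /trunc_form big_ord0 mulr_ge0 ?exprn_ge0 //.
  by do 2 apply: sumr_ge0 => ? _; rewrite exprn_ge0.
set N := (L.+1 + d)%N.
have [w prim_w] := prim_root_ex (isT : (0 < N)%N).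
pose s k l := (\sum_i c i * P.[X i, Y i] * (X i ^+ k * Y i ^+ l))^*.
pose m : {poly {poly C}} := \poly_(k < L.+1) \poly_(l < L.+1) s k l.
pose lam (q : {poly {poly C}}) := \sum_i c i * q.[X i, Y i].
have sm1 : (size m <= L.+1)%N by apply: size_poly.
have sm2 : (sizeY m <= L.+1)%N.
  apply/bigmax_leqP => i _; rewrite coef_poly; case: ifP => _.
    exact: size_poly.
  by rewrite size_poly0.
set S := trunc_form _ _.
have SE : S = \sum_(k < L.+1) \sum_(l < L.+1) `|s k l| ^+ 2.
  by do 2 apply: eq_bigr => ? _; rewrite /s norm_conjC.
have S0 : 0 <= S by rewrite SE; do 2 apply: sumr_ge0 => ? _; rewrite exprn_ge0.
pose g := P * m.
have sg1 : (size g <= N)%N.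
  apply: leq_trans (size_polyMleq _ _) _; rewrite /N; move: s1 sm1; lia.
have sg2 : (sizeY g <= N)%N.
  rewrite sizeYE rmorphM /=; apply: leq_trans (size_polyMleq _ _) _.
  by rewrite -!sizeYE /N; move: s2 sm2; lia.
have rearr (a b x y : C) : a * (b * y * x) = b * (a * (x * y)) by ring.
have lamg : lam g = S.
  rewrite /lam SE.
  under eq_bigr => i _.
    rewrite /g !hornerM mulrA (horner2_coef _ _ sm1 sm2) mulr_sumr.
    under eq_bigr => k _.
      rewrite mulr_sumr; under eq_bigr => l _.
        rewrite coef_poly ltn_ord coef_poly ltn_ord rearr.
      over.
    over.
  over.
  rewrite exchange_big; apply: eq_bigr => k _ /=.
  rewrite exchange_big; apply: eq_bigr => l _ /=.
  by rewrite -mulr_sumr normCK [s k l in RHS]/s conjCK -/(s k l).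
have pars := parseval_horner2 prim_w sg1 sg2.
have parsm : (size m <= N)%N /\ (sizeY m <= N)%N.
  by split; apply: leq_trans (leq_addr _ _).
have {parsm} parsm := parseval_horner2 prim_w parsm.1 parsm.2.
have N0 : 0 < N%:R ^+ 2 :> C by rewrite exprn_gt0 // ltr0n.
pose G := \sum_(i < N) \sum_(j < N) `|g`_i`_j| ^+ 2.
have Gle : G <= M ^+ 2 * S.
  have E : \sum_(i < N) \sum_(j < N) `|m`_i`_j| ^+ 2 = S.
    rewrite SE /N.
    have F (H : nat -> C) : (forall i, (L.+1 <= i)%N -> H i = 0) ->
        \sum_(i < L.+1 + d) H i = \sum_(i < L.+1) H i.
      move=> H0; rewrite big_split_ord /= [X in _ + X]big1 ?addr0 // => i _.
      by rewrite H0 // leq_addr.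
    rewrite (F (fun i => \sum_(j < L.+1 + d) `|m`_i`_j| ^+ 2)); last first.
      move=> i Li; apply: big1 => j _.
      by rewrite coef_poly ltnNge Li /= coef0 normr0 expr0n.
    apply: eq_bigr => k _; rewrite (F (fun j => `|m`_k`_j| ^+ 2)).
      by apply: eq_bigr => l _; rewrite coef_poly ltn_ord coef_poly ltn_ord.
    move=> j Lj; rewrite coef_poly ltn_ord coef_poly ltnNge Lj /=.
    by rewrite normr0 expr0n.
  rewrite -E -(ler_pM2l N0) -pars mulrCA -parsm mulr_sumr.
  apply: ler_sum => k _; rewrite mulr_sumr; apply: ler_sum => l _.
  rewrite !hornerM normrM exprMn ler_wpM2r ?exprn_ge0 //.
  have nw := norm_prim_root prim_w.
  by rewrite lerXn2r ?nnegrE // PM // normrX nw expr1n.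
have CS : S ^+ 2 <= G * trunc_form N c.
  rewrite -[S]ger0_norm // -lamg /lam.
  have -> : \sum_i c i * g.[X i, Y i] =
     \sum_(k : 'I_N * 'I_N) g`_k.1`_k.2 * \sum_i c i * (X i ^+ k.1 * Y i ^+ k.2).
    under eq_bigr => i _.
      rewrite (horner2_coef _ _ sg1 sg2) mulr_sumr.
      under eq_bigr => k _.
        rewrite mulr_sumr; under eq_bigr => l _.
          rewrite rearr.
        over.
      over.
    over.
    rewrite exchange_big -(pair_bigA _ (fun k l =>
      g`_(nat_of_ord k)`_(nat_of_ord l) * \sum_i c i * (X i ^+ k * Y i ^+ l))) /=.
    apply: eq_bigr => k _; rewrite exchange_big; apply: eq_bigr => l _ /=.
    by rewrite mulr_sumr.
  apply: le_trans (cauchy_schwarz _ _) _.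
  by rewrite /G /trunc_form !pair_bigA.
have T0 : 0 <= trunc_form N c.
  by do 2 apply: sumr_ge0 => ? _; rewrite exprn_ge0.
have [->|Sn0] := eqVneq S 0; first by rewrite mulr_ge0 ?exprn_ge0.
have {}Sn0 : 0 < S by rewrite lt_def Sn0.
rewrite -(ler_pM2l Sn0) -expr2 (le_trans CS) // mulrCA mulrA.
exact: ler_wpM2r.
Qed.

Lemma trunc_form_ge0 L c : 0 <= trunc_form L c.
Proof. by do 2 apply: sumr_ge0 => ? _; rewrite exprn_ge0. Qed.

Lemma szego_conj i j : (szego i j)^* = szego j i.
Proof.
rewrite /szego fmorphV !rmorphM !rmorphB !rmorphM /= !conjCK rmorph1.
by rewrite [X j * _]mulrC [Y j * _]mulrC.
Qed.

Lemma szego_form_real c : szego_form c \is Num.real.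
Proof.
rewrite CrealE /szego_form rmorph_sum /=; apply/eqP.
under eq_bigr => i _ do rewrite rmorph_sum /=.
rewrite exchange_big; do 2 apply: eq_bigr => ? _ /=.
by rewrite !rmorphM /= conjCK szego_conj [_^* * _]mulrC.
Qed.

Variable rho : C.
Hypotheses (rho0 : 0 <= rho) (rho1 : rho < 1).
Hypotheses (Xrho : forall i, `|X i| <= rho) (Yrho : forall i, `|Y i| <= rho).

Lemma trunc_form_lim c : exists2 K : C, 0 <= K &
  forall L, `|trunc_form L c - szego_form c| <= K * rho ^+ L.
Proof.
(* Replacing (1 - a^L)(1 - b^L) by 1 costs a^L b^L - a^L - b^L, three terms of modulus at most
   rho^L. *)
pose K := \sum_i \sum_j `|c i * (c j)^* * szego i j| * 3%:R.
exists K; first by do 2 apply: sumr_ge0 => ? _; rewrite mulr_ge0 ?ler0n.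
move=> L.
have geom (a : C) : `|a| < 1 -> \sum_(k < L) a ^+ k = (1 - a ^+ L) * (1 - a)^-1.
  move=> a1; have a0 : 1 - a != 0.
    by rewrite subr_eq0 eq_sym; apply: contraTneq a1 => ->; rewrite normr1 ltxx.
  apply: (mulIf a0); rewrite mulfVK // mulrC -opprB mulNr -subrX1.
  by rewrite opprB.
have small Z i j : (forall i, `|Z i| <= rho) -> `|Z i * (Z j)^*| <= rho.
  move=> Zr; rewrite normrM norm_conjC (le_trans _ (Zr i)) //.
  by rewrite ler_piMr // (le_trans (Zr j)) // ltW.
pose a i j := X i * (X j)^*; pose b i j := Y i * (Y j)^*.
have TE : trunc_form L c = \sum_i \sum_j c i * (c j)^* * szego i j *
    ((1 - a i j ^+ L) * (1 - b i j ^+ L)).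
  rewrite /trunc_form.
  under eq_bigr => k _ do under eq_bigr => l _ do rewrite sqr_norm_sum.
  under eq_bigr => k _ do rewrite exchange_big /=.
  rewrite exchange_big; apply: eq_bigr => i _ /=.
  under eq_bigr => k _ do rewrite exchange_big /=.
  rewrite exchange_big; apply: eq_bigr => j _ /=.
  have ha := geom _ (le_lt_trans (small _ X i j Xrho) rho1).
  have hb := geom _ (le_lt_trans (small _ Y i j Yrho) rho1).
  rewrite -/(a i j) in ha; rewrite -/(b i j) in hb.
  have -> : szego i j = (1 - a i j)^-1 * (1 - b i j)^-1 by rewrite /szego invfM.
  transitivity (c i * (c j)^* * ((\sum_(k < L) a i j ^+ k) * (\sum_(k < L) b i j ^+ k))).
    rewrite mulr_suml mulr_sumr; apply: eq_bigr => k _.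
    rewrite !mulr_sumr; apply: eq_bigr => l _.
    rewrite !rmorphM !rmorphXn /= /a /b !exprMn; ring.
  rewrite ha hb; ring.
rewrite TE /szego_form -sumrB (le_trans (ler_norm_sum _ _ _)) // mulr_suml.
apply: ler_sum => i _; rewrite -sumrB (le_trans (ler_norm_sum _ _ _)) // mulr_suml.
apply: ler_sum => j _.
rewrite -[X in _ - X]mulr1 -mulrBr normrM -[leRHS]mulrA ler_wpM2l //.
have -> : (1 - a i j ^+ L) * (1 - b i j ^+ L) - 1 =
  a i j ^+ L * b i j ^+ L - a i j ^+ L - b i j ^+ L by ring.
have aL : `|a i j ^+ L| <= rho ^+ L.
  by rewrite normrX lerXn2r ?nnegrE // small.
have bL : `|b i j ^+ L| <= rho ^+ L.
  by rewrite normrX lerXn2r ?nnegrE // small.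
have rL : rho ^+ L <= 1 by rewrite exprn_ile1 // ltW.
rewrite (le_trans (ler_normB _ _)) //.
have -> : 3%:R * rho ^+ L = rho ^+ L + rho ^+ L + rho ^+ L by ring.
rewrite lerD // (le_trans (ler_normB _ _)) // lerD // normrM.
by rewrite (le_trans _ aL) // ler_piMr // (le_trans bL).
Qed.

Lemma szego_form_ge0 c : 0 <= szego_form c.
Proof.
have [K K0 HK] := trunc_form_lim c.
apply: (@le_of_lt1_slack _ _ _ K) => //; first exact: szego_form_real.
move=> d d0 d1; have [n hn] := expr_lt_eps archC rho0 rho1 d0.
have h1 := HK n; have h2 := ler_wpM2l K0 (hn n (leqnn n)).
apply: le_trans (trunc_form_ge0 n c) _.
rewrite addrC -lerBlDr (le_trans _ h2) // (le_trans _ h1) //.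
apply: real_ler_norm; rewrite realB ?szego_form_real //.
by rewrite realE trunc_form_ge0.
Qed.

(** The limit of [trunc_form_contract]: the shift of the truncation order by d disappears as L
    grows. It amounts to positivity of the kernel (M^2 - P(z) conj P(w)) S(z, w). *)
Lemma szego_form_contract P (M : C) c : 0 <= M ->
  (forall x y, `|x| = 1 -> `|y| = 1 -> `|P.[x, y]| <= M) ->
  szego_form (fun i => c i * P.[X i, Y i]) <= M ^+ 2 * szego_form c.
Proof.
move=> M0 PM; pose d := maxn (size P) (sizeY P).
have s1 : (size P <= d.+1)%N by rewrite leqW // leq_maxl.
have s2 : (sizeY P <= d.+1)%N by rewrite leqW // leq_maxr.
set c' := fun i => _.
have [K K0 HK] := trunc_form_lim c; have [K' K0' HK'] := trunc_form_lim c'.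
have M20 : 0 <= M ^+ 2 by rewrite exprn_ge0.
apply: (@le_of_lt1_slack _ _ _ (K' + M ^+ 2 * K)).
- exact: szego_form_real.
- by rewrite realM ?szego_form_real // realE M20.
- by rewrite addr_ge0 ?mulr_ge0.
move=> e e0 e1; have [n hn] := expr_lt_eps archC rho0 rho1 e0.
have Tr k u : trunc_form k u \is Num.real by rewrite realE trunc_form_ge0.
have h1 : szego_form c' <= trunc_form n c' + K' * e.
  rewrite addrC -lerBlDr (le_trans _ (ler_wpM2l K0' (hn n (leqnn n)))) //.
  rewrite (le_trans _ (HK' n)) // distrC real_ler_norm //.
  by rewrite realB ?szego_form_real.
have h2 : trunc_form (n + d) c <= szego_form c + K * e.
  rewrite addrC -lerBlDr (le_trans _ (ler_wpM2l K0 (hn (n + d)%N (leq_addr _ _)))) //.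
  rewrite (le_trans _ (HK _)) // real_ler_norm //.
  by rewrite realB ?szego_form_real.
apply: (le_trans h1).
rewrite mulrDl addrA addrAC lerD2r -mulrA -mulrDr.
apply: le_trans (ler_wpM2l M20 h2).
exact: trunc_form_contract.
Qed.

Lemma szego_form_lipschitz (B : C) : 0 <= B -> exists2 K : C, 0 <= K &
  forall c c' e, (forall i, `|c i| <= B) -> (forall i, `|c' i| <= B) ->
    (forall i, `|c i - c' i| <= e) ->
    `|szego_form c - szego_form c'| <= K * e.
Proof.
move=> B0; exists (\sum_i \sum_j (B + B) * `|szego i j|).
  by do 2 apply: sumr_ge0 => ? _; rewrite mulr_ge0 ?addr_ge0.
move=> c c' e cB cB' ce; rewrite /szego_form -sumrB mulr_suml.
rewrite (le_trans (ler_norm_sum _ _ _)) //; apply: ler_sum => i _.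
rewrite -sumrB mulr_suml (le_trans (ler_norm_sum _ _ _)) //.
apply: ler_sum => j _; rewrite -mulrBl normrM mulrAC ler_wpM2r //.
have -> : c i * (c j)^* - c' i * (c' j)^* =
  (c i - c' i) * (c j)^* + c' i * (c j - c' j)^* by rewrite rmorphB; ring.
rewrite (le_trans (ler_normD _ _)) // !normrM !norm_conjC mulrDl.
by rewrite lerD // [B * e]mulrC; [exact: ler_pM|rewrite mulrC; exact: ler_pM].
Qed.

End Form.
End SzegoForm.

(** * Reflections and the bound on linear functionals *)

Section Reflection.
Variable C : numClosedFieldType.
Hypothesis archC : forall x : C, exists n : nat, `|x| <= n%:R.
Hypothesis prim_root_ex : forall N, (0 < N)%N -> exists w : C, N.-primitive_root w.
Implicit Types (p q g v : {poly {poly C}}).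

(** Supplies, for finitely many points of the open disk, the common radius [rho] below 1 that the
    geometric series need. *)
Lemma max_modulus_family (I : finType) (F : I -> C) (r : C) :
  0 <= r -> r < 1 -> (forall i, `|F i| < 1) ->
  exists s : C, [/\ r <= s, s < 1 & forall i, `|F i| <= s].
Proof.
move=> r0 r1 F1.
suff [s [s1 s2 s3]] : exists s : C, [/\ r <= s, s < 1 & forall i, i \in enum I -> `|F i| <= s].
  by exists s; split=> // i; apply: s3; rewrite mem_enum.
elim: (enum I) => [|j e [s [rs s1 es]]]; first by exists r.
have sr : s \is Num.real by rewrite realE (le_trans r0).
have jr : `|F j| \is Num.real by rewrite normr_real.
have [le|lt] := real_leP jr sr.
  by exists s; split=> // i; rewrite inE => /orP[/eqP->|/es].
exists `|F j|; split=> [||i]; rewrite ?F1 ?(le_trans rs (ltW lt)) //.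
by rewrite inE => /orP[/eqP->|/es /le_trans]; [rewrite lexx|apply; apply: ltW].
Qed.

Definition reflects n1 n2 q g := forall x y : C, x != 0 -> y != 0 ->
  g.[x, y] = x ^+ n1 * y ^+ n2 * (q.[(x^*)^-1, (y^*)^-1])^*.

(** Reflection in the circle exchanges the radii 1/r and r; the power of r compensates the monomial
    x^n1 y^n2. *)
Lemma norm_reflects n1 n2 q g (r x y : C) : reflects n1 n2 q g -> 0 < r ->
  `|x| = 1 -> `|y| = 1 ->
  `|r ^+ (n1 + n2) * g.[r^-1 * x, r^-1 * y]| = `|q.[r * x, r * y]|.
Proof.
move=> qg r0 x1 y1.
have nz z : `|z| = 1 -> r^-1 * z != 0.
  move=> z1; apply: mulf_neq0; first by rewrite invr_eq0 gt_eqF.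
  by rewrite -normr_gt0 z1 ltr01.
have cz z : `|z| = 1 -> ((r^-1 * z)^*)^-1 = r * z.
  move=> z1; have zc : z^* = z^-1 by rewrite [RHS]invC_norm z1 expr1n invr1 mul1r.
  by rewrite rmorphM /= zc fmorphV invfM !invrK /= geC0_conj // ltW.
rewrite (qg _ _ (nz _ x1) (nz _ y1)) !cz // !normrM norm_conjC !normrX !normrM.
rewrite x1 y1 !mulr1 normfV ger0_norm ?ltW // mulrA exprD.
rewrite [r ^+ n1 * _ * _]mulrACA -!exprMn mulfV ?gt_eqF // !expr1n !mul1r //.
Qed.

Section Contract.
Variables (I : finType) (X Y : I -> C).
Hypotheses (X1 : forall i, `|X i| < 1) (Y1 : forall i, `|Y i| < 1).

Lemma szego_form_ge0_disc c : 0 <= szego_form X Y c.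
Proof.
have h0 : 0 <= 2^-1 :> C by rewrite invr_ge0 ler0n.
have h1 : 2^-1 < 1 :> C by rewrite invf_lt1 ?ltr0n // ltr1n.
have [s [s0 s1 Xs]] := max_modulus_family h0 h1 X1.
have [r [r0 r1 Yr]] := max_modulus_family (le_trans h0 s0) s1 Y1.
have rp : 0 <= r := le_trans h0 (le_trans s0 r0).
exact: (szego_form_ge0 archC rp r1 (fun i => le_trans (Xs i) r0) Yr).
Qed.

(** For r < 1, let Q approximate 1/q(rz). The polynomial P = r^(n1+n2) g(z/r) Q(z) has modulus at
    most 1 + d on the torus, by [norm_reflects], so [szego_form_contract] with weights c q(rz) gives
    the inequality up to an error linear in d. *)
Lemma reflection_contract n1 n2 q g (c : I -> C) : stable2 q ->
  (size q <= n1.+1)%N -> (sizeY q <= n2.+1)%N -> reflects n1 n2 q g ->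
  szego_form X Y (fun i => c i * g.[X i, Y i]) <=
  szego_form X Y (fun i => c i * q.[X i, Y i]).
Proof.
move=> st sz1 sz2 qg.
have h0 : 0 <= 2^-1 :> C by rewrite invr_ge0 ler0n.
have h1 : 2^-1 < 1 :> C by rewrite invf_lt1 ?ltr0n // ltr1n.
have [s [s0 s1 Xs]] := max_modulus_family h0 h1 X1.
have [rho [r0 r1 Yr]] := max_modulus_family (le_trans h0 s0) s1 Y1.
have rho0 : 0 <= rho := le_trans h0 (le_trans s0 r0).
have Xr i : `|X i| <= rho := le_trans (Xs i) r0.
pose H := szego_form X Y.
have Hr c' : H c' \is Num.real by exact: szego_form_real.
have [Kq Kq0 lipq] := horner2_lipschitz q (@ler01 C).
have [Kg Kg0 lipg] := horner2_lipschitz g (@ler0n C 2).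
have [Kn Kn0 lipn] := horner_lipschitz ('X^(n1 + n2)) (@ler01 C).
have [Bq Bq0 bq] := horner2_bound q (@ler01 C).
have [Bg Bg0 bg] := horner2_bound g (@ler0n C 2).
have [A A0 cA] : exists2 A : C, 0 <= A & forall i, `|c i| <= A.
  exists (\sum_i `|c i|) => [|i]; first exact: sumr_ge0.
  by rewrite (bigD1 i) //= lerDl sumr_ge0.
pose e1 := Kq + Kq; pose e2 := Bg + Bg + Kn * Bg + (Kg + Kg).
have e10 : 0 <= e1 by rewrite addr_ge0.
have e20 : 0 <= e2 by rewrite !addr_ge0 ?mulr_ge0.
pose B := A * (Bq + Bg + Bg).
have B0 : 0 <= B by rewrite mulr_ge0 ?addr_ge0.
have [K K0 lipH] := szego_form_lipschitz X Y B0.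
pose cq i := c i * q.[X i, Y i]; pose cg i := c i * g.[X i, Y i].
have Hq0 : 0 <= H cq by exact: (szego_form_ge0 archC rho0 r1 Xr Yr).
(* The factor (1 + d)^2 is at most 1 + 3 d and at most 4; A e1 d and A e2 d bound the change of the
   weights when q(rz) is replaced by q and q(rz) P by g. *)
apply: (@le_of_lt1_slack _ _ _ (3%:R * H cq + 4%:R * (K * (A * e1)) + K * (A * e2))) => //.
  by rewrite !addr_ge0 ?mulr_ge0 ?ler0n.
move=> d d0 d1.
(* With r = 1 - d/2 >= 1/2 the points z/r stay in the disk of radius 2, on which [lipg] and [bg]
   were taken. *)
have [r [rE r1' rh]] : exists r : C, [/\ 1 - r = d / 2, r < 1 & 2^-1 <= r].
  exists (1 - d / 2); split.
  - by rewrite opprB addrC subrK.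
  - by rewrite gtrBl divr_gt0 ?ltr0n.
  rewrite lerBrDr -lerBrDl; have -> : 1 - 2^-1 = 2^-1 :> C by field.
  by rewrite ler_pdivrMr ?ltr0n // mulVf ?pnatr_eq0 // ltW.
have d20 : 0 <= d / 2 by rewrite divr_ge0 ?ltW ?ltr0n.
have d2d : d / 2 <= d by rewrite ger_pMr // invf_le1 ?ltr0n // ler1n.
have r0' : 0 < r by rewrite (lt_le_trans _ rh) // invr_gt0 ltr0n.
have [Q HQ] := approx_inverse archC st sz1 sz2 (ltW r0') r1' d0.
pose P := (r ^+ (n1 + n2))%:P%:P * dilate r^-1 r^-1 g * Q.
pose qr i := q.[r * X i, r * Y i].
have PM x y : `|x| = 1 -> `|y| = 1 -> `|P.[x, y]| <= 1 + d.
  move=> x1 y1; rewrite /P !hornerM !hornerC horner_dilate normrM.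
  rewrite (norm_reflects qg) // -normrM.
  have -> : q.[r * x, r * y] * Q.[x, y] = 1 - (1 - q.[r * x, r * y] * Q.[x, y]) by ring.
  rewrite (le_trans (ler_normB _ _)) // normr1 lerD2l.
  by apply: HQ; rewrite ?x1 ?y1.
have d1p : 0 <= 1 + d by rewrite addr_ge0 // ltW.
have := szego_form_contract archC prim_root_ex rho0 r1 Xr Yr (fun i => c i * qr i) d1p PM.
set cP := fun i => _ * _ => Hcon.
have X1' i : `|X i| <= 1 := ltW (X1 i).
have Y1' i : `|Y i| <= 1 := ltW (Y1 i).
have shrink z : `|z| <= 1 -> `|r * z| <= 1.
  by move=> z1; rewrite normrM mulr_ile1 // (ger0_norm (ltW r0')) ltW.
have gap z : `|z| <= 1 -> `|r * z - z| <= d.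
  move=> z1; have -> : r * z - z = - ((d / 2) * z) by rewrite -rE; ring.
  by rewrite normrN normrM (ger0_norm d20) (le_trans _ d2d) // ler_piMr.
have rV : r^-1 <= 2%:R by rewrite -[2%:R]invrK lef_pV2 // posrE invr_gt0 ltr0n.
have grow z : `|z| <= 1 -> `|r^-1 * z| <= 2%:R.
  move=> z1; rewrite normrM normfV (ger0_norm (ltW r0')).
  by rewrite (le_trans (ler_piMr _ z1)) // invr_ge0 ltW.
have gap' z : `|z| <= 1 -> `|r^-1 * z - z| <= d.
  move=> z1; have -> : r^-1 * z - z = (1 - r) * (r^-1 * z).
    by rewrite mulrBl mul1r mulrA mulfV ?gt_eqF // mul1r.
  rewrite normrM rE (ger0_norm d20).
  by rewrite -[leRHS](@divfK _ 2%:R) ?pnatr_eq0 // ler_wpM2l ?grow.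
have le12 : 1 <= 2%:R :> C by rewrite ler1n.
have qdiff i : `|q.[r * X i, r * Y i] - q.[X i, Y i]| <= e1 * d.
  apply: le_trans (lipq _ _ _ _ _ _ _ _) _; rewrite ?shrink //.
  by rewrite mulrDl -mulrDr ler_wpM2l // lerD ?gap.
have bqr i : `|qr i| <= Bq by rewrite bq ?shrink.
have bqi i : `|q.[X i, Y i]| <= Bq by rewrite bq.
have bgi i : `|g.[X i, Y i]| <= Bg by rewrite bg // (le_trans _ le12).
have Pq i : qr i * P.[X i, Y i] =
    r ^+ (n1 + n2) * g.[r^-1 * X i, r^-1 * Y i] * (qr i * Q.[X i, Y i]).
  by rewrite /P !hornerM !hornerC horner_dilate; ring.
have bgr i : `|g.[r^-1 * X i, r^-1 * Y i]| <= Bg by rewrite bg ?grow.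
have rn1 : `|r ^+ (n1 + n2)| <= 1.
  by rewrite normrX (ger0_norm (ltW r0')) exprn_ile1 // ltW.
have bQ i : `|qr i * Q.[X i, Y i]| <= 2%:R.
  have -> : qr i * Q.[X i, Y i] = 1 - (1 - qr i * Q.[X i, Y i]) by ring.
  rewrite (le_trans (ler_normB _ _)) // normr1 -[2%:R]/(1 + 1) lerD2l.
  by rewrite (le_trans (HQ _ _ _ _)) // ltW.
have gdiff i : `|qr i * P.[X i, Y i] - g.[X i, Y i]| <= e2 * d.
  rewrite Pq; set gr := g.[r^-1 * X i, _]; set u := qr i * _; set rn := r ^+ _.
  have -> : rn * gr * u - g.[X i, Y i] =
     rn * gr * (u - 1) + (rn - 1) * gr + (gr - g.[X i, Y i]) by ring.
  rewrite /e2 [leRHS]mulrDl (le_trans (ler_normD _ _)) // lerD //; last first.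
    apply: le_trans (lipg _ _ _ _ _ _ _ _) _; rewrite ?grow ?(le_trans _ le12) //.
    by rewrite mulrDl -mulrDr ler_wpM2l // lerD ?gap'.
  rewrite (le_trans (ler_normD _ _)) // [leRHS]mulrDl lerD //.
    rewrite !normrM -[leLHS]addr0 [leRHS]mulrDl lerD //; last by rewrite mulr_ge0 // ltW.
    rewrite ler_pM ?mulr_ge0 //; last by rewrite distrC HQ.
    by rewrite -[leRHS]mul1r ler_pM ?bgr.
  rewrite normrM -mulrA [Bg * d]mulrC mulrA ler_pM ?bgr //.
  have := lipn r 1; rewrite !hornerXn expr1n => /(_ _ _)/le_trans; apply.
  - by rewrite (ger0_norm (ltW r0')) ltW.
  - by rewrite normr1.
  by rewrite ler_wpM2l // distrC rE (ger0_norm d20).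
have cB i u : `|u| <= Bq + Bg + Bg -> `|c i * u| <= B.
  by move=> ub; rewrite normrM ler_pM.
have L1 : H (fun i => c i * qr i) <= H cq + K * (A * e1) * d.
  rewrite addrC -lerBlDr.
  have -> : K * (A * e1) * d = K * (A * (e1 * d)) by rewrite !mulrA.
  rewrite (le_trans (real_ler_norm _)) ?realB //; apply: lipH.
  - by move=> i; apply: cB; rewrite -addrA (le_trans (bqr i)) // lerDl addr_ge0.
  - by move=> i; apply: cB; rewrite -addrA (le_trans (bqi i)) // lerDl addr_ge0.
  by move=> i; rewrite /cq -mulrBr normrM ler_pM // qdiff.
have L2 : H cg <= H cP + K * (A * e2) * d.
  rewrite addrC -lerBlDr.
  have -> : K * (A * e2) * d = K * (A * (e2 * d)) by rewrite !mulrA.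
  rewrite (le_trans (real_ler_norm _)) ?realB // distrC.
  apply: lipH.
  - move=> i; rewrite /cP -mulrA; apply: cB; rewrite Pq !normrM.
    rewrite -addrA (@le_trans _ _ (Bg + Bg)) // ?lerDr // -mulr2n -mulr_natr.
    rewrite ler_pM ?mulr_ge0 //; last by rewrite -normrM bQ.
    by rewrite -[leRHS]mul1r ler_pM ?bgr.
  - by move=> i; apply: cB; rewrite (le_trans (bgi i)) // lerDr addr_ge0.
  by move=> i; rewrite /cP /cg -mulrA -mulrBr normrM ler_pM // gdiff.
apply: (le_trans L2).
rewrite [X in _ <= _ + X]mulrDl addrA lerD2r.
apply: (le_trans Hcon).
have d4 : (1 + d) ^+ 2 <= 4%:R.
  have -> : 4%:R = 2%:R ^+ 2 :> C by rewrite expr2 -natrM.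
  by rewrite lerXn2r ?nnegrE ?ler0n // -[2%:R]/(1 + 1) lerD2l ltW.
have d3 : (1 + d) ^+ 2 <= 1 + 3%:R * d.
  have -> : (1 + d) ^+ 2 = 1 + (d + d + d * d) by ring.
  have -> : 3%:R * d = d + d + d by ring.
  by rewrite !lerD2l ler_piMr // ltW.
apply: (le_trans (ler_wpM2l (exprn_ge0 2 d1p) L1)).
rewrite mulrDr mulrDl addrA lerD //.
  have -> : H cq + 3%:R * H cq * d = (1 + 3%:R * d) * H cq by ring.
  exact: ler_wpM2r.
rewrite [leLHS]mulrA; apply: ler_wpM2r; first exact: ltW.
by apply: ler_wpM2r => //; rewrite !mulr_ge0.
Qed.

Definition add_origin (Z : I -> C) (j : I + unit) : C :=
  if j is inl i then Z i else 0.

Lemma szego_form_add_origin (W : I + unit -> C) (t := W (inr tt)) :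
  szego_form (add_origin X) (add_origin Y) W =
  szego_form X Y (W \o inl) + (\sum_i W (inl i)) * t^* +
    t * (\sum_i W (inl i))^* + t * t^*.
Proof.
have sum1 (F : unit -> C) : \sum_u F u = F tt.
  by rewrite (big_pred1 tt) // => -[].
rewrite /szego_form big_sumType sum1 !big_sumType !sum1 /=.
have -> : \sum_i \sum_(j : I + unit) W (inl i) * (W j)^* *
    szego (add_origin X) (add_origin Y) (inl i) j =
    szego_form X Y (W \o inl) + (\sum_i W (inl i)) * t^*.
  rewrite mulr_suml -big_split; apply: eq_bigr => i _ /=.
  rewrite big_sumType sum1; congr (_ + _).
  by rewrite /szego /= conjC0 !mulr0 subr0 mulr1 invr1 mulr1.
rewrite !addrA; congr (_ + _ + _).
  rewrite rmorph_sum mulr_sumr; apply: eq_bigr => i _ /=.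
  by rewrite /szego /= !mul0r subr0 mulr1 invr1 mulr1.
by rewrite /szego /= !mul0r subr0 mulr1 invr1 mulr1.
Qed.

End Contract.

Section FunctionalBound.
Variables (I : finType) (X Y : I -> C).
Hypotheses (X1 : forall i, `|X i| < 1) (Y1 : forall i, `|Y i| < 1).

(* Both Szego-kernel inequalities are applied with the extra point [(0, 0)],
   where [p'] and [v] vanish; adding them cancels the terms quadratic in [v]. *)
Lemma functional_bound n1 n2 p p' v (c : I -> C) :
  stable2 (p + v) -> stable2 (p - v) ->
  (size p <= n1.+1)%N -> (sizeY p <= n2.+1)%N ->
  (size v <= n1.+1)%N -> (sizeY v <= n2.+1)%N ->
  reflects n1 n2 p p' -> reflects n1 n2 v v ->
  v.[0, 0] = 0 -> p'.[0, 0] = 0 -> p.[0, 0] != 0 ->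
  `|\sum_i c i * v.[X i, Y i]| ^+ 2 <=
  szego_form X Y (fun i => c i * p.[X i, Y i]).
Proof.
move=> st1 st2 sp1 sp2 sv1 sv2 pp vv v0 p'0 p0.
have X1' j : `|add_origin X j| < 1 by case: j => [i|[]] /=; rewrite ?normr0 ?ltr01.
have Y1' j : `|add_origin Y j| < 1 by case: j => [i|[]] /=; rewrite ?normr0 ?ltr01.
have szD (u : {poly {poly C}}) : u = v \/ u = - v ->
    (size (p + u)%R <= n1.+1)%N /\ (sizeY (p + u) <= n2.+1)%N.
  move=> uv; have [u1 u2] : (size u <= n1.+1)%N /\ (sizeY u <= n2.+1)%N.
    by case: uv => ->; rewrite // sizeYE rmorphN !size_polyN -sizeYE.
  split; first by apply: leq_trans (size_polyD _ _) _; rewrite geq_max sp1.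
  rewrite sizeYE rmorphD; apply: leq_trans (size_polyD _ _) _.
  by rewrite geq_max -!sizeYE sp2.
have rD : reflects n1 n2 (p + v) (p' + v).
  by move=> x y x0 y0; rewrite !hornerD pp // vv // rmorphD mulrDr.
have rB : reflects n1 n2 (p - v) (p' - v).
  by move=> x y x0 y0; rewrite !(hornerD, hornerN) pp // vv // rmorphB mulrBr.
pose lam (f : {poly {poly C}}) := \sum_i c i * f.[X i, Y i].
pose H (f : {poly {poly C}}) := szego_form X Y (fun i => c i * f.[X i, Y i]).
(* The weight at the origin satisfies t p(0, 0) = - lam v, and has the opposite sign for p - v. In
   the sum the cross terms with lam p cancel and the terms in lam v alone leave -2 |lam v|^2. *)
pose t := - lam v / p.[0, 0].
pose W s (j : I + unit) := if j is inl i then c i else s.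
have HE s f : szego_form (add_origin X) (add_origin Y)
    (fun j => W s j * f.[add_origin X j, add_origin Y j]) =
    H f + lam f * (s * f.[0, 0])^* + (s * f.[0, 0]) * (lam f)^* +
    (s * f.[0, 0]) * (s * f.[0, 0])^* by rewrite szego_form_add_origin.
have := reflection_contract X1' Y1' (W t) st1 (szD _ (or_introl erefl)).1
  (szD _ (or_introl erefl)).2 rD.
have := reflection_contract X1' Y1' (W (- t)) st2 (szD _ (or_intror erefl)).1
  (szD _ (or_intror erefl)).2 rB.
rewrite !HE !(hornerD, hornerN) v0 p'0 !subr0 !addr0 !mulr0 conjC0 !mulr0 !mul0r !addr0.
have lamD f g : lam (f + g) = lam f + lam g.
  by rewrite /lam -big_split; apply: eq_bigr => i _; rewrite !hornerD mulrDr.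
have lamN f : lam (- f) = - lam f.
  by rewrite /lam -sumrN; apply: eq_bigr => i _; rewrite !hornerN mulrN.
have HD f g : H (f + g) + H (f - g) = 2%:R * H f + 2%:R * H g.
  rewrite /H /szego_form !mulr_sumr -!big_split; apply: eq_bigr => i _ /=.
  rewrite !mulr_sumr -!big_split; apply: eq_bigr => j _ /=.
  rewrite !(hornerD, hornerN) !(rmorphM, rmorphD, rmorphN) /=; ring.
have tp : t * p.[0, 0] = - lam v by rewrite /t divfK.
rewrite mulNr tp !lamD lamN !rmorphD !rmorphN /= !opprK.
move=> /lerD H2 /H2; rewrite addrC HD.
have -> : H (p - v) + (lam p - lam v) * (lam v)^* +
    lam v * ((lam p)^* - (lam v)^*) + lam v * (lam v)^* +
   (H (p + v) + (lam p + lam v) * (- (lam v)^*) +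
     (- lam v) * ((lam p)^* + (lam v)^*) + (- lam v) * (- (lam v)^*)) =
   (H (p + v) + H (p - v)) - 2%:R * (lam v * (lam v)^*) by ring.
rewrite HD -normCK -/(lam v) -/(H p) addrAC lerD2r => Hle.
have : 0 <= 2%:R * H p' by rewrite mulr_ge0 ?ler0n //; apply: szego_form_ge0_disc.
move=> /le_trans/(_ Hle); rewrite -mulrBr pmulr_rge0 ?ltr0n // subr_ge0.
by [].
Qed.

End FunctionalBound.
End Reflection.

(** * Integrals over the torus *)

Section TorusIntegral.
Variable R : realType.
Local Notation mR := (measurableTypeR R).
Local Notation C := R[i].
Implicit Types (f g : mR * mR -> C) (p v : {bipoly R}).

Lemma measurable_invr : measurable_fun [set: R] (fun x : R => x^-1).
Proof.
have -> : [set: R] = [set x : R | x != 0] `|` [set 0].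
  apply/esym/seteqP; split => x //= _.
  by have [->|x0] := eqVneq x 0; [right|left].
apply/measurable_funU => //.
  apply: open_measurable; exact: open_neq.
split; last exact: measurable_fun_set1.
apply: open_continuous_measurable_fun; first exact: open_neq.
by move=> x; rewrite inE /= => x0; apply: inv_continuous.
Qed.

Definition cmeas f := measurable_fun setT (fun t => complex.Re (f t)) /\
  measurable_fun setT (fun t => complex.Im (f t)).

Lemma cmeas_cst (c : C) : cmeas (fun=> c).
Proof. by split; exact: measurable_cst. Qed.

Lemma cmeasD f g : cmeas f -> cmeas g -> cmeas (fun t => f t + g t).
Proof.
move=> [f1 f2] [g1 g2]; split.
  rewrite (_ : (fun t => _) = (fun t => complex.Re (f t)) \+ (fun t => complex.Re (g t))).
    exact: measurable_funD.
  by apply/funext => t /=; case: (f t); case: (g t).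
rewrite (_ : (fun t => _) = (fun t => complex.Im (f t)) \+ (fun t => complex.Im (g t))).
  exact: measurable_funD.
by apply/funext => t /=; case: (f t); case: (g t).
Qed.

Lemma cmeasM f g : cmeas f -> cmeas g -> cmeas (fun t => f t * g t).
Proof.
move=> [f1 f2] [g1 g2]; split.
  rewrite (_ : (fun t => _) = ((fun t => complex.Re (f t)) \* (fun t => complex.Re (g t))) \-
     ((fun t => complex.Im (f t)) \* (fun t => complex.Im (g t)))).
    by apply: measurable_funB; exact: measurable_funM.
  by apply/funext => t /=; case: (f t); case: (g t).
rewrite (_ : (fun t => _) = ((fun t => complex.Re (f t)) \* (fun t => complex.Im (g t))) \+
     ((fun t => complex.Im (f t)) \* (fun t => complex.Re (g t)))).
  by apply: measurable_funD; exact: measurable_funM.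
by apply/funext => t /=; case: (f t); case: (g t).
Qed.

Lemma cmeasV f : cmeas f -> cmeas (fun t => (f t)^-1).
Proof.
move=> [f1 f2].
pose n2 t := complex.Re (f t) ^+ 2 + complex.Im (f t) ^+ 2.
have mn2 : measurable_fun setT (fun t => (n2 t)^-1).
  apply: (measurableT_comp measurable_invr).
  by apply: measurable_funD; exact: measurable_funX.
split.
  rewrite (_ : (fun t => _) = (fun t => complex.Re (f t)) \* (fun t => (n2 t)^-1)).
    exact: measurable_funM.
  by apply/funext => t /=; rewrite /n2; case: (f t).
rewrite (_ : (fun t => _) = (fun t => - complex.Im (f t)) \* (fun t => (n2 t)^-1)).
  by apply: measurable_funM => //; exact: measurableT_comp.
by apply/funext => t /=; rewrite /n2; case: (f t) => a b /=; rewrite mulNr.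
Qed.

Lemma unit_circle_meas (h : mR * mR -> mR) : measurable_fun setT h ->
  cmeas (fun t => unit_circle (h t)).
Proof.
move=> mh.
have m2 : measurable_fun setT (fun t => 2 * pi * h t : R).
  by apply: measurable_funM => //; exact: measurable_cst.
split.
  exact: (measurableT_comp (continuous_measurable_fun (@continuous_cos R)) m2).
exact: (measurableT_comp (continuous_measurable_fun (@continuous_sin R)) m2).
Qed.

Lemma eval2_meas p : cmeas (fun t => eval2 p (torus_param t)).
Proof.
have m1 : cmeas (fun t : mR * mR => unit_circle t.1).
  by apply: unit_circle_meas; exact: measurable_fst.
have m2 : cmeas (fun t : mR * mR => unit_circle t.2).
  by apply: unit_circle_meas; exact: measurable_snd.
rewrite /eval2 /torus_param /=.
elim/poly_ind: p => [|p c IH].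
  rewrite (_ : (fun t => _) = fun=> 0); last by apply/funext => t; rewrite !horner0.
  exact: cmeas_cst.
rewrite (_ : (fun t => _) = (fun t => p.[unit_circle t.1, unit_circle t.2] *
   unit_circle t.1 + c.[unit_circle t.2])); last first.
  by apply/funext => t; rewrite !hornerE.
apply: cmeasD; first exact: cmeasM.
elim/poly_ind: c => [|c a IHc].
  rewrite (_ : (fun t => _) = fun=> 0); last by apply/funext => t; rewrite !horner0.
  exact: cmeas_cst.
rewrite (_ : (fun t => _) = (fun t => c.[unit_circle t.2] * unit_circle t.2 + a)); last first.
  by apply/funext => t; rewrite !hornerE.
by apply: cmeasD; [exact: cmeasM|exact: cmeas_cst].
Qed.

Lemma normcX2 (z : C) : ComplexField.Normc.normc z ^+ 2 = complex.Re z ^+ 2 + complex.Im z ^+ 2.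
Proof. by case: z => a b /=; rewrite sqr_sqrtr // addr_ge0 // sqr_ge0. Qed.

Lemma le_limn_einf (u : (\bar R)^nat) (l : R) :
  (forall e : R, 0 < e -> exists n, forall m, (n <= m)%N -> ((l - e)%:E <= u m)%E) ->
  (l%:E <= limn_einf u)%E.
Proof.
move=> H; rewrite limn_einf_lim; apply/lee_addgt0Pr => e e0.
have [n hn] := H e e0.
suff : ((l - e)%:E <= limn (einfs u))%E.
  by rewrite EFinB leeBlDr.
apply: lime_ge; first exact: is_cvg_einfs.
exists n => // m /= nm; apply: le_ereal_inf_tmp => _ [k /= mk <-].
by apply: hn; apply: leq_trans mk.
Qed.

Lemma limn_einf_le (u : (\bar R)^nat) (l : \bar R) : (forall m, (u m <= l)%E) ->
  (limn_einf u <= l)%E.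
Proof.
move=> H; rewrite limn_einf_lim; apply: lime_le; first exact: is_cvg_einfs.
exists 0%N => // m _ /=; apply: le_trans (H m).
by apply: ereal_inf_lbound; exists m => /=.
Qed.

(** Closed cells overlap on their edges. This is harmless: only a pointwise lower bound and an upper
    bound on the integral of nonnegative step functions are needed. *)
Definition cell N (a : nat) : set mR := `[a%:R / N%:R, a.+1%:R / N%:R].

(** [minn] puts the endpoint t = 1 into the last cell. *)
Definition cell_idx N (t : R) := minn (Num.truncn (N%:R * t)) N.-1.

Lemma cell_idxP N (t : R) : (0 < N)%N -> 0 <= t <= 1 ->
  (cell_idx N t < N)%N /\
  (cell_idx N t)%:R / N%:R <= t <= (cell_idx N t).+1%:R / N%:R.
Proof.
move=> N0 /andP[t0 t1]; split.
  by rewrite /cell_idx gtn_min ltn_predL N0 orbT.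
have Nr : 0 < N%:R :> R by rewrite ltr0n.
have Nt0 : 0 <= N%:R * t by rewrite mulr_ge0 // ltW.
have /andP[h1 h2] := truncn_itv Nt0.
rewrite ler_pdivrMr // ler_pdivlMr // [t * _]mulrC /cell_idx; apply/andP; split.
  by apply: le_trans h1; rewrite ler_nat geq_minl.
case: (leqP (Num.truncn (N%:R * t)) N.-1) => _; first exact: ltW.
by rewrite prednK // ler_piMr // ltW.
Qed.

Local Notation normc := ComplexField.Normc.normc.

Lemma cvg_invnS2 : (fun m : nat => m.+2%:R^-1 : R) @ \oo --> (0 : R).
Proof. by have := @cvg_harmonic R; rewrite -cvg_shiftS. Qed.

Lemma cvg_near_one (r : nat -> R) : (forall m, `|r m - 1| <= m.+2%:R^-1) ->
  r @ \oo --> (1 : R).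
Proof.
move=> r1; apply: (@squeeze_cvgr _ _ _ _ (fun m => 1 - m.+2%:R^-1) (fun m => 1 + m.+2%:R^-1)).
- by near=> m; rewrite -ler_distl.
- by rewrite -[X in _ --> X]subr0; apply: cvgB; [exact: cvg_cst|exact: cvg_invnS2].
by rewrite -[X in _ --> X]addr0; apply: cvgD; [exact: cvg_cst|exact: cvg_invnS2].
Unshelve. all: end_near. Qed.

Lemma cvg_cell_idx (t : R) : 0 <= t <= 1 ->
  (fun m => (cell_idx m.+2 t)%:R / m.+2%:R : R) @ \oo --> t.
Proof.
move=> t01; apply: (@squeeze_cvgr _ _ _ _ (fun m => t - m.+2%:R^-1) (fun=> t)).
- near=> m; have [_ /andP[-> h]] := cell_idxP (isT : (0 < m.+2)%N) t01.
  by rewrite andbT lerBlDr; move: h; rewrite -addn1 natrD mulrDl mul1r.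
- by rewrite -[X in _ --> X]subr0; apply: cvgB; [exact: cvg_cst|exact: cvg_invnS2].
exact: cvg_cst.
Unshelve. all: end_near. Qed.

Lemma normc_le_ReIm (z : C) : normc z <= `|complex.Re z| + `|complex.Im z|.
Proof.
rewrite -(@ler_pXn2r _ 2) ?nnegrE ?addr_ge0 //; last by case: z => a b; exact: sqrtr_ge0.
rewrite normcX2 sqrrD !real_normK ?num_real // addrAC lerDl mulrn_wge0 // mulr_ge0 //.
Qed.

Definition cdist (z : nat -> C) (w : C) (m : nat) : R :=
  `|complex.Re (z m) - complex.Re w| + `|complex.Im (z m) - complex.Im w|.

Lemma cvg_cell_circle (r : nat -> R) (t : R) : 0 <= t <= 1 ->
  (forall m, `|r m - 1| <= m.+2%:R^-1) ->
  cdist (fun m => (r m)%:C * unit_circle ((cell_idx m.+2 t)%:R / m.+2%:R))%C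
    (unit_circle t) @ \oo --> (0 : R).
Proof.
move=> t01 r1; have cr := cvg_near_one r1; have ct := cvg_cell_idx t01.
have c2 : (fun m => 2 * pi * ((cell_idx m.+2 t)%:R / m.+2%:R) : R) @ \oo --> 2 * pi * t.
  by apply: cvgM => //; exact: cvg_cst.
have ccos : (fun m => cos (2 * pi * ((cell_idx m.+2 t)%:R / m.+2%:R)) : R) @ \oo --> cos (2 * pi * t).
  by apply: continuous_cvg => //; exact: continuous_cos.
have csin : (fun m => sin (2 * pi * ((cell_idx m.+2 t)%:R / m.+2%:R)) : R) @ \oo --> sin (2 * pi * t).
  by apply: continuous_cvg => //; exact: continuous_sin.
have cRe := cvgM cr ccos; have cIm := cvgM cr csin.
rewrite mul1r in cRe; rewrite mul1r in cIm.
rewrite -[X in _ --> X]addr0; apply: cvgD.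
  rewrite -[X in _ --> X](@normr0 _ R) -[X in `|X|](subrr (cos (2 * pi * t))).
  apply: cvg_norm; apply: cvgB; last exact: cvg_cst.
  rewrite (_ : (fun m => _) = (fun m => r m * cos (2 * pi * ((cell_idx m.+2 t)%:R / m.+2%:R)))).
    exact: cRe.
  by apply/funext => m; rewrite /= mul0r subr0.
rewrite -[X in _ --> X](@normr0 _ R) -[X in `|X|](subrr (sin (2 * pi * t))).
apply: cvg_norm; apply: cvgB; last exact: cvg_cst.
rewrite (_ : (fun m => _) = (fun m => r m * sin (2 * pi * ((cell_idx m.+2 t)%:R / m.+2%:R)))).
  exact: cIm.
by apply/funext => m; rewrite /= mul0r addr0.
Qed.

Lemma normc_unit_circle (t : R) : normc (unit_circle t) = 1.
Proof. by rewrite /= cos2Dsin2 sqrtr1. Qed.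

Lemma normr_unit_circle (t : R) : `|unit_circle t| = 1.
Proof. by rewrite -[LHS]/((normc (unit_circle t))%:C)%C normc_unit_circle. Qed.

Lemma cvg_normc_eval2 p (z1 z2 : nat -> C) (w1 w2 : C) :
  (forall m, `|z1 m| <= 2) -> (forall m, `|z2 m| <= 2) ->
  `|w1| <= 2 -> `|w2| <= 2 ->
  cdist z1 w1 @ \oo --> (0 : R) -> cdist z2 w2 @ \oo --> (0 : R) ->
  (fun m => normc p.[z1 m, z2 m]) @ \oo --> normc p.[w1, w2].
Proof.
move=> b1 b2 b3 b4 c1 c2.
have [K K0 lip] := horner2_lipschitz p (ler0n C 2).
have KE : (K = (complex.Re K)%:C)%C by rewrite RRe_real // realE K0.
pose k := complex.Re K; pose e m := k * (cdist z1 w1 m + cdist z2 w2 m).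
have ce : e @ \oo --> (0 : R).
  rewrite -[X in _ --> X](mulr0 k); apply: cvgM; first exact: cvg_cst.
  by rewrite -[X in _ --> X]addr0; exact: cvgD.
have k0 : 0 <= k by rewrite -ler0c -KE.
have le m : `|normc p.[z1 m, z2 m] - normc p.[w1, w2]| <= e m.
  have h : `|normc p.[z1 m, z2 m] - normc p.[w1, w2]| <= normc (p.[z1 m, z2 m] - p.[w1, w2]).
    rewrite -lecR -[X in _ <= X]/(`|p.[z1 m, z2 m] - p.[w1, w2]|).
    apply: le_trans (ler_dist_dist _ _).
    by rewrite -[`|p.[z1 m, z2 m]|]/(_%:C)%C -[`|p.[w1, w2]|]/(_%:C)%C -rmorphB /= normc_def /= expr0n addr0 sqrtr_sqr.
  apply: (le_trans h); have := lip _ _ _ _ (b1 m) (b2 m) b3 b4.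
  rewrite KE -[`|_|]/(_%:C)%C -[`|z1 m - w1|]/(_%:C)%C -[`|z2 m - w2|]/(_%:C)%C.
  rewrite -rmorphD -rmorphM lecR => /le_trans; apply.
  have sub (x y : C) : `|complex.Re (x - y)| + `|complex.Im (x - y)| =
      `|complex.Re x - complex.Re y| + `|complex.Im x - complex.Im y|.
    by case: x y => a b [].
  by rewrite ler_wpM2l // lerD // (le_trans (normc_le_ReIm _)) // sub.
apply: (@squeeze_cvgr _ _ _ _ (fun m => normc p.[w1, w2] - e m) (fun m => normc p.[w1, w2] + e m)).
- by near=> m; rewrite -ler_distl.
- by rewrite -[X in _ --> X]subr0; apply: cvgB => //; exact: cvg_cst.
by rewrite -[X in _ --> X]addr0; apply: cvgD => //; exact: cvg_cst.
Unshelve. all: end_near. Qed.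

Definition quot_sqr v p (z : C * C) : R := normc (eval2 v z / eval2 p z) ^+ 2.

Lemma quot_sqr_ge0 v p z : 0 <= quot_sqr v p z.
Proof. by rewrite /quot_sqr exprn_ge0 //; case: (_ / _) => a b; exact: sqrtr_ge0. Qed.

Lemma quot_sqr_meas v p (A : set (mR * mR)) :
  measurable_fun A (fun t => (quot_sqr v p (torus_param t))%:E).
Proof.
have [mRe mIm] := cmeasM (eval2_meas v) (cmeasV (eval2_meas p)).
apply: measurable_funTS; apply/measurable_EFinP.
rewrite (_ : (fun t => _) = (fun t => complex.Re (eval2 v (torus_param t) / eval2 p (torus_param t)) ^+ 2) \+
  (fun t => complex.Im (eval2 v (torus_param t) / eval2 p (torus_param t)) ^+ 2)).
  by apply: measurable_funD; exact: measurable_funX.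
by apply/funext => t; rewrite /quot_sqr normcX2.
Qed.

(** The two radii are independent: part (i) samples inside the bidisk, part (ii) keeps the second
    variable on the circle. With m + 2 points per circle the radius 1 - 1/(m+2) used later is
    positive. *)
Definition grid_point (r s : nat -> R) (m a b : nat) : C * C :=
  ((r m)%:C * unit_circle (a%:R / m.+2%:R), (s m)%:C * unit_circle (b%:R / m.+2%:R))%C.

Section Grid.
Variables (v p : {bipoly R}) (r s : nat -> R).
Hypotheses (r1 : forall m, `|r m - 1| <= m.+2%:R^-1)
  (s1 : forall m, `|s m - 1| <= m.+2%:R^-1).

Let F m a b := quot_sqr v p (grid_point r s m a b).

Definition grid_step (m : nat) (t : mR * mR) : R :=
  \sum_(a < m.+2) \sum_(b < m.+2) F m a b * \1_(cell m.+2 a `*` cell m.+2 b) t.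

Let step0 m t : 0 <= grid_step m t.
Proof. by do 2 apply: sumr_ge0 => ? _; rewrite mulr_ge0 ?quot_sqr_ge0. Qed.

Lemma grid_step_lower (t : mR * mR) (e : R) : unit_square t -> 0 < e ->
  exists n, forall m, (n <= m)%N ->
    quot_sqr v p (torus_param t) - e <= grid_step m t.
Proof.
case: t => t1 t2 [] /=; rewrite !in_itv /= => t1P t2P e0.
rewrite /quot_sqr /torus_param /=.
(* At a zero of p the quotient is 0 by the convention on inverses, so no null set has to be
   discarded. *)
have [p0|p0] := eqVneq (eval2 p (unit_circle t1, unit_circle t2)) 0.
  exists 0%N => m _; rewrite p0 invr0 mulr0 ComplexField.Normc.normc0 expr0n /= sub0r.
  by apply: le_trans (step0 m _); rewrite oppr_le0 ltW.
pose a m := cell_idx m.+2 t1; pose b m := cell_idx m.+2 t2.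
have norm2 (x : nat -> R) (y : nat -> R) : (forall m, `|x m - 1| <= m.+2%:R^-1) ->
    forall m, `|(x m)%:C%C * unit_circle (y m)| <= 2%:R.
  move=> x1 m; rewrite normrM normr_unit_circle mulr1.
  rewrite -[`|_|]/((normc (x m)%:C%C)%:C%C) /= expr0n addr0 sqrtr_sqr.
  rewrite -(rmorph_nat (real_complex R)) lecR -[x m](subrK 1) (le_trans (ler_normD _ _)) //.
  rewrite normr1 -[2%:R]/(1 + 1) lerD2r (le_trans (x1 m)) // invf_le1 ?ltr0n //.
  by rewrite ler1n.
have nt (x : R) : `|unit_circle x| <= 2%:R by rewrite normr_unit_circle ler1n.
have cv := cvg_normc_eval2 (p := v) (norm2 r _ r1) (norm2 s _ s1) (nt t1) (nt t2)
  (cvg_cell_circle t1P r1) (cvg_cell_circle t2P s1).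
have cp := cvg_normc_eval2 (p := p) (norm2 r _ r1) (norm2 s _ s1) (nt t1) (nt t2)
  (cvg_cell_circle t1P r1) (cvg_cell_circle t2P s1).
have np0 : normc p.[unit_circle t1, unit_circle t2] != 0.
  by apply: contra p0 => /eqP/ComplexField.Normc.eq0_normc/eqP.
pose z m := grid_point r s m (a m) (b m).
have cq : (fun m => normc v.[(z m).1, (z m).2] / normc p.[(z m).1, (z m).2]) @ \oo -->
    normc v.[unit_circle t1, unit_circle t2] / normc p.[unit_circle t1, unit_circle t2].
  by apply: cvgM; [exact: cv|apply: cvgV; [exact: np0|exact: cp]].
have cF : (fun m => F m (a m) (b m)) @ \oo --> quot_sqr v p (unit_circle t1, unit_circle t2).
  rewrite /quot_sqr /eval2 /= expr2 ComplexField.Normc.normcM ComplexField.Normc.normcV.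
  rewrite (_ : (fun m => _) = (fun m =>
      normc v.[(z m).1, (z m).2] / normc p.[(z m).1, (z m).2] *
     (normc v.[(z m).1, (z m).2] / normc p.[(z m).1, (z m).2]))).
    by apply: cvgM; exact: cq.
  apply/funext => m; rewrite /F /quot_sqr /eval2 expr2.
  by rewrite ComplexField.Normc.normcM ComplexField.Normc.normcV.
move/cvgrPdist_lt: cF => /(_ e e0) [n _ hn].
exists n => m nm; have := hn m nm; rewrite /= => /ltW; rewrite ler_distlC => /andP[h _].
apply: (@le_trans _ _ (F m (a m) (b m))); first exact: h.
have [am at1] := cell_idxP (isT : (0 < m.+2)%N) t1P.
have [bm bt2] := cell_idxP (isT : (0 < m.+2)%N) t2P.
rewrite /grid_step (bigD1 (Ordinal am)) //= (bigD1 (Ordinal bm)) //=.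
rewrite -addrA indicE mem_set ?mulr1; last by split; rewrite /cell /= in_itv.
rewrite lerDl addr_ge0 //; first by apply: sumr_ge0 => ? _; rewrite mulr_ge0 ?quot_sqr_ge0.
by do 2 apply: sumr_ge0 => ? _; rewrite mulr_ge0 ?quot_sqr_ge0.
Qed.

Lemma grid_step_meas m : measurable_fun setT (fun t => (grid_step m t)%:E).
Proof.
apply/measurable_EFinP; rewrite /grid_step.
apply: measurable_sum => a; apply: measurable_sum => b.
apply: measurable_funM; first exact: measurable_cst.
by apply: measurable_indic; apply: measurableX; exact: measurable_itv.
Qed.

Let mu : {measure set (mR * mR) -> \bar R} :=
  [the {measure set (mR * mR) -> \bar R} of (@lebesgue_measure R \x @lebesgue_measure R)%E].

Lemma unit_square_meas : measurable (@unit_square R).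
Proof. by apply: measurableX; exact: measurable_itv. Qed.

Lemma integral_grid_step m :
  (\int[mu]_(t in @unit_square R) (grid_step m t)%:E <=
   ((\sum_(a < m.+2) \sum_(b < m.+2) F m a b) / m.+2%:R ^+ 2)%:E)%E.
Proof.
have F0 a b : 0 <= F m a b := quot_sqr_ge0 _ _ _.
have mcell a b : measurable (cell m.+2 a `*` cell m.+2 b).
  by apply: measurableX; exact: measurable_itv.
have mind a b : measurable_fun (@unit_square R) (fun t =>
    (F m a b * \1_(cell m.+2 a `*` cell m.+2 b) t)%:E).
  apply/measurable_EFinP; apply: measurable_funM; first exact: measurable_cst.
  exact: measurable_indic.
under eq_integral => t _.
  rewrite /grid_step -sumEFin; under eq_bigr => a _ do rewrite -sumEFin.
over.
rewrite ge0_integral_sum //=; first last.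
- by move=> a t _; apply: sume_ge0 => b _; rewrite lee_fin mulr_ge0.
- by move=> a; apply: emeasurable_sum.
- exact: unit_square_meas.
rewrite mulr_suml -sumEFin; apply: lee_sum => a _.
rewrite ge0_integral_sum //=; first last.
- by move=> b t _; rewrite lee_fin mulr_ge0.
- exact: unit_square_meas.
rewrite mulr_suml -sumEFin; apply: lee_sum => b _.
rewrite (integralZl_indic unit_square_meas (fun=> cell m.+2 a `*` cell m.+2 b)) //; last first.
  by move=> h; have := F0 a b; rewrite leNgt h.
rewrite [leRHS](EFinM (F m a b)) lee_wpmul2l ?lee_fin // integral_indic //; last exact: unit_square_meas.
apply: (@le_trans _ _ (mu (cell m.+2 a `*` cell m.+2 b))).
  apply: le_measure; rewrite ?inE //.
  by apply: measurableI => //; exact: unit_square_meas.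
have lc c : lebesgue_measure (cell m.+2 c) = (m.+2%:R^-1)%:E :> \bar R.
  rewrite lebesgue_measure_itv /= lte_fin ltr_pM2r ?invr_gt0 ?ltr0n // ltr_nat ltnSn.
  by rewrite -EFinB -mulrBl -natrB // subSnn mul1r.
have -> : mu (cell m.+2 a `*` cell m.+2 b) = (m.+2%:R^-1 * m.+2%:R^-1)%:E.
  rewrite /mu /= product_measure1E; try exact: measurable_itv.
  by rewrite EFinM; congr (_ * _)%E; exact: lc.
by rewrite -expr2 exprVn.
Qed.

(** Fatou's lemma for the step functions: their lower limit dominates |v/p|^2 at every point, and
    their integrals are at most the grid averages. *)
Lemma L2_torus_of_grid (B : R) :
  (forall m, \sum_(a < m.+2) \sum_(b < m.+2) F m a b <= B * m.+2%:R ^+ 2) ->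
  L2_torus (fun z => eval2 v z / eval2 p z).
Proof.
move=> FB; have [mRe mIm] := cmeasM (eval2_meas v) (cmeasV (eval2_meas p)).
split; [exact: measurable_funTS|exact: measurable_funTS|].
have mF := @quot_sqr_meas v p (@unit_square R).
have mG m : measurable_fun (@unit_square R) (fun t => (grid_step m t)%:E).
  by apply: measurable_funTS; exact: grid_step_meas.
have G0 m t : unit_square t -> (0 <= (grid_step m t)%:E)%E by rewrite lee_fin.
have := fatou mu unit_square_meas mG G0.
set J := (X in (_ <= X)%E) => HJ.
have JB : (J <= B%:E)%E.
  apply: limn_einf_le => m; apply: (le_trans (integral_grid_step m)).
  by rewrite lee_fin ler_pdivrMr // exprn_gt0 // ltr0n.
apply: (@le_lt_trans _ _ B%:E); last exact: ltry.
apply: le_trans JB; apply: le_trans HJ.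
apply: ge0_le_integral => //.
- exact: unit_square_meas.
- by move=> t _; rewrite lee_fin quot_sqr_ge0.
- rewrite /limn_einf; apply: measurableT_comp => //.
  apply: (@measurable_fun_limn_esup _ _ _ _ (fun m t => (- (grid_step m t)%:E)%E)) => m.
  exact: measurableT_comp.
move=> t tS; apply: le_limn_einf => e e0.
have [n hn] := grid_step_lower tS e0.
by exists n => m nm; rewrite lee_fin; exact: hn.
Qed.

End Grid.
End TorusIntegral.

(** * Szego forms on a dilated grid of roots of unity *)

Section GridSzego.
Variable C : numClosedFieldType.
Variables (N : nat) (w r : C).
Hypotheses (prim_w : N.-primitive_root w) (r0 : 0 <= r) (r1 : r < 1).

Let X (a : 'I_N) := r * w ^+ a.
Let rho := r ^+ (2 * N).

Let N0 : (0 < N)%N := prim_root_gt0 prim_w.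

Let rho1 : rho < 1.
Proof. by rewrite /rho exprn_ilt1 // muln_eq0 /= -lt0n. Qed.

(** On the grid (X_a conj X_b)^N = r^(2N) for all a and b, because w^N = 1; the geometric series
    folds into N terms and the common factor 1/(1 - rho). *)
Lemma grid_geometric a b :
  (1 - X a * (X b)^*)^-1 = (1 - rho)^-1 * \sum_(k < N) X a ^+ k * (X b ^+ k)^*.
Proof.
have nw := norm_prim_root prim_w.
pose x := X a * (X b)^*.
have xN : x ^+ N = rho.
  rewrite /x /X rmorphM !exprMn rmorphXn /= (geC0_conj r0) -!exprM.
  rewrite mulnC exprM (prim_expr_order prim_w) expr1n mulr1 mulnC exprM.
  by rewrite -rmorphXn (prim_expr_order prim_w) rmorph1 expr1n mulr1 -exprD addnn -mul2n.
have xn1 : 1 - x != 0.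
  rewrite subr_eq0; apply/eqP => x1.
  by move: xN; rewrite -x1 expr1n => E; move: rho1; rewrite -E ltxx.
have -> : \sum_(k < N) X a ^+ k * (X b ^+ k)^* = \sum_(k < N) x ^+ k.
  by apply: eq_bigr => k _; rewrite rmorphXn /= -exprMn.
have r1' : 1 - rho != 0 by rewrite subr_eq0 gt_eqF.
apply: (mulfI r1'); rewrite mulrA mulfV // mul1r; apply: (mulIf xn1).
rewrite -mulrA mulVf // mulr1 -xN mulrC.
have := subrX1 x N; rewrite -opprB => /(congr1 -%R); rewrite opprK => ->.
by rewrite -mulNr opprB.
Qed.

Lemma rho_factor_gt0 : 0 < (1 - rho)^-1.
Proof. by rewrite invr_gt0 subr_gt0. Qed.

Lemma grid_term_le (k : nat) (h : 'I_N -> C) :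
  `|\sum_a h a * X a ^+ k| ^+ 2 <= `|\sum_a h a * w ^+ (a * k)| ^+ 2.
Proof.
have -> : \sum_a h a * X a ^+ k = r ^+ k * \sum_a h a * w ^+ (a * k).
  rewrite mulr_sumr; apply: eq_bigr => a _.
  by rewrite /X exprMn exprM mulrCA.
rewrite normrM exprMn ler_piMl ?exprn_ge0 // exprn_ile1 // normrX.
by rewrite (ger0_norm r0) exprn_ile1 // ltW.
Qed.

Definition szego1 (h : 'I_N -> C) := \sum_a \sum_b h a * (h b)^* * (1 - X a * (X b)^*)^-1.

Lemma szego1E h : szego1 h = (1 - rho)^-1 * \sum_(k < N) `|\sum_a h a * X a ^+ k| ^+ 2.
Proof.
under [in RHS]eq_bigr => k _ do rewrite sqr_norm_sum.
rewrite exchange_big mulr_sumr; apply: eq_bigr => a _ /=.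
rewrite exchange_big mulr_sumr; apply: eq_bigr => b _ /=.
rewrite grid_geometric mulrCA; congr (_ * _); rewrite mulr_sumr.
by apply: eq_bigr => k _; rewrite rmorphM /=; ring.
Qed.

Lemma szego1_ge0 h : 0 <= szego1 h.
Proof.
rewrite szego1E mulr_ge0 ?(ltW rho_factor_gt0) //.
by apply: sumr_ge0 => k _; rewrite exprn_ge0.
Qed.

Lemma szego1_le h : szego1 h <= (1 - rho)^-1 * (N%:R * \sum_a `|h a| ^+ 2).
Proof.
rewrite szego1E ler_wpM2l ?(ltW rho_factor_gt0) // -(parseval prim_w).
by apply: ler_sum => k _; exact: grid_term_le.
Qed.

(** By [grid_geometric] the form is a sum of squared values of a discrete Fourier transform damped
    by r^(k+l) <= 1; dropping the damping leaves Parseval's identity. *)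
Lemma szego_form_grid_le (h : 'I_N * 'I_N -> C) :
  szego_form (fun i => X i.1) (fun i => X i.2) h <=
  ((1 - rho)^-1 * N%:R) ^+ 2 * \sum_i `|h i| ^+ 2.
Proof.
have -> : szego_form (fun i => X i.1) (fun i => X i.2) h =
   (1 - rho)^-1 ^+ 2 * trunc_form (fun i => X i.1) (fun i => X i.2) N h.
  rewrite /trunc_form /szego_form.
  under [in RHS]eq_bigr => k _ do under eq_bigr => l _ do rewrite sqr_norm_sum.
  under [in RHS]eq_bigr => k _ do rewrite exchange_big /=.
  rewrite [in RHS]exchange_big mulr_sumr; apply: eq_bigr => i _ /=.
  under [in RHS]eq_bigr => k _ do rewrite exchange_big /=.
  rewrite [in RHS]exchange_big mulr_sumr; apply: eq_bigr => j _ /=.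
  rewrite /szego invfM !grid_geometric.
  set A := \sum_(k < N) _; set B := \sum_(k < N) _.
  transitivity ((1 - rho)^-1 ^+ 2 * (h i * (h j)^* * (A * B))); first by ring.
  congr (_ * _); rewrite /A mulr_suml mulr_sumr; apply: eq_bigr => k _.
  rewrite mulr_sumr mulr_sumr; apply: eq_bigr => l _.
  by rewrite !rmorphM /=; ring.
rewrite [X in _ <= X * _]exprMn -[leRHS]mulrA ler_wpM2l ?exprn_ge0 ?(ltW rho_factor_gt0) //.
pose h2 a b := h (a, b).
have -> : \sum_i `|h i| ^+ 2 = \sum_a \sum_b `|h2 a b| ^+ 2.
  by rewrite pair_bigA; apply: eq_bigr => -[a b] _.
rewrite -(parseval2 prim_w h2); apply: ler_sum => k _; apply: ler_sum => l _.
have -> : \sum_i h i * (X i.1 ^+ k * X i.2 ^+ l) =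
    r ^+ (k + l) * \sum_(a < N) \sum_(b < N) h2 a b * w ^+ (b * l) * w ^+ (a * k).
  rewrite mulr_sumr; under [in RHS]eq_bigr => a _ do rewrite mulr_sumr.
  rewrite pair_bigA; apply: eq_bigr => -[a b] _ /=.
  by rewrite /h2 /X !exprMn exprD !exprM; ring.
rewrite normrM exprMn ler_piMl ?exprn_ge0 // exprn_ile1 // normrX.
by rewrite (ger0_norm r0) exprn_ile1 // ltW.
Qed.

End GridSzego.

Section ComplexFacts.
Variable R : realType.
Local Notation C := R[i].
Local Notation normc := ComplexField.Normc.normc.

Lemma normr_normc (z : C) : `|z| = ((normc z)%:C)%C.
Proof. by []. Qed.

Lemma complex_arch (x : C) : exists n : nat, `|x| <= n%:R.
Proof.
exists (Num.truncn (normc x)).+1.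
by rewrite -(rmorph_nat (real_complex R)) lecR ltW // truncnS_gt.
Qed.

Lemma unit_circleD (s t : R) : unit_circle (s + t) = unit_circle s * unit_circle t.
Proof.
apply/eqP; rewrite eq_complex /= mulrDr cosD sinD.
by rewrite eqxx [X in _ == X]addrC eqxx.
Qed.

Lemma unit_circle0 : unit_circle (0 : R) = 1.
Proof. by rewrite /unit_circle mulr0 cos0 sin0. Qed.

Lemma unit_circleMn (t : R) n : unit_circle (t *+ n) = unit_circle t ^+ n.
Proof.
elim: n => [|n IH]; first by rewrite mulr0n unit_circle0.
by rewrite mulrS unit_circleD IH exprS.
Qed.

Lemma unit_circle_nat n k : unit_circle (k%:R / n%:R : R) = unit_circle n%:R^-1 ^+ k.
Proof. by rewrite -unit_circleMn mulr_natl. Qed.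

Lemma unit_circle_prim n : (0 < n)%N -> n.-primitive_root (unit_circle (n%:R^-1 : R)).
Proof.
move=> n0; have nr : 0 < n%:R :> R by rewrite ltr0n.
have wn : unit_circle (n%:R^-1 : R) ^+ n = 1.
  rewrite -unit_circle_nat mulfV ?gt_eqF // /unit_circle mulr1 mulr_natl.
  by rewrite cos2pi sin2pi.
have [m mprim mn] := prim_order_exists n0 wn.
suff E : m = n by rewrite E in mprim.
have m0 := prim_order_gt0 mprim.
apply/eqP; rewrite eqn_leq dvdn_leq //= leqNgt; apply/negP => ltmn.
have := prim_expr_order mprim; rewrite -unit_circle_nat.
set x := m%:R / n%:R => E.
have x01 : 0 < x < 1 by rewrite divr_gt0 ?ltr0n // ltr_pdivrMr // mul1r ltr_nat.
have : cos (2 * pi * x) = 1 by have := congr1 (@complex.Re R) E.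
rewrite -mulrA mulr_natl cos_mulr2n cos2sin2 mulrnBl => H.
have s0 : sin (pi * x) ^+ 2 = 0 by move: H; lra.
move/eqP: s0; rewrite sqrf_eq0 => /eqP s0.
case/andP: x01 => x0 x1.
have : 0 < sin (pi * x).
  by apply: sin_gt0_pi; rewrite mulr_gt0 ?pi_gt0 //= gtr_pMr ?pi_gt0.
by rewrite s0 ltxx.
Qed.

Lemma complex_prim_root N : (0 < N)%N -> exists w : C, N.-primitive_root w.
Proof. by move=> N0; exists (unit_circle N%:R^-1); exact: unit_circle_prim. Qed.

(** The gap 1/N, with N = m + 2, balances two needs: the radius tends to 1, so that samples converge
    to boundary values, while rho = r^(2N) stays at most 1/2, so that 1/(1 - rho) is at most 2. *)
Definition grid_radius (m : nat) : R := 1 - m.+2%:R^-1.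

Lemma radius_near1 m : `|grid_radius m - 1| <= m.+2%:R^-1.
Proof. by rewrite /grid_radius addrAC subrr add0r normrN ger0_norm. Qed.

Lemma radius_bounds m : 0 <= grid_radius m < 1.
Proof.
rewrite /grid_radius subr_ge0 gtrBl invr_gt0 ltr0n andbT.
by rewrite invf_le1 ?ltr0n // ler1n.
Qed.

(* [(1 + 1/(N-1))^N >= 1 + N/(N-1) >= 2] *)
Lemma radius_power m : grid_radius m ^+ (2 * m.+2) <= 2^-1.
Proof.
have /andP[r0 r1] := radius_bounds m.
apply: (@le_trans _ _ (grid_radius m ^+ m.+2)).
  by rewrite mul2n -addnn exprD ler_piMl ?exprn_ge0 // exprn_ile1 // ltW.
have rE : grid_radius m = (1 + m.+1%:R^-1)^-1.
  rewrite /grid_radius -[m.+2%:R]natr1.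
  have a0 : 0 < m.+1%:R :> R by rewrite ltr0n.
  set a := m.+1%:R in a0 *.
  by field; rewrite !gt_eqF //= ?addr_gt0 // ltr01.
rewrite rE exprVn lef_pV2 ?posrE ?exprn_gt0 ?ltr0n ?addr_gt0 ?invr_gt0 ?ltr0n //.
apply: le_trans (bernoulli m.+2 _); last by rewrite invr_ge0 ler0n.
rewrite -[2%:R]/(1 + 1) lerD2l.
by rewrite ler_pdivlMr ?ltr0n // mul1r ler_nat.
Qed.

Lemma radius_factor m : (1 - grid_radius m ^+ (2 * m.+2))^-1 <= 2.
Proof.
have := radius_power m => h.
rewrite -[leRHS]invrK lef_pV2 ?posrE ?invr_gt0 ?ltr0n // ; lra.
Qed.

End ComplexFacts.

(** * Part (i): square integrability of v/p *)

Section PartOne.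
Variable R : realType.
Local Notation C := R[i].
Implicit Types (p q v : {bipoly R}).

Lemma stable2_no_zeros q : no_zeros_in_bidisk q -> stable2 q.
Proof. by move=> st x y x1 y1; exact: (st (x, y)). Qed.

Lemma bidegree_le_size m q : bidegree_le (bidegree q) m ->
  (size q <= m.1.+1)%N /\ (sizeY q <= m.2.+1)%N.
Proof. by rewrite /bidegree_le /bidegree /= => /andP[]; lia. Qed.

Lemma reflects_reflection (n : nat * nat) q : bidegree_le (bidegree q) n ->
  reflects n.1 n.2 q (reflection n q).
Proof. by move=> qn x y x0 y0; exact: (eval2_reflection (z := (x, y)) qn x0 y0). Qed.

Lemma reflection_size n q :
  (size (reflection n q) <= n.1.+1)%N /\ (sizeY (reflection n q) <= n.2.+1)%N.
Proof.
split; first exact: size_poly.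
apply/bigmax_leqP => i _; rewrite coef_poly; case: ifP => _; first exact: size_poly.
by rewrite size_poly0.
Qed.

Lemma coef_reflection n q i j : (i <= n.1)%N -> (j <= n.2)%N ->
  (reflection n q)`_i`_j = conjc q`_(n.1 - i)`_(n.2 - j).
Proof. by move=> i1 j1; rewrite coef_poly ltnS i1 coef_poly ltnS j1. Qed.

(** The nonzero constant coefficient of [p] reappears, conjugated, as the coefficient of the
    reflection at the top bidegree, so neither degree can drop. *)
Lemma bidegree_reflection p : p`_0`_0 != 0 ->
  bidegree (reflection (bidegree p) p) = bidegree p.
Proof.
move=> p0; have [s1 s2] := reflection_size (bidegree p) p.
set n := bidegree p; set g := reflection n p.
have gn : g`_n.1`_n.2 != 0 by rewrite coef_reflection // !subnn conjc_eq0.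
rewrite [LHS]/bidegree [RHS]surjective_pairing; congr (_, _).
  have : (n.1 < size g)%N.
    by rewrite ltnNge; apply: contra gn => /(nth_default 0)->; rewrite coef0.
  by move: s1; rewrite -/n -/g; case: (size g) => // k; lia.
have : (n.2 < sizeY g)%N.
  apply: leq_trans (max_size_coefXY g n.1).
  by rewrite ltnNge; apply: contra gn => /(nth_default 0)->.
by move: s2; rewrite -/n -/g; case: (sizeY g) => // k; lia.
Qed.

Lemma eval2_00 q : eval2 q (0, 0) = q`_0`_0.
Proof. by rewrite /eval2 /= !horner_coef0. Qed.

Lemma quot_sqrE v p (z : C * C) : ((quot_sqr v p z)%:C)%C = `|eval2 v z / eval2 p z| ^+ 2.
Proof. by rewrite /quot_sqr rmorphXn. Qed.

Lemma radius_complex m : 0 <= ((grid_radius R m)%:C)%C /\ ((grid_radius R m)%:C)%C < 1.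
Proof.
have /andP[r0 r1] := radius_bounds R m.
by split; [rewrite ler0c|rewrite -(rmorph1 (real_complex R)) ltcR].
Qed.

Lemma radius_factor_complex m :
  (1 - ((grid_radius R m)%:C)%C ^+ (2 * m.+2))^-1 <= 2%:R :> C.
Proof.
rewrite -(rmorphXn (real_complex R)) -(rmorph1 (real_complex R)) -rmorphB -fmorphV.
by rewrite -(rmorph_nat (real_complex R)) lecR radius_factor.
Qed.

(** With S the grid sum of |v/p|^2, the functional bound reads S^2 <= H and the grid estimate H <=
    (2N)^2 S. Dividing by S gives S <= 4 N^2, whence the constant 4. *)
Theorem stable_perturbation_L2 p v (n := bidegree p) :
  no_zeros_in_bidisk p -> eval2 (reflection n p) (0, 0) = 0 ->
  bidegree_le (bidegree v) n -> eval2 v (0, 0) = 0 -> v = reflection n v ->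
  no_zeros_in_bidisk (p + v) -> no_zeros_in_bidisk (p - v) ->
  L2_torus (fun z => eval2 v z / eval2 p z).
Proof.
move=> st p'0 vn v0 vv st1 st2.
apply: (@L2_torus_of_grid R v p (grid_radius R) (grid_radius R) _ _ 4) => [m|m|m].
- exact: radius_near1.
- exact: radius_near1.
set N := m.+2; set w : C := unit_circle (N%:R^-1 : R).
have prim_w : N.-primitive_root w by exact: unit_circle_prim.
pose r : C := ((grid_radius R m)%:C)%C.
have [r0 r1] : 0 <= r /\ r < 1 := radius_complex m.
have X1 (i : 'I_N) : `|r * w ^+ i| < 1.
  by rewrite normrM normrX (norm_prim_root prim_w) expr1n mulr1 ger0_norm.
pose X (i : 'I_N * 'I_N) : C := r * w ^+ i.1; pose Y (i : 'I_N * 'I_N) : C := r * w ^+ i.2.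
pose g i := eval2 v (X i, Y i) / eval2 p (X i, Y i).
have p0 i : eval2 p (X i, Y i) != 0 by apply: st; split; apply: X1.
have [sp1 sp2] : (size p <= n.1.+1)%N /\ (sizeY p <= n.2.+1)%N.
  by apply: bidegree_le_size; rewrite /bidegree_le !leqnn.
have [sv1 sv2] := bidegree_le_size vn.
have pp' : reflects n.1 n.2 p (reflection n p).
  by apply: reflects_reflection; rewrite /bidegree_le !leqnn.
have vv' : reflects n.1 n.2 v v by rewrite [X in reflects _ _ _ X]vv; apply: reflects_reflection.
have p00 : p.[0, 0] != 0 by apply: (st (0, 0)); split; rewrite normr0 ltr01.
have := functional_bound (@complex_arch R) (@complex_prim_root R) (fun i => X1 i.1)
  (fun i => X1 i.2) (fun i => (g i)^* / eval2 p (X i, Y i))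
  (stable2_no_zeros st1) (stable2_no_zeros st2) sp1 sp2 sv1 sv2 pp' vv' v0 p'0 p00.
pose S := \sum_i `|g i| ^+ 2.
have S0 : 0 <= S by apply: sumr_ge0 => i _; rewrite exprn_ge0.
have -> : \sum_i (g i)^* / eval2 p (X i, Y i) * v.[r * w ^+ i.1, r * w ^+ i.2] = S.
  apply: eq_bigr => i _; rewrite mulrAC -mulrA -[v.[_, _]]/(eval2 v (X i, Y i)).
  by rewrite -/(g i) mulrC -normCK.
set H := szego_form _ _ _ => HS.
have HE : H = szego_form X Y (fun i => (g i)^*).
  by apply: eq_bigr => i _; apply: eq_bigr => j _; rewrite !divfK.
have := szego_form_grid_le prim_w r0 r1 (fun i => (g i)^*).
rewrite -[szego_form _ _ _]/(szego_form X Y (fun i => (g i)^*)) -HE.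
have -> : \sum_i `|(g i)^*| ^+ 2 = S by apply: eq_bigr => i _; rewrite norm_conjC.
move=> HB; have {HS HB} := le_trans HS HB.
rewrite (ger0_norm S0).
set k := (_ * N%:R) ^+ 2 => Sk.
have Sk' : S <= k.
  have [S00|Sn0] := eqVneq S 0.
    rewrite S00 exprn_ge0 // mulr_ge0 // ?ler0n //.
    exact: ltW (rho_factor_gt0 prim_w r0 r1).
  by rewrite -(ler_pM2r (_ : 0 < S)) // lt_def Sn0.
have k4 : k <= 4%:R * N%:R ^+ 2.
  rewrite /k exprMn ler_wpM2r ?exprn_ge0 ?ler0n //.
  have -> : 4%:R = 2%:R ^+ 2 :> C by rewrite expr2 -natrM.
  rewrite lerXn2r ?nnegrE ?ler0n ?radius_factor_complex //.
  exact: ltW (rho_factor_gt0 prim_w r0 r1).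
rewrite -lecR rmorphM rmorphXn !(rmorph_nat (real_complex R)).
apply: le_trans k4; apply: le_trans Sk'.
rewrite rmorph_sum /= le_eqVlt; apply/orP; left; apply/eqP.
under eq_bigr => a _ do rewrite rmorph_sum /=.
rewrite /S pair_bigA; apply: eq_bigr => -[a b] _ /=.
by rewrite quot_sqrE /g /X /Y /grid_point /= !unit_circle_nat.
Qed.

End PartOne.

(** * The Bezoutian *)

Section Bezoutian.
Variable A : comNzRingType.
Implicit Types (f g : {poly A}) (n k : nat) (x : A).

(** With h# the reversal of h at degree n, the columns are the coefficients in w of (f(x) g#(w) -
    g(x) f#(w)) / (1 - x w). Compared with the usual Bezoutian the second variable is reversed: when
    g is the conjugate reversal of f the matrix is hermitian. Each column lies visibly in the ideal
    (f, g). *)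
Definition bez_col n f g k := f * drop_poly (n - k) g - g * drop_poly (n - k) f.

Definition bezoutian n f g : 'M[A]_n := \matrix_(j, k) (bez_col n f g k)`_j.

Lemma bez_col_size n f g k : (size f <= n.+1)%N -> (size g <= n.+1)%N -> (k < n)%N ->
  (size (bez_col n f g k) <= n)%N.
Proof.
move=> sf sg kn; apply/leq_sizeP => j nj; set m := (n - k)%N.
have E : bez_col n f g k * 'X^m = g * take_poly m f - f * take_poly m g.
  rewrite /bez_col -/m mulrBl -!mulrA.
  have d h : drop_poly m h * 'X^m = h - take_poly m h.
    by apply/esym/eqP; rewrite subr_eq addrC poly_take_drop.
  by rewrite !d; ring.
have -> : (bez_col n f g k)`_j = (bez_col n f g k * 'X^m)`_(j + m).
  by rewrite coefMXn ltnNge leq_addl /= addnK.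
rewrite E; apply: nth_default; apply: leq_trans (leq_add nj (leqnn m)).
rewrite (leq_trans (size_polyD _ _)) // geq_max size_polyN.
have s (h h' : {poly A}) : (size h <= n.+1)%N -> (size (h * take_poly m h')%R <= n + m)%N.
  move=> sh; apply: leq_trans (size_polyMleq _ _) _.
  have := size_take_poly m h'; have : (0 < m)%N by rewrite subn_gt0.
  by move: sh; lia.
by rewrite !s.
Qed.

Lemma bez_col_horner n f g k x : f.[x] = 0 -> g.[x] = 0 -> (bez_col n f g k).[x] = 0.
Proof. by move=> fx gx; rewrite hornerD hornerN !hornerM fx gx !mul0r subrr. Qed.

Lemma bezoutian_root n f g x : (size f <= n.+1)%N -> (size g <= n.+1)%N ->
  f.[x] = 0 -> g.[x] = 0 -> (\row_(j < n) x ^+ j) *m bezoutian n f g = 0.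
Proof.
move=> sf sg fx gx; apply/rowP => k; rewrite !mxE.
transitivity (bez_col n f g k).[x]; last exact: bez_col_horner.
rewrite (horner_coef_wide _ (bez_col_size sf sg (ltn_ord k))).
by apply: eq_bigr => j _; rewrite !mxE mulrC.
Qed.

Lemma bezoutian_lead0 n f g : (0 < n)%N -> (size f <= n)%N -> (size g <= n)%N ->
  \det (bezoutian n f g) = 0.
Proof.
case: n => // n _ sf sg; rewrite (expand_det_col _ ord0) big1 // => j _.
by rewrite mxE /bez_col subn0 !drop_poly_eq0 // !mulr0 subrr coef0 mul0r.
Qed.

Lemma drop_polyS m f : drop_poly m f = (f`_m)%:P + 'X * drop_poly m.+1 f.
Proof.
apply/polyP => -[|i]; rewrite coefD coefC coefXM !coef_drop_poly /= ?addr0 //.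
by rewrite add0r addnS.
Qed.

Lemma bezoutian_scaler n f g (c : A) : bezoutian n f (c *: g) = c *: bezoutian n f g.
Proof.
apply/matrixP => j k; rewrite !mxE /bez_col drop_polyZ -scalerAr -scalerAl -scalerBr.
by rewrite coefZ.
Qed.

(* The Christoffel-Darboux identity. *)
Lemma bez_col_generating n f g (w : A) :
  (size f <= n.+1)%N -> (size g <= n.+1)%N ->
  (1 - w *: 'X) * (\sum_(k < n) w ^+ k *: bez_col n f g k) =
  \sum_(k < n.+1) w ^+ k *: (g`_(n - k) *: f - f`_(n - k) *: g).
Proof.
move=> sf sg; pose c k := g`_(n - k) *: f - f`_(n - k) *: g.
have bS k : (k < n)%N -> bez_col n f g k.+1 = 'X * bez_col n f g k + c k.+1.
  move=> kn; rewrite /c /bez_col (drop_polyS (n - k.+1) g) (drop_polyS (n - k.+1) f).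
  have -> : (n - k.+1).+1 = (n - k)%N by rewrite subnSK.
  by rewrite -!mul_polyC; ring.
have b0 : bez_col n f g 0 = c 0%N.
  rewrite /c /bez_col subn0 (drop_polyS n g) (drop_polyS n f).
  by rewrite (drop_poly_eq0 sf) (drop_poly_eq0 sg) -!mul_polyC; ring.
have bn : bez_col n f g n = 0 by rewrite /bez_col subnn !drop_poly0l mulrC subrr.
have first m : (m <= n)%N ->
    (1 - w *: 'X) * (\sum_(k < m) w ^+ k *: bez_col n f g k) =
    \sum_(k < m.+1) w ^+ k *: c k - w ^+ m *: bez_col n f g m.
  elim: m => [|m IH] mn.
    by rewrite big_ord0 mulr0 big_ord1 expr0 !scale1r b0 subrr.
  rewrite big_ord_recr mulrDr IH 1?ltnW // [in RHS]big_ord_recr /= bS //.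
  by rewrite -!mul_polyC !polyC_exp exprS; ring.
by rewrite first // bn scaler0 subr0.
Qed.

End Bezoutian.

Lemma map_bezoutian (A B : comNzRingType) (phi : {rmorphism A -> B}) n f g :
  map_mx phi (bezoutian n f g) = bezoutian n (map_poly phi f) (map_poly phi g).
Proof.
apply/matrixP => j k; rewrite !mxE /bez_col.
have d m (h : {poly A}) : map_poly phi (drop_poly m h) = drop_poly m (map_poly phi h).
  by apply/polyP => i; rewrite coef_drop_poly !coef_map coef_drop_poly.
by rewrite -!d -!rmorphM -rmorphB coef_map.
Qed.

(** A kernel vector v gives f H(g) = g H(f) with H(g) of degree below n = deg g. Coprimality forces
    H(g) = 0, a triangular system in v whose diagonal is the leading coefficient of g. *)
Lemma bezoutian_unit (F : fieldType) n (f g : {poly F}) :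
  (size f <= n.+1)%N -> size g = n.+1 -> coprimep f g -> bezoutian n f g \in unitmx.
Proof.
move=> sf sg cfg; rewrite unitmxE unitfE -det_tr; apply/negP => /det0P [v v0 vB].
pose H (h : {poly F}) := \sum_(k < n) v 0 k *: drop_poly (n - k) h.
have E : f * H g = g * H f.
  apply/eqP; rewrite -subr_eq0 /H !mulr_sumr -sumrB.
  have -> : \sum_(k < n) (f * (v 0 k *: drop_poly (n - k) g) -
      g * (v 0 k *: drop_poly (n - k) f)) = \sum_(k < n) v 0 k *: bez_col n f g k.
    by apply: eq_bigr => k _; rewrite /bez_col scalerBr -!scalerAr.
  apply/eqP/polyP => j; rewrite coef0 coef_sum.
  have [jn|nj] := ltnP j n.
    move/rowP/(_ (Ordinal jn)): vB; rewrite !mxE => HH; rewrite -[RHS]HH.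
    by apply: eq_bigr => k _; rewrite !mxE coefZ.
  apply: big1 => k _; rewrite coefZ nth_default ?mulr0 //.
  by apply: leq_trans nj; apply: bez_col_size; rewrite ?sg.
have Hs : (size (H g) <= n)%N.
  apply: (leq_trans (size_sum _ _ _)); apply/bigmax_leqP => k _.
  apply: leq_trans (size_scale_leq _ _) _; rewrite size_drop_poly sg.
  by have := ltn_ord k; lia.
have H0 : H g = 0.
  apply/eqP; have : g %| H g by rewrite -(Gauss_dvdpr _ (_ : coprimep g f)) ?E ?dvdp_mulr // coprimep_sym.
  by apply: contraTT => Hg0; apply/negP => /(dvdp_leq Hg0); rewrite sg ltnNge Hs.
have gn : g`_n != 0 by rewrite -[n]/(n.+1.-1) -sg -lead_coefE lead_coef_eq0 -size_poly_eq0 sg.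
have vz : forall i (ii : (i < n)%N), v 0 (Ordinal ii) = 0.
  suff H1 m : forall i (ii : (i < n)%N), (n - i <= m)%N -> v 0 (Ordinal ii) = 0.
    by move=> i ii; apply: (H1 (n - i)%N).
  elim: m => [|m IH] i ii im; first by move: im ii; lia.
  have := congr1 (fun h : {poly F} => h`_i) H0; rewrite coef0 coef_sum.
  rewrite (bigD1 (Ordinal ii)) //= coefZ coef_drop_poly subnKC ?(ltnW ii) //.
  rewrite big1 ?addr0 => [/eqP|k ki]; first by rewrite mulf_eq0 (negPf gn) orbF => /eqP.
  rewrite coefZ coef_drop_poly.
  have [ltki|leik] := ltnP k i.
    by rewrite (@nth_default _ 0 g) ?mulr0 // sg; have := ii; lia.
  have lik : (i < k)%N by rewrite ltn_neqAle leik andbT eq_sym.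
  have -> : k = Ordinal (ltn_ord k) by apply: val_inj.
  by rewrite (IH _ (ltn_ord k)) ?mul0r //; have := ii; lia.
by case/negP: v0; apply/eqP/rowP => -[i ii]; rewrite mxE vz.
Qed.

(** * Positivity of the Bezoutian of a stable polynomial *)

Section Hermitian.
Variable C : numClosedFieldType.

Definition qform n (M : 'M[C]_n) (y : 'rV[C]_n) : C :=
  \sum_j \sum_k y 0 j * M j k * (y 0 k)^*.

(** The matrix identity behind this is B = T(f) T(f)^H - T(g) T(g)^H, where T(h) is the triangular
    Toeplitz matrix whose column l is X^l h cut at degree n. Conjugate reversal turns the
    coefficients of [drop_poly (n - k)] into the conjugated entries [F h l k]. *)
Lemma bezoutian_qform n (f : {poly C}) (y : 'rV[C]_n) (g := crev n f)
    (ell := fun h : {poly C} => \sum_(j < n) y 0 j * h`_j) :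
  (size f <= n.+1)%N ->
  qform (bezoutian n f g) y =
  \sum_(l < n) (`|ell ('X^l * f)| ^+ 2 - `|ell ('X^l * g)| ^+ 2).
Proof.
move=> sf; have sg : (size g <= n.+1)%N by exact: crev_size.
have gc i : (i <= n)%N -> g`_(n - i) = (f`_i)^*.
  by move=> le_in; rewrite crev_coef ?leq_subr // subKn.
have fc i : (i <= n)%N -> f`_(n - i) = (g`_i)^*.
  by move=> le_in; rewrite crev_coef // conjCK.
pose F (h : {poly C}) l k := if (k < l)%N then 0 else h`_(k - l).
have ellF (h : {poly C}) (l : nat) : ell ('X^l * h) = \sum_(k < n) y 0 k * F h l k.
  by apply: eq_bigr => k _; rewrite coefXnM.
have colE (h h' : {poly C}) (k : 'I_n) (j : 'I_n) : (size h <= n.+1)%N ->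
   (forall i, (i <= n)%N -> h`_(n - i) = (h'`_i)^*) ->
   (h' * drop_poly (n - k) h)`_j = \sum_(l < n) (F h' l j) * (F h' l k)^*.
  move=> sh hh; have kn := ltnW (ltn_ord k).
  rewrite coefMr (big_ord_widen n (fun l => h'`_(j - l) * (drop_poly (n - k) h)`_l)) //.
  rewrite big_mkcond; apply: eq_bigr => l _; rewrite ltnS /F ltnNge.
  case: (leqP l j) => lj /=; last by rewrite mul0r.
  rewrite coef_drop_poly; case: (ltnP k l) => kl.
    by rewrite rmorph0 (@nth_default _ 0 h) // (leq_trans sh) //; have := ltn_ord k; lia.
  congr (_ * _); rewrite -hh; last by rewrite (leq_trans (leq_subr _ _)).
  by congr (h`_ _); lia.
rewrite /qform.
have rearr (G : 'I_n -> 'I_n -> 'I_n -> C) :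
    \sum_j \sum_k y 0 j * (\sum_(l < n) G l j k) * (y 0 k)^* =
    \sum_(l < n) \sum_j \sum_k y 0 j * G l j k * (y 0 k)^*.
  rewrite [RHS]exchange_big; apply: eq_bigr => j _ /=.
  rewrite [RHS]exchange_big; apply: eq_bigr => k _ /=.
  by rewrite mulr_sumr mulr_suml.
transitivity (\sum_(j < n) \sum_(k < n) y 0 j *
    (\sum_(l < n) (F f l j * (F f l k)^* - F g l j * (F g l k)^*)) * (y 0 k)^*).
  apply: eq_bigr => j _; apply: eq_bigr => k _; congr (_ * _ * _).
  by rewrite mxE /bez_col coefB sumrB (colE g f) // (colE f g).
rewrite rearr; apply: eq_bigr => l _; rewrite !ellF !sqr_norm_sum -sumrB.
apply: eq_bigr => j _; rewrite -sumrB; apply: eq_bigr => k _.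
by rewrite !rmorphM /=; ring.
Qed.

Lemma bezoutian_psd n (f : {poly C}) (y : 'rV[C]_n) :
  (size f <= n.+1)%N -> stable1 f -> 0 <= qform (bezoutian n f (crev n f)) y.
Proof.
move=> sf st; rewrite bezoutian_qform // sumrB subr_ge0.
apply: (@crev_contract _ (fun h : {poly C} => \sum_(j < n) y 0 j * h`_j)) => //.
  move=> a u v; rewrite mulr_sumr -big_split; apply: eq_bigr => j _ /=.
  by rewrite coefD coefZ mulrDr; ring.
move=> l h nl; apply: big1 => j _.
by rewrite coefXnM (leq_trans (ltn_ord j) nl) mulr0.
Qed.

(** On combinations of the vectors (z_a^j) the form becomes a Christoffel-Darboux kernel, that is, a
    difference of two one-variable Szego forms, with weights d f and d g. *)
Lemma bezoutian_qform_eval n (I : finType) (f : {poly C}) (g := crev n f) (d z : I -> C) :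
  (size f <= n.+1)%N -> (forall a, `|z a| < 1) ->
  qform (bezoutian n f g) (\row_(j < n) \sum_a d a * z a ^+ j) =
  \sum_a \sum_b d a * (d b)^* * ((f.[z a] * (f.[z b])^* - g.[z a] * (g.[z b])^*) *
    (1 - z a * (z b)^*)^-1).
Proof.
move=> sf z1; have sg : (size g <= n.+1)%N by exact: crev_size.
have K a b : \sum_(j < n) \sum_(k < n) z a ^+ j * (bezoutian n f g) j k * (z b ^+ k)^* =
    (f.[z a] * (f.[z b])^* - g.[z a] * (g.[z b])^*) * (1 - z a * (z b)^*)^-1.
  have u0 : 1 - z a * (z b)^* != 0.
    rewrite subr_eq0 eq_sym; apply: contraTneq (z1 a) => E.
    have : `|z a| * `|z b| < 1 by rewrite mulr_ilt1.
    by rewrite -(norm_conjC (z b)) -normrM E normr1 ltxx.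
  apply: (mulIf u0); rewrite mulfVK //.
  pose S := \sum_(k < n) ((z b)^* ^+ k *: bez_col n f g k).[z a].
  have HS : (1 - (z b)^* * z a) * S =
      \sum_(k < n.+1) ((z b)^* ^+ k *: (g`_(n - k) *: f - f`_(n - k) *: g)).[z a].
    have := congr1 (fun h : {poly C} => h.[z a]) (bez_col_generating ((z b)^*) sf sg).
    by rewrite hornerM hornerD hornerN hornerC hornerZ hornerX !horner_sum.
  transitivity (S * (1 - z a * (z b)^*)); first congr (_ * _).
    rewrite exchange_big; apply: eq_bigr => k _ /=.
    rewrite hornerZ (horner_coef_wide _ (bez_col_size sf sg (ltn_ord k))) mulr_sumr.
    by apply: eq_bigr => j _; rewrite mxE rmorphXn /=; ring.
  rewrite mulrC [z a * _]mulrC HS.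
  have hc (h : {poly C}) : (size h <= n.+1)%N ->
      (h.[z b])^* = \sum_(k < n.+1) (z b)^* ^+ k * (h`_k)^*.
    move=> sh; rewrite (horner_coef_wide _ sh) rmorph_sum; apply: eq_bigr => k _.
    by rewrite rmorphM rmorphXn /= mulrC.
  rewrite !hc // !mulr_sumr -sumrB; apply: eq_bigr => k _.
  rewrite hornerZ hornerD hornerN !hornerZ.
  have kn : (k <= n)%N by rewrite -ltnS.
  by rewrite (crev_coef _ (leq_subr _ _)) subKn // (crev_coef _ kn) conjCK; ring.
rewrite /qform.
under eq_bigr => j _.
  under eq_bigr => k _.
    rewrite !mxE rmorph_sum mulr_suml mulr_suml.
    under eq_bigr => a _ do rewrite mulr_sumr.
  over.
over.
rewrite /=; under eq_bigr => j _ do rewrite exchange_big /=.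
rewrite exchange_big; apply: eq_bigr => a _ /=.
under eq_bigr => j _ do rewrite exchange_big /=.
rewrite exchange_big; apply: eq_bigr => b _ /=.
rewrite -K mulr_sumr; apply: eq_bigr => j _; rewrite mulr_sumr; apply: eq_bigr => k _.
by rewrite mxE !rmorphM /= !rmorphXn /=; ring.
Qed.

End Hermitian.

(** * Hermitian polynomial matrices on the circle *)

Section CirclePolynomials.
Variable C : numClosedFieldType.
Implicit Types (f g : {poly C}) (x y z t a b c : C).

Lemma circle_conj z : `|z| = 1 -> z^* = z^-1.
Proof. by move=> z1; rewrite [RHS]invC_norm z1 expr1n invr1 mul1r. Qed.

Lemma circle_neq0 z : `|z| = 1 -> z != 0.
Proof. by move=> z1; rewrite -normr_gt0 z1 ltr01. Qed.

(** In place of compactness, the polynomial is split into linear factors: a root w off the circle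
    keeps distance at least ||w| - 1| from it. *)
Lemma lower_bound_circle f : (forall z, `|z| = 1 -> f.[z] != 0) ->
  exists2 e : C, 0 < e & forall z, `|z| = 1 -> e <= `|f.[z]|.
Proof.
have [n] := ubnP (size f); elim: n f => // n IH f szf f0.
have [sz1|sz1] := leqP (size f) 1.
  exists `|f`_0|.
    rewrite normr_gt0; have := f0 1 (normr1 _).
    by rewrite {1}(size1_polyC sz1) hornerC.
  by move=> z _; rewrite {2}(size1_polyC sz1) hornerC.
have [w /rootP fw] : exists w, root f w.
  by apply/closed_rootP; apply/eqP => szf1; rewrite szf1 in sz1.
have /factor_theorem [g fE] : root f w by apply/rootP.
have g0 : forall z, `|z| = 1 -> g.[z] != 0.
  by move=> z /f0; rewrite fE hornerM mulf_eq0 negb_or => /andP[].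
have gn0 : g != 0.
  by apply: contraTneq (g0 1 (normr1 _)) => ->; rewrite horner0 eqxx.
have szg : (size g < n)%N.
  by move: szf; rewrite fE size_Mmonic ?monicXsubC // size_XsubC addn2.
have [e e0 he] := IH g szg g0.
have w1 : `|w| != 1 by apply/eqP => /f0; rewrite fw eqxx.
exists (e * Num.norm (Num.norm w - 1)) => [|z z1].
  by rewrite mulr_gt0 // normr_gt0 subr_eq0.
rewrite fE hornerM hornerXsubC normrM ler_pM //; first exact: ltW.
  exact: he.
by rewrite -z1 distrC (le_trans (ler_dist_dist _ _)).
Qed.

(** The Cayley transform (1 + i d)/(1 - i d) produces points of the circle near 1 algebraically. *)
Lemma circle_point (d : C) : 0 < d -> exists u : C,
  [/\ `|u| = 1, u != 1 & `|u - 1| <= 2%:R * d].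
Proof.
move=> d0; pose w : C := 1 + 'i * d; pose u := w / w^*.
have dr : d \is Num.real by rewrite realE ltW.
have wc : w^* = 1 - 'i * d.
  by rewrite rmorphD rmorphM /= rmorph1 conjCi (conj_Creal dr) mulNr.
have nw : 1 <= `|w|.
  have : 1 <= `|w| ^+ 2.
    rewrite normCK wc.
    have -> : w * (1 - 'i * d) = 1 - 'i ^+ 2 * d ^+ 2 by rewrite /w; ring.
    by rewrite sqrCi mulN1r opprK lerDl exprn_ge0 // ltW.
  by rewrite expr_ge1.
have w0 : w != 0 by rewrite -normr_gt0 (lt_le_trans ltr01).
have wc0 : w^* != 0 by rewrite conjC_eq0.
exists u; split.
- by rewrite normrM normfV norm_conjC mulfV // normr_eq0.
- apply/eqP => u1; have : w - w^* = 0.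
    by apply/eqP; rewrite subr_eq0; apply/eqP; rewrite -[LHS](divfK wc0) -/u u1 mul1r.
  rewrite wc /w => /eqP; have -> : 1 + 'i * d - (1 - 'i * d) = 2%:R * ('i * d) :> C by ring.
  by rewrite !mulf_eq0 pnatr_eq0 /= (negPf (neq0Ci _)) (gt_eqF d0).
have -> : u - 1 = (w - w^*) / w^* by rewrite mulrBl mulfV.
have -> : w - w^* = 2%:R * ('i * d) by rewrite wc /w; ring.
rewrite normrM normfV norm_conjC normrM normrM normCi mul1r (ger0_norm (ltW d0)).
rewrite ger0_norm ?ler0n // ler_piMr ?mulr_ge0 ?ler0n ?(ltW d0) //.
by rewrite invf_le1 // (lt_le_trans ltr01).
Qed.

Lemma circle_approx f t : `|t| = 1 -> exists2 K : C, 0 <= K &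
  forall d, 0 < d -> d < 1 -> exists u, [/\ `|u| = 1, u != 1,
    `|u - 1| <= 2%:R * d, `|f.[t * u] - f.[t]| <= K * d &
    `|f.[t * u^-1] - f.[t]| <= K * d].
Proof.
move=> t1; have [K K0 lip] := horner_lipschitz f (@ler01 C).
exists (K * 2%:R) => [|d d0 d1]; first by rewrite mulr_ge0 ?ler0n.
have [u [u1 un1 ud]] := circle_point d0.
have tu : `|t * u| <= 1 by rewrite normrM t1 u1 mul1r.
have tv : `|t * u^-1| <= 1 by rewrite normrM normfV t1 u1 invr1 mul1r.
have t1' : `|t| <= 1 by rewrite t1.
exists u; split => //.
  apply: (le_trans (lip _ _ tu t1')).
  rewrite -[t in X in _ - X]mulr1 -mulrBr normrM t1 mul1r -mulrA.
  exact: ler_wpM2l.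
apply: (le_trans (lip _ _ tv t1')).
rewrite -[t in X in _ - X]mulr1 -mulrBr normrM t1 mul1r -mulrA.
have -> : u^-1 - 1 = u^-1 * (1 - u) by rewrite mulrBr mulr1 mulVf // circle_neq0.
by rewrite normrM normfV u1 invr1 mul1r distrC ler_wpM2l.
Qed.

Lemma small_eq0 (a K : C) : 0 <= a -> 0 <= K -> (forall d, 0 < d -> d < 1 -> a <= K * d) -> a = 0.
Proof.
move=> a0 K0 H; apply/le_anti; rewrite a0 andbT.
apply: (@le_of_lt1_slack _ _ _ K) => //; first by rewrite realE a0.
by move=> d d0 d1; rewrite add0r H.
Qed.

Lemma ge0_approx (a K : C) : 0 <= K ->
  (forall d, 0 < d -> d < 1 -> exists2 b, 0 <= b & `|a - b| <= K * d) -> 0 <= a.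
Proof.
move=> K0 H.
have ac : a^* = a.
  apply/eqP; rewrite -subr_eq0 -normr_eq0; apply/eqP.
  apply: (@small_eq0 _ (K + K)); rewrite ?addr_ge0 // => d d0 d1.
  have [b b0 hb] := H d d0 d1.
  have -> : a^* - a = (a - b)^* - (a - b) by rewrite rmorphB /= (geC0_conj b0); ring.
  by rewrite (le_trans (ler_normB _ _)) // norm_conjC mulrDl lerD.
have ar : a \is Num.real by apply/CrealP.
apply: (@le_of_lt1_slack _ _ _ K) => // d d0 d1; have [b b0 hb] := H d d0 d1.
apply: (le_trans b0); rewrite -lerBlDl (le_trans _ hb) // distrC real_ler_norm //.
by rewrite realB // realE b0.
Qed.

Lemma circle_ge0_closed f n t : `|t| = 1 ->
  (forall z, `|z| = 1 -> z != t -> 0 <= z ^- n * f.[z]) -> 0 <= t ^- n * f.[t].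
Proof.
move=> t1 H; have t0 := circle_neq0 t1.
have [K K0 hK] := circle_approx f t1.
have [M M0 hM] := horner_bound f (@ler01 C).
have [L L0 hL] := horner_lipschitz ('X^n) (@ler01 C).
apply: (@ge0_approx _ (K + L * 2%:R * M)); first by rewrite addr_ge0 ?mulr_ge0 ?ler0n.
move=> d d0 d1; have [u [u1 un1 ud fu _]] := hK d d0 d1.
have tu1 : `|t * u| = 1 by rewrite normrM t1 u1 mul1r.
exists ((t * u) ^- n * f.[t * u]).
  by apply: H => //; rewrite -[X in _ == X]mulr1 (inj_eq (mulfI t0)).
have nn z : `|z| = 1 -> `|z ^- n| = 1 by move=> z1; rewrite normfV normrX z1 expr1n invr1.
have -> : t ^- n * f.[t] - (t * u) ^- n * f.[t * u] =
    (t * u) ^- n * (f.[t] - f.[t * u]) + (t ^- n - (t * u) ^- n) * f.[t] by ring.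
rewrite (le_trans (ler_normD _ _)) // [leRHS]mulrDl lerD //.
  by rewrite normrM nn // mul1r distrC.
rewrite normrM mulrAC ler_pM //; last by apply: hM; rewrite t1.
have -> : t ^- n - (t * u) ^- n = - (t ^- n * (t * u) ^- n * (t ^+ n - (t * u) ^+ n)).
  have a0 : t ^+ n != 0 by rewrite expf_neq0.
  have b0 : (t * u) ^+ n != 0 by rewrite expf_neq0 // circle_neq0.
  by field; rewrite a0 b0.
rewrite normrN !normrM !nn // !mul1r.
have := hL t (t * u); rewrite !hornerXn t1 tu1 lexx => /(_ isT isT)/le_trans; apply.
rewrite -[t in X in `|X - _|]mulr1 -mulrBr normrM t1 mul1r distrC -mulrA.
exact: ler_wpM2l.
Qed.

(* Nonnegativity on the circle forces even order: a simple factor [z - t]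
   changes argument by pi across [t]. *)
Lemma circle_ge0_double_root f n t : `|t| = 1 ->
  (forall z, `|z| = 1 -> 0 <= z ^- n * ((z - t) * f.[z])) -> f.[t] = 0.
Proof.
move=> t1 H; have t0 := circle_neq0 t1.
have [K K0 hK] := circle_approx f t1.
have [M M0 hM] := horner_bound f (@ler01 C).
have [L L0 hL] := horner_lipschitz ('X^(2 * n)) (@ler01 C).
have FM : `|f.[t]| <= M by apply: hM; rewrite t1.
suff : 0 <= - (f.[t] * (f.[t])^*).
  rewrite -normCK oppr_ge0 => h; apply/eqP.
  by rewrite -(normr_eq0 f.[t]) -sqrf_eq0 eq_le h exprn_ge0.
apply: (@ge0_approx _ ((L * 2%:R + 2%:R) * (M * M) + (K * M + M * K))).
  by rewrite !addr_ge0 ?mulr_ge0 ?addr_ge0 ?mulr_ge0 ?ler0n.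
move=> d d0 d1; have [u [u1 un1 ud fu fv]] := hK d d0 d1.
have u0 := circle_neq0 u1.
have tu1 : `|t * u| = 1 by rewrite normrM t1 u1 mul1r.
have tv1 : `|t * u^-1| = 1 by rewrite normrM normfV t1 u1 invr1 mul1r.
set f1 := f.[t * u] in fu; set f2 := f.[t * u^-1] in fv.
(* The values at t u and t/u are nonnegative, and so is their product. Since (u - 1)^2 = - u |u -
   1|^2 on the circle, it equals |u - 1|^2 times - c f1 conj f2, where c tends to 1 with u. *)
pose c := u * u^-1 ^+ (2 * n).
exists (- (c * f1 * f2^*)).
  have := mulr_ge0 (H _ tu1) (H _ tv1); rewrite -/f1 -/f2.
  rewrite -[X in _ * X](geC0_conj (H _ tv1)) -/f2.
  have u10 : 0 < `|u - 1| ^+ 2 by rewrite exprn_gt0 // normr_gt0 subr_eq0.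
  set A := _ * _ => A0; rewrite -(pmulr_rge0 _ u10); suff <- : A = `|u - 1| ^+ 2 * - (c * f1 * f2^*) by [].
  rewrite /A /c normCK !(rmorphM, rmorphB) /= !fmorphV !rmorphXn /= !(rmorphM, fmorphV) /= rmorph1.
  rewrite (circle_conj u1) (circle_conj t1) !invrK !exprMn !exprVn mulnC exprM.
  have tn0 : t ^+ n != 0 by rewrite expf_neq0.
  have un0 : u ^+ n != 0 by rewrite expf_neq0.
  field; rewrite ?tn0 ?un0 ?t0 ?u0 //.
have -> : - (f.[t] * (f.[t])^*) - - (c * f1 * f2^*) =
   (c - 1) * (f.[t] * (f.[t])^*) + c * ((f1 - f.[t]) * (f.[t])^* + f1 * (f2 - f.[t])^*).
  by rewrite rmorphB; ring.
have nc : `|c| = 1 by rewrite normrM normrX normfV u1 invr1 expr1n mulr1.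
have f1M : `|f1| <= M by apply: hM; rewrite tu1.
rewrite (le_trans (ler_normD _ _)) // [leRHS]mulrDl lerD //.
  rewrite normrM mulrAC ler_pM //; last by rewrite normrM norm_conjC ler_pM.
  have -> : c - 1 = u * (u^-1 ^+ (2 * n) - 1) + (u - 1) by rewrite /c; ring.
  rewrite (le_trans (ler_normD _ _)) // [leRHS]mulrDl lerD // normrM u1 mul1r.
  have := hL u^-1 1; rewrite !hornerXn expr1n normfV u1 invr1 normr1 lexx.
  move=> /(_ isT isT)/le_trans; apply; rewrite -mulrA ler_wpM2l //.
  have -> : u^-1 - 1 = u^-1 * (1 - u) by rewrite mulrBr mulr1 mulVf.
  by rewrite normrM normfV u1 invr1 mul1r distrC.
rewrite normrM nc mul1r (le_trans (ler_normD _ _)) // [leRHS]mulrDl !normrM !norm_conjC lerD //.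
  by rewrite mulrAC ler_pM.
by rewrite -mulrA ler_pM.
Qed.

End CirclePolynomials.

(** * Positive semidefinite forms *)

Section QuadraticForms.
Variable C : numClosedFieldType.

(** Testing t = 1 and t = i gives the hermitian symmetry; t = -b/c then gives the inequality. When c
    = 0, a large negative multiple of b forces b = 0. *)
Lemma hermitian_form_bound (a b b' c : C) : 0 <= c ->
  (forall t, 0 <= a + t^* * b + t * b' + t * t^* * c) ->
  b' = b^* /\ `|b| ^+ 2 <= a * c.
Proof.
move=> c0 H.
have a0 : 0 <= a by have := H 0; rewrite rmorph0 !mul0r !addr0.
have cc : c^* = c by apply: geC0_conj.
have ac : a^* = a by apply: geC0_conj.
have bb : b' = b^*.
  have H1 := geC0_conj (H 1); have Hi := geC0_conj (H 'i).
  rewrite !(rmorphD, rmorphM) /= !rmorph1 !mul1r cc ac in H1.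
  rewrite !(rmorphD, rmorphM) /= !conjCK !conjCi cc ac in Hi.
  have {}H1 : b^* + b'^* = b + b'.
    have -> : b^* + b'^* = a + b^* + b'^* + c - a - c by ring.
    by rewrite H1; ring.
  have {}Hi : 'i * (b^* - b'^*) = 'i * (b' - b).
    have -> : 'i * (b^* - b'^*) =
       a + 'i * b^* + - 'i * b'^* + - 'i * 'i * c - a + 'i * 'i * c by ring.
    by rewrite Hi; ring.
  have {}Hi := mulfI (neq0Ci _) Hi.
  have two : 2%:R != 0 :> C by rewrite pnatr_eq0.
  apply: (mulfI two).
  have -> : 2%:R * b^* = (b^* + b'^*) + (b^* - b'^*) by ring.
  by rewrite H1 Hi; ring.
split=> //; rewrite {}bb in H.
have [c00|cn0] := eqVneq c 0.
  rewrite c00 mulr0; have [->|bn0] := eqVneq b 0; first by rewrite normr0 expr0n.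
  have nb0 : 0 < `|b| ^+ 2 by rewrite exprn_gt0 // normr_gt0.
  pose s := (a + 1) / `|b| ^+ 2.
  have s0 : 0 <= s by rewrite divr_ge0 ?addr_ge0 // ltW.
  have := H (- (s * b)); rewrite c00 mulr0 addr0 rmorphN rmorphM /= (geC0_conj s0).
  have -> : a + - (s * b^*) * b + - (s * b) * b^* = a - 2%:R * (s * `|b| ^+ 2).
    by rewrite normCK; ring.
  rewrite /s divfK ?(gt_eqF nb0) //.
  have -> : a - 2%:R * (a + 1) = - (a + 2%:R) by ring.
  by rewrite oppr_ge0 => /(lt_le_trans (ltr_wpDl a0 (ltr0Sn C 1))); rewrite ltxx.
have {}cn0 : 0 < c by rewrite lt_def cn0.
have := H (- (b / c)); rewrite rmorphN rmorphM fmorphV /= cc.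
have -> : a + - (b^* / c) * b + - (b / c) * b^* + - (b / c) * - (b^* / c) * c =
    a - `|b| ^+ 2 / c.
  by rewrite normCK; field; rewrite gt_eqF.
by rewrite subr_ge0 ler_pdivrMr.
Qed.

Variable n : nat.
Implicit Types (M : 'M[C]_n) (y : 'rV[C]_n) (x : 'cV[C]_n).

Definition sform M y (z : 'rV[C]_n) := \sum_j \sum_k y 0 j * M j k * (z 0 k)^*.

Lemma qform_sform M y : qform M y = sform M y y. Proof. by []. Qed.

Lemma sform_mx M y (z : 'rV[C]_n) : sform M y z = (y *m M *m (map_mx Num.conj z)^T) 0 0.
Proof.
rewrite /sform mxE exchange_big; apply: eq_bigr => k _ /=.
by rewrite !mxE mulr_suml.
Qed.

Lemma qform_congr M (G : 'M[C]_n) y :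
  qform (G *m M *m (map_mx Num.conj G)^T) y = qform M (y *m G).
Proof. by rewrite !qform_sform !sform_mx map_mxM trmx_mul !mulmxA. Qed.

Lemma sform_psd M y (z : 'rV[C]_n) : (forall y, 0 <= qform M y) ->
  sform M z y = (sform M y z)^* /\ `|sform M y z| ^+ 2 <= qform M y * qform M z.
Proof.
move=> H; apply: hermitian_form_bound => // t.
have -> : qform M y + t^* * sform M y z + t * sform M z y + t * t^* * qform M z =
    qform M (y + t *: z).
  rewrite !qform_sform !sform_mx !map_mxD !map_mxZ !linearD /= !linearZ /=.
  rewrite !mulmxDl -!scalemxAl.
  move: (y *m M *m (map_mx Num.conj y)^T) (y *m M *m (map_mx Num.conj z)^T)
    (z *m M *m (map_mx Num.conj y)^T) (z *m M *m (map_mx Num.conj z)^T) => A1 A2 A3 A4.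
  by rewrite !mxE; ring.
exact: H.
Qed.

Lemma psd_hermitian M : (forall y, 0 <= qform M y) -> forall j k, M k j = (M j k)^*.
Proof.
move=> H j k; have [+ _] := sform_psd (delta_mx 0 j) (delta_mx 0 k) H.
have E i l : sform M (delta_mx 0 i) (delta_mx 0 l) = M i l.
  by rewrite sform_mx -rowE map_delta_mx trmx_delta -colE !mxE.
by rewrite !E.
Qed.

End QuadraticForms.

(** * Dividing the circle roots out of the determinant *)

Section CircleMatrices.
Variable C : numClosedFieldType.
Implicit Types (t z : C) (d : nat).

Definition evm m n z (B : 'M[{poly C}]_(m, n)) : 'M[C]_(m, n) := map_mx (horner_eval z) B.

Definition polyC_mx m n (B : 'M[C]_(m, n)) : 'M[{poly C}]_(m, n) := map_mx polyC B.

Lemma evm_polyC_mx m n z (B : 'M[C]_(m, n)) : evm z (polyC_mx B) = B.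
Proof. by apply/matrixP => i j; rewrite !mxE /= /horner_eval hornerC. Qed.

Lemma evmM m n k z (A : 'M[{poly C}]_(m, n)) (B : 'M[{poly C}]_(n, k)) :
  evm z (A *m B) = evm z A *m evm z B.
Proof. exact: map_mxM. Qed.

Lemma evm_coef m n z (B : 'M[{poly C}]_(m, n)) i j : evm z B i j = (B i j).[z].
Proof. by rewrite mxE. Qed.

Lemma det_evm n z (B : 'M[{poly C}]_n) : \det (evm z B) = (\det B).[z].
Proof. exact: det_map_mx. Qed.

Variable n : nat.
Implicit Types (B : 'M[{poly C}]_n) (x : 'cV[{poly C}]_n) (y : 'rV[C]_n).

Definition psd_circle B d := forall z, `|z| = 1 -> forall y, 0 <= z ^- d * qform (evm z B) y.

(* On the circle the hermitian matrix is [z^-d B(z)]; [dominated] says that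
   [x x^*] is bounded by a multiple of it, i.e. that [x^* T^-1 x] is bounded
   where [T] is invertible. *)
Definition dominated B d x := exists2 K : C, 0 <= K &
  forall z, `|z| = 1 -> forall y,
    `|(y *m evm z x) 0 0| ^+ 2 <= K * (z ^- d * qform (evm z B) y).

Lemma qformZ (M : 'M[C]_n) y (a : C) : qform (a *: M) y = a * qform M y.
Proof.
rewrite /qform mulr_sumr; apply: eq_bigr => j _; rewrite mulr_sumr.
by apply: eq_bigr => k _; rewrite mxE; ring.
Qed.

Lemma evm_entries_bound m (x : 'cV[{poly C}]_m) : exists2 K : C, 0 <= K &
  forall z i, `|z| = 1 -> `|evm z x i 0| <= K.
Proof.
have h i : exists2 K : C, 0 <= K & forall z, `|z| <= 1 -> `|(x i 0).[z]| <= K.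
  exact: horner_bound.
have [K K0 hK] := fin_all_exists2 h.
exists (\sum_i K i) => [|z i z1]; first by apply: sumr_ge0 => i _.
rewrite evm_coef (le_trans (hK i z _)) ?z1 // (bigD1 i) //= lerDl.
by apply: sumr_ge0.
Qed.

(** With T = z^-d B(z), the equation T w = x is solved by Cramer's rule. Cauchy-Schwarz for T bounds
    |y x|^2 by the form at y times the form at the conjugate transpose of w; the latter is bounded
    because det B stays away from 0 on the circle. *)
Lemma dominated_nonsingular B d x : psd_circle B d ->
  (forall z, `|z| = 1 -> (\det B).[z] != 0) -> dominated B d x.
Proof.
move=> psd det0; have [e e0 he] := lower_bound_circle det0.
pose u := \adj B *m x.
have [Ku Ku0 hu] := evm_entries_bound u; have [Kx Kx0 hx] := evm_entries_bound x.
exists (\sum_(i < n) (Ku / e) * Kx).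
  by apply: sumr_ge0 => i _; rewrite mulr_ge0 // divr_ge0 // ltW.
move=> z z1 y; have z0 := circle_neq0 z1.
pose M := z ^- d *: evm z B; pose h := (\det B).[z].
have h0 : h != 0 := det0 z z1.
pose w := (z ^+ d / h) *: evm z u; pose w' : 'rV[C]_n := (map_mx Num.conj w)^T.
have psdM y' : 0 <= qform M y' by rewrite qformZ psd.
have Mw : M *m w = evm z x.
  rewrite /M /w -scalemxAl -scalemxAr scalerA -evmM /u mulmxA mul_mx_adj.
  rewrite mul_scalar_mx /evm map_mxZ /= -/h /horner_eval scalerA.
  have zd0 : z ^+ d != 0 by rewrite expf_neq0.
  by have -> : z ^- d * (z ^+ d / h) * h = 1; [field; rewrite zd0 h0|rewrite scale1r].
have [_ CS] := sform_psd y w' psdM.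
have sE : sform M y w' = (y *m evm z x) 0 0.
  rewrite sform_mx /w' map_trmx trmxK -map_mx_comp.
  have -> : map_mx (Num.conj \o Num.conj) w = w.
    by apply/matrixP => i j; rewrite mxE /= conjCK.
  by rewrite -mulmxA Mw.
have <- : qform M y = z ^- d * qform (evm z B) y by rewrite qformZ.
rewrite -sE (le_trans CS) // mulrC ler_wpM2r //.
rewrite -[leLHS]ger0_norm // qform_sform sform_mx.
have -> : (map_mx Num.conj w')^T = w.
  rewrite /w' map_trmx trmxK -map_mx_comp.
  by apply/matrixP => i j; rewrite mxE /= conjCK.
rewrite -mulmxA Mw mxE (le_trans (ler_norm_sum _ _ _)) //; apply: ler_sum => i _.
rewrite normrM ler_pM ?hx // 2!mxE norm_conjC.
have -> : `|w i 0| = `|evm z u i 0| / `|h|.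
  by rewrite /w mxE normrM normrM normfV normrX z1 expr1n mul1r mulrC.
apply: ler_pM; rewrite ?invr_ge0 //; first exact: hu.
by rewrite lef_pV2 ?posrE ?normr_gt0 // he.
Qed.

Lemma unitmx_with_row (u : 'rV[C]_n) (i : 'I_n) : u != 0 ->
  exists2 G : 'M[C]_n, G \in unitmx & row i G = u.
Proof.
move=> u0; pose f : 'M[C]_n := delta_mx i 0 *m u.
have uE : delta_mx 0 i *m f = u.
  by rewrite /f mulmxA mul_delta_mx; apply/rowP => b; rewrite mxE big_ord1 mxE mul1r.
have rE : \rank ((delta_mx 0 i : 'rV[C]_n) *m f) = \rank (delta_mx 0 i : 'rV[C]_n).
  by rewrite uE mxrank_delta rank_rV u0.
have [G Gu fG] := complete_unitmx rE.
by exists G; rewrite // rowE -fG uE.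
Qed.

Lemma mul_mx_diagE (K : comNzRingType) (M : 'M[K]_n) (v : 'rV[K]_n) a b :
  (M *m diag_mx v) a b = M a b * v 0 b.
Proof. by rewrite mul_mx_diag mxE. Qed.

Lemma diag_mul_mx_diagE (K : comNzRingType) (M : 'M[K]_n) (u v : 'rV[K]_n) a b :
  (diag_mx u *m M *m diag_mx v) a b = u 0 a * M a b * v 0 b.
Proof. by rewrite mul_mx_diagE mul_diag_mx mxE. Qed.

Section DivideRoot.
Variables (B : 'M[{poly C}]_n) (d : nat) (t : C).
Hypotheses (psd : psd_circle B d) (t1 : `|t| = 1) (dett : (\det B).[t] = 0).

Lemma congruent_root : exists (i : 'I_n) (G : 'M[C]_n),
  G \in unitmx /\ forall k, (row i G *m evm t B) 0 k = 0.
Proof.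
have /det0P [u u0 uB] : \det (evm t B) == 0 by rewrite det_evm dett.
have [i ui] : exists i, u 0 i != 0.
  apply/existsP; apply: contraNT u0 => /existsPn H; apply/eqP/rowP => i.
  by rewrite mxE; have := H i; rewrite negbK => /eqP.
have [G Gu Gi] := unitmx_with_row i u0.
by exists i, G; split=> // k; rewrite Gi uB mxE.
Qed.

Variables (i : 'I_n) (G : 'M[C]_n).
Hypotheses (Gu : G \in unitmx) (Gi : forall k, (row i G *m evm t B) 0 k = 0).

Let B1 := polyC_mx G *m B *m polyC_mx (map_mx Num.conj G)^T.
Let D : {poly C} := 'X - t%:P.
Let t0 : t != 0 := circle_neq0 t1.

Let evB1 z : evm z B1 = G *m evm z B *m (map_mx Num.conj G)^T.
Proof. by rewrite /B1 !evmM !evm_polyC_mx. Qed.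

Let psdB1 : psd_circle B1 d.
Proof. by move=> z z1 y; rewrite evB1 qform_congr psd. Qed.

Let rowB1 k : (B1 i k).[t] = 0.
Proof.
rewrite -evm_coef evB1 -mulmxA; set M := G *m _.
have -> : M i k = (row i M) 0 k by rewrite [RHS]mxE.
have G0 : row i G *m evm t B = 0 by apply/rowP => j; rewrite Gi mxE.
by rewrite /M row_mul mulmxA G0 mul0mx mxE.
Qed.

Let colB1 k : (B1 k i).[t] = 0.
Proof.
have psdt y : 0 <= qform (t ^- d *: evm t B1) y by rewrite qformZ psdB1.
have := psd_hermitian psdt i k.
have E a b : (t ^- d *: evm t B1) a b = t ^- d * (B1 a b).[t] by rewrite mxE evm_coef.
rewrite !E rowB1 mulr0 rmorph0 => /eqP.
by rewrite mulf_eq0 invr_eq0 expf_eq0 (negPf t0) andbF => /eqP.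
Qed.

Let q a b := B1 a b %/ D.

Let divD (f : {poly C}) : f.[t] = 0 -> f = D * (f %/ D).
Proof. by move=> ft; rewrite mulrC divpK // dvdp_XsubCl; apply/rootP. Qed.

Let q_root : (q i i).[t] = 0.
Proof.
apply: (@circle_ge0_double_root _ _ d t t1) => z z1.
suff <- : qform (evm z B1) (delta_mx 0 i) = (z - t) * (q i i).[z] by exact: psdB1.
have -> : (z - t) * (q i i).[z] = (B1 i i).[z].
  by rewrite [in RHS](divD (rowB1 i)) hornerM hornerXsubC.
by rewrite qform_sform sform_mx -rowE map_delta_mx trmx_delta -colE 2![LHS]mxE evm_coef.
Qed.

(** This is G B G^H with row i divided by z - t and column i by its conjugate. On the circle conj(z
    - t) = -(z - t)/(t z), so the column is divided by z - t and multiplied by -t z: entries stay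
    polynomial and d is unchanged. The diagonal entry can be divided twice by [q_root]. *)
Let B' : 'M[{poly C}]_n := \matrix_(a, b)
  if a == i then if b == i then (- t) *: ('X * (q i i %/ D)) else q i b
  else if b == i then (- t) *: ('X * q a i) else B1 a b.

Let s (a : 'I_n) : {poly C} := if a == i then D else 1.
Let r (a : 'I_n) : {poly C} := if a == i then (- t) *: 'X else 1.

Let B'E a b : B1 a b * r b = s a * B' a b * s b.
Proof.
rewrite /r /s [B' a b]mxE; have [->|ai] := eqVneq a i; have [->|bi] := eqVneq b i.
- rewrite {1}(divD (rowB1 i)) -/(q i i) {1}(divD q_root).
  by rewrite -!mul_polyC; ring.
- by rewrite {1}(divD (rowB1 b)) -/(q i b); ring.
- by rewrite {1}(divD (colB1 a)) -/(q a i) -!mul_polyC; ring.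
by rewrite mul1r !mulr1.
Qed.

Let det_scale : \det B' * D ^+ 2 = (\det G * (\det G)^* * - t) *: ('X * \det B).
Proof.
have E : B1 *m diag_mx (\row_a r a) = diag_mx (\row_a s a) *m B' *m diag_mx (\row_a s a).
  apply/matrixP => a b.
  rewrite mul_mx_diagE diag_mul_mx_diagE.
  by rewrite [X in _ * X]mxE B'E; congr (_ * _ * _); rewrite mxE.
have prod1 (f : 'I_n -> {poly C}) : (forall a, a != i -> f a = 1) ->
    \prod_a (\row_a f a) 0 a = f i.
  move=> f1; rewrite (bigD1 i) //= mxE big1 ?mulr1 // => a ai.
  by rewrite mxE f1.
have := congr1 determinant E; rewrite !det_mulmx !det_diag !prod1; first last.
- by move=> a ai; rewrite /r (negPf ai).
- by move=> a ai; rewrite /s (negPf ai).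
rewrite /r /s eqxx !det_map_mx det_tr det_map_mx /= => H.
have -> : \det B' * D ^+ 2 = D * \det B' * D by ring.
by rewrite -H -!mul_polyC !rmorphM rmorphN /=; ring.
Qed.

Let W z : 'M[C]_n := diag_mx (\row_a (s a).[z]).

Let evB' z : `|z| = 1 -> evm z B1 = W z *m evm z B' *m (map_mx Num.conj (W z))^T.
Proof.
move=> z1; have z0 := circle_neq0 z1.
have -> : (map_mx Num.conj (W z))^T = diag_mx (\row_a ((s a).[z])^*).
  rewrite /W map_diag_mx tr_diag_mx; congr diag_mx.
  by apply/rowP => a; rewrite !mxE.
apply/matrixP => a b; rewrite diag_mul_mx_diagE (evm_coef _ B1) (evm_coef _ B').
rewrite [X in X * _ * _]mxE [X in _ * X]mxE.
have rb0 : (r b).[z] != 0.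
  rewrite /r; case: ifP => _; rewrite ?hornerC ?oner_eq0 //.
  by rewrite hornerZ hornerX mulf_neq0 // oppr_eq0.
have rs : (r b).[z] * ((s b).[z])^* = (s b).[z].
  rewrite /r /s; case: ifP => _; last by rewrite !hornerC rmorph1 mulr1.
  rewrite hornerZ hornerX hornerXsubC rmorphB /= (circle_conj z1) (circle_conj t1).
  by field; rewrite t0 z0.
apply: (mulIf rb0).
by rewrite -hornerM B'E !hornerM -[X in _ * X = _]rs; ring.
Qed.

Let qformB1 z y : `|z| = 1 -> qform (evm z B1) y = qform (evm z B') (y *m W z).
Proof. by move=> z1; rewrite evB' // qform_congr. Qed.

Let psdB' : psd_circle B' d.
Proof.
move=> z z1 y.
have gen u : `|u| = 1 -> u != t -> 0 <= u ^- d * qform (evm u B') y.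
  move=> u1 ut.
  have su a : (s a).[u] != 0.
    rewrite /s; case: ifP => _; rewrite ?hornerC ?oner_eq0 //.
    by rewrite hornerXsubC subr_eq0.
  have := psdB1 u1 (\row_a (y 0 a / (s a).[u])); rewrite qformB1 //.
  suff -> : \row_a (y 0 a / (s a).[u]) *m W u = y by [].
  by apply/rowP => a; rewrite mul_mx_diag !mxE divfK.
(* At z = t the matrix [W] is singular, and positivity comes by continuity from the other points of
   the circle. *)
have [zt|] := eqVneq z t; last exact: gen.
rewrite {z z1}zt.
pose f := \sum_j \sum_k (y 0 j)%:P * B' j k * ((y 0 k)^*)%:P.
have fE u : qform (evm u B') y = f.[u].
  rewrite /f /qform horner_sum; apply: eq_bigr => j _.
  rewrite horner_sum; apply: eq_bigr => k _.
  by rewrite !hornerM !hornerC evm_coef.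
rewrite fE; apply: circle_ge0_closed => // u u1 ut; rewrite -fE; exact: gen.
Qed.

Let Psi (x : 'cV[{poly C}]_n) : 'cV[{poly C}]_n :=
  \col_a if a == i then (polyC_mx G *m x) a 0 %/ D else (polyC_mx G *m x) a 0.

Let PsiE x a : Psi x a 0 = if a == i then (polyC_mx G *m x) a 0 %/ D else (polyC_mx G *m x) a 0.
Proof. by rewrite [LHS]mxE. Qed.

Let GxD (a : C) (u v : 'cV[{poly C}]_n) b : (polyC_mx G *m (a%:P *: u + v)) b 0 =
  a%:P * (polyC_mx G *m u) b 0 + (polyC_mx G *m v) b 0.
Proof. by rewrite mulmxDr -scalemxAr [LHS]mxE [X in X + _]mxE. Qed.

Let Lf (x : 'cV[{poly C}]_n) : C := ((polyC_mx G *m x) i 0).[t].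

(** One pair of roots costs the single condition that entry i of G x vanish at t. Then G x is the
    diagonal matrix of the [s a] times F x, and domination of F x by B2 carries over to x. The new
    factor X of the determinant has no root on the circle. *)
Lemma divide_root : exists (B2 : 'M[{poly C}]_n) (c : C)
    (F : 'cV[{poly C}]_n -> 'cV[{poly C}]_n) (L : 'cV[{poly C}]_n -> C),
  [/\ psd_circle B2 d, c != 0 & \det B2 * D ^+ 2 = c *: ('X * \det B)] /\
  [/\ forall (a : C) u v, F (a%:P *: u + v) = a%:P *: F u + F v,
      forall (a : C) u v, L (a%:P *: u + v) = a * L u + L v &
      forall x, L x = 0 -> dominated B2 d (F x) -> dominated B d x].
Proof.
exists B', (\det G * (\det G)^* * - t), Psi, Lf; split; split => //.
- have G0 : \det G != 0 by rewrite -unitfE -unitmxE.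
  by rewrite !mulf_neq0 // ?conjC_eq0 // oppr_eq0.
- move=> a u v; apply/colP => b; rewrite PsiE GxD [RHS]mxE [X in _ = X + _]mxE !PsiE.
  by case: ifP => _ //; rewrite divpD mul_polyC divpZl -mul_polyC.
- by move=> a u v; rewrite /Lf GxD hornerD hornerM hornerC.
move=> x Lx [K K0 hK]; exists K => // z z1 y.
pose y' := y *m invmx G.
have yE : y = y' *m G by rewrite /y' mulmxKV.
have Gx : polyC_mx G *m x = diag_mx (\row_a s a) *m Psi x.
  apply/colP => a; rewrite mul_diag_mx [RHS]mxE [X in _ = X * _]mxE PsiE /s; case: ifP => [/eqP->|_].
    exact: divD.
  by rewrite mul1r.
have -> : y *m evm z x = (y' *m W z) *m evm z (Psi x).
  rewrite {1}yE -!mulmxA -[G](evm_polyC_mx z) -!evmM Gx; congr (_ *m _).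
  rewrite evmM; congr (_ *m _).
  have sE : map_mx (horner_eval z) (\row_a s a) = \row_a (s a).[z].
    by apply/rowP => a; rewrite !mxE.
  by rewrite /W /evm map_diag_mx sE.
have -> : qform (evm z B) y = qform (evm z B') (y' *m W z).
  by rewrite -qformB1 // evB1 qform_congr -yE.
exact: hK.
Qed.

End DivideRoot.

Lemma torus_root_conditions (B : 'M[{poly C}]_n) d (ts : seq C) (h : {poly C}) :
  psd_circle B d -> \det B = \prod_(t <- ts) ('X - t%:P) * h ->
  {in ts, forall t, `|t| = 1} -> (forall z, `|z| = 1 -> h.[z] != 0) ->
  exists (m : nat) (L : 'I_m -> 'cV[{poly C}]_n -> C),
    [/\ (2 * m = size ts)%N,
        forall i (a : C) u v, L i (a%:P *: u + v) = a * L i u + L i v &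
        forall x, (forall i, L i x = 0) -> dominated B d x].
Proof.
have [k] := ubnP (size ts); elim: k B ts h => // k IH B ts h szk psd detB ts1 h0.
case: ts => [|t ts] in szk detB ts1 *.
  exists 0%N, (fun _ _ => 0); split => // [[]|x _] //.
  apply: dominated_nonsingular => // z z1.
  by rewrite detB big_nil mul1r h0.
have t1 : `|t| = 1 by apply: ts1; rewrite mem_head.
have dett : (\det B).[t] = 0.
  by rewrite detB big_cons !hornerM hornerXsubC subrr !mul0r.
have [i [G [Gu Gi]]] := congruent_root dett.
have [B2 [c [F [L [[psd2 c0 det2] [Flin Llin FL]]]]]] := divide_root psd t1 Gu Gi.
have D0 : 'X - t%:P != 0 by rewrite polyXsubC_eq0.
have det3 : \det B2 * ('X - t%:P) = \prod_(u <- ts) ('X - u%:P) * (c *: ('X * h)).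
  apply: (mulIf D0); rewrite -mulrA -expr2 det2 detB big_cons -!mul_polyC; ring.
(* X - t divides the remaining product while c X h does not vanish at t, so t occurs a second time
   in the list. This is where the roots pair up. *)
have t_in : t \in ts.
  have : root (\prod_(u <- ts) ('X - u%:P) * (c *: ('X * h))) t.
    by rewrite -det3 rootM root_XsubC eqxx orbT.
  rewrite rootM root_prod_XsubC => /orP[//|].
  rewrite rootE hornerZ hornerM hornerX !mulf_eq0 (negPf c0) (negPf (circle_neq0 t1)).
  by rewrite (negPf (h0 _ t1)).
have det4 : \det B2 = \prod_(u <- rem t ts) ('X - u%:P) * (c *: ('X * h)).
  apply: (mulIf D0); rewrite det3 (big_rem t) //=; ring.
have h20 z : `|z| = 1 -> (c *: ('X * h)).[z] != 0.
  by move=> z1; rewrite hornerZ hornerM hornerX !mulf_neq0 ?h0 // circle_neq0.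
have szr : size ts = (size (rem t ts)).+1.
  by rewrite size_rem // prednK //; case: (ts) t_in.
have [||m [L2 [m2 L2lin L2d]]] := IH B2 (rem t ts) _ _ psd2 det4 _ h20.
- by move: szk szr => /=; clear; move: (size ts) (size (rem t ts)) => a b; lia.
- by move=> u /mem_rem ut; apply: ts1; rewrite inE ut orbT.
pose LL (j : 'I_m.+1) x := if unlift ord0 j is Some j' then L2 j' (F x) else L x.
exists m.+1, LL; split.
- by rewrite /= szr -m2; lia.
- by move=> j a u v; rewrite /LL; case: unliftP => [j' _|_]; rewrite ?Flin ?L2lin ?Llin.
move=> x Lx; apply: FL; first by have := Lx ord0; rewrite /LL unlift_none.
by apply: L2d => j; have := Lx (fintype.lift ord0 j); rewrite /LL liftK.
Qed.

End CircleMatrices.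

(** * Square-integrable quotients *)

Section PolyCol.
Variables (F : fieldType) (n d : nat).
Implicit Types u v : 'rV[F]_(n * d).

Definition poly_col v : 'cV[{poly F}]_n := \col_j rVpoly (row j (vec_mx v)).

Lemma poly_col_linear (k : F) u v : poly_col (k *: u + v) = k%:P *: poly_col u + poly_col v.
Proof. by apply/colP => j; rewrite !mxE !linearD /= !linearZ /= mul_polyC. Qed.

Lemma size_poly_col v j : (size (poly_col v j 0%R) <= d)%N.
Proof. by rewrite mxE size_poly. Qed.

Lemma poly_col_eq0 v : poly_col v = 0 -> v = 0.
Proof.
move=> v0; rewrite -[v]vec_mxK; suff -> : vec_mx v = 0 by rewrite linear0.
apply/row_matrixP => j; rewrite row0 -[row _ _]rVpolyK.
by move/colP/(_ j): v0; rewrite !mxE => ->; rewrite linear0.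
Qed.

End PolyCol.

Lemma common_zero_conditions (F : fieldType) n1 n2 m
    (L : 'I_m -> 'cV[{poly F}]_n1 -> F) :
  (forall i (a : F) u v, L i (a%:P *: u + v) = a * L i u + L i v) ->
  (m < n1 * n2)%N ->
  exists x : 'cV[{poly F}]_n1,
    [/\ x != 0, forall j, (size (x j ord0) <= n2)%N & forall i, L i x = 0].
Proof.
move=> Llin mn.
pose X (c : 'rV[F]_(n1 * n2)) := poly_col c.
have L0 i : L i 0 = 0.
  have := Llin i 1 0 0; rewrite scaler0 addr0 mul1r => /esym/eqP.
  by rewrite -subr_eq0 addrK => /eqP.
have X0 : X 0 = 0.
  by have := poly_col_linear (-1) (0 : 'rV[F]_(n1 * n2)) 0; rewrite scaler0 addr0 polyCN scaleN1r addNr.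
pose A : 'M[F]_(n1 * n2, m) := \matrix_(k, i) L i (X (delta_mx 0 k)).
have LA c i : L i (X c) = (c *m A) 0 i.
  rewrite mxE [in LHS](row_sum_delta c).
  have sumL (s : seq 'I_(n1 * n2)) : L i (X (\sum_(j <- s) c 0 j *: delta_mx 0 j)) =
      \sum_(j <- s) c 0 j * A j i.
    elim: s => [|k s IH]; first by rewrite !big_nil X0 L0.
    by rewrite !big_cons /X poly_col_linear Llin -/(X _) IH mxE.
  exact: sumL.
have : kermx A != 0.
  rewrite kermx_eq0 /row_free; apply: contraTneq mn => <-.
  by rewrite -leqNgt rank_leq_col.
move/rowV0Pn => [c /sub_kermxP cA c0].
exists (X c); split.
- by apply: contraNneq c0 => /poly_col_eq0 ->.
- exact: size_poly_col.
by move=> i; rewrite LA cA mxE.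
Qed.

Definition poly_of_col (A : nzRingType) n (x : 'cV[A]_n) : {poly A} :=
  \sum_(j < n) (x j 0)%:P * 'X^j.

Lemma coef_poly_of_col (A : nzRingType) n (x : 'cV[A]_n) (j : 'I_n) : (poly_of_col x)`_j = x j 0.
Proof.
rewrite /poly_of_col coef_sum (bigD1 j) //= coefCM coefXn eqxx mulr1 big1 ?addr0 //.
move=> k kj; rewrite coefCM coefXn (_ : (j == k :> nat) = false) ?mulr0 //.
by apply/negbTE; rewrite eq_sym.
Qed.

Lemma size_poly_of_col (A : nzRingType) n (x : 'cV[A]_n) : (size (poly_of_col x) <= n)%N.
Proof.
apply: (leq_trans (size_sum _ _ _)); apply/bigmax_leqP => j _.
rewrite mul_polyC; apply: leq_trans (size_scale_leq _ _) _.
by rewrite size_polyXn.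
Qed.

Section Existence.
Variable R : realType.
Local Notation C := R[i].
Implicit Types (p v : {bipoly R}).

Section FixedP.
Variables (p : {bipoly R}) (n1 n2 : nat).
Let q := reflection (n1, n2) p.
Hypotheses (sp1 : (size p <= n1.+1)%N) (sp2 : (sizeY p <= n2.+1)%N).
Hypothesis pstab : forall z : C, `|z| = 1 -> stable1 (slice z p).

Let B := bezoutian n1 p q.

Lemma slice_reflection (z : C) : `|z| = 1 -> slice z q = z ^+ n2 *: crev n1 (slice z p).
Proof.
move=> z1; have z0 := circle_neq0 z1.
apply/polyP => i; rewrite coef_slice coefZ [X in _ = _ * X]coef_poly.
rewrite [X in X.[z]]coef_poly /=; case: ifP => [in1|_]; last first.
  by rewrite horner0 mulr0.
rewrite coef_slice (horner_coef_wide (n := n2.+1)) ?size_poly //.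
rewrite (horner_coef_wide (n := n2.+1)); last exact: leq_trans (max_size_coefXY _ _) _.
rewrite rmorph_sum mulr_sumr [RHS](reindex_inj rev_ord_inj); apply: eq_bigr => j _ /=.
rewrite coef_poly ltn_ord subSS rmorphM rmorphXn /= (circle_conj z1).
have jn : (j <= n2)%N by rewrite -ltnS.
have zE : z ^+ n2 = z ^+ j * z ^+ (n2 - j) by rewrite -exprD subnKC.
rewrite mulrCA; congr (_ * _).
by rewrite exprVn zE -mulrA mulfV ?mulr1 // expf_neq0.
Qed.

Lemma evm_bezoutian (z : C) : `|z| = 1 ->
  evm z B = z ^+ n2 *: bezoutian n1 (slice z p) (crev n1 (slice z p)).
Proof.
by move=> z1; rewrite /evm map_bezoutian -/(slice z p) -/(slice z q) slice_reflection // bezoutian_scaler.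
Qed.

Lemma bezoutian_qform_circle (z : C) y : `|z| = 1 ->
  z ^- n2 * qform (evm z B) y = qform (bezoutian n1 (slice z p) (crev n1 (slice z p))) y.
Proof.
move=> z1; rewrite evm_bezoutian // qformZ mulrA mulVf ?mul1r //.
by rewrite expf_neq0 // circle_neq0.
Qed.

Lemma bezoutian_psd_circle : psd_circle B n2.
Proof.
move=> z z1 y; rewrite bezoutian_qform_circle //; apply: bezoutian_psd.
  exact: leq_trans (size_slice _ _) _.
exact: pstab.
Qed.

(** The duality of part (i) on one slice |z_2| = 1. For the row vector with entries sum_a d_a X_a^j,
    d_a = conj(h_a)/f(X_a), domination reads s^2 <= K Q, where s is the grid sum of |h|^2. Dropping
    the subtracted term of Q leaves Q <= 2 N s, hence s <= 2 K N. *)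
Lemma dominated_L2 (x : 'cV[{poly C}]_n1) : dominated B n2 x ->
  L2_torus (fun z => eval2 (poly_of_col x) z / eval2 p z).
Proof.
move=> [K K0 dom]; set c := poly_of_col x.
(* The second radius is 1 because domination is known for |z_2| = 1 only; the sample points avoid
   the zeros of p by [pstab]. *)
apply: (@L2_torus_of_grid R c p (grid_radius R) (fun=> 1) _ _ (complex.Re K * 2)) => [m|m|m].
- exact: radius_near1.
- by rewrite subrr normr0 invr_ge0 ler0n.
set N := m.+2; set w : C := unit_circle (N%:R^-1 : R).
have prim_w : N.-primitive_root w by exact: unit_circle_prim.
pose r : C := ((grid_radius R m)%:C)%C.
have [r0 r1] : 0 <= r /\ r < 1 := radius_complex R m.
have nw : `|w| = 1 := norm_prim_root prim_w.
pose X (a : 'I_N) : C := r * w ^+ a.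
have X1 (a : 'I_N) : `|X a| < 1 by rewrite normrM normrX nw expr1n mulr1 ger0_norm.
have N0 : 0 < N%:R :> C by rewrite ltr0n.
have bound (z : C) : `|z| = 1 ->
    \sum_(a < N) `|c.[X a, z] / p.[X a, z]| ^+ 2 <= K * 2%:R * N%:R.
  move=> z1; pose f := slice z p; pose h a := c.[X a, z] / p.[X a, z].
  have fX a : f.[X a] != 0 by apply: pstab.
  have sf : (size f <= n1.+1)%N by exact: leq_trans (size_slice _ _) _.
  pose d a := (h a)^* / f.[X a].
  pose s := \sum_(a < N) `|h a| ^+ 2; rewrite -/s.
  have s0 : 0 <= s by apply: sumr_ge0 => a _; rewrite exprn_ge0.
  have := dom z z1 (\row_(j < n1) \sum_a d a * X a ^+ j).
  rewrite bezoutian_qform_circle // bezoutian_qform_eval // -/f.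
  have -> : ((\row_(j < n1) \sum_a d a * X a ^+ j) *m evm z x) 0 0 = s.
    rewrite mxE; under eq_bigr => j _ do rewrite mxE mulr_suml.
    rewrite exchange_big; apply: eq_bigr => a _ /=.
    transitivity (d a * c.[X a, z]); last first.
      by rewrite /d /f horner_slice mulrAC -mulrA -/(h a) mulrC -normCK.
    rewrite /c /poly_of_col !horner_sum mulr_sumr; apply: eq_bigr => j _.
    by rewrite !(hornerM, hornerC, hornerXn) -polyC_exp hornerC evm_coef; ring.
  rewrite (ger0_norm s0).
  set Q := (X in K * X) => Hs.
  have QE : Q = szego1 w r (fun a => d a * f.[X a]) -
      szego1 w r (fun a => d a * (crev n1 f).[X a]).
    rewrite /Q /szego1 -sumrB; apply: eq_bigr => a _; rewrite -sumrB; apply: eq_bigr => b _.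
    by rewrite !rmorphM /= -/(X a) -/(X b); ring.
  have Qle : Q <= 2%:R * (N%:R * s).
    rewrite QE; apply: (@le_trans _ _ (szego1 w r (fun a => d a * f.[X a]))).
      by rewrite gerBl szego1_ge0.
    apply: (le_trans (szego1_le prim_w r0 r1 _)).
    have -> : \sum_a `|d a * f.[X a]| ^+ 2 = s.
      by apply: eq_bigr => a _; rewrite /d divfK // norm_conjC.
    by rewrite ler_wpM2r ?mulr_ge0 ?(ltW N0) // radius_factor_complex.
  have := le_trans Hs (ler_wpM2l K0 Qle).
  have [->|sn0] := eqVneq s 0; first by rewrite !mulr_ge0 ?ler0n.
  have {}sn0 : 0 < s by rewrite lt_def sn0.
  by rewrite expr2 !mulrA ler_pM2r.
have KE : K = ((complex.Re K)%:C)%C by rewrite RRe_real // realE K0.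
rewrite -lecR rmorphM rmorphXn rmorphM /= !(rmorph_nat (real_complex R)) -KE.
rewrite exchange_big !rmorph_sum /=.
have -> : K * 2%:R * N%:R ^+ 2 = \sum_(b < N) K * 2%:R * N%:R.
  by rewrite sumr_const card_ord -[RHS]mulr_natr expr2 mulrA.
apply: ler_sum => b _; rewrite rmorph_sum /=.
have wb : `|w ^+ b| = 1 by rewrite normrX nw expr1n.
apply: le_trans (bound _ wb); rewrite le_eqVlt; apply/orP; left; apply/eqP.
apply: eq_bigr => a _; rewrite quot_sqrE /eval2 /grid_point /= !unit_circle_nat.
by rewrite rmorph1 mul1r.
Qed.

Lemma exists_L2_quotient (ts : seq C) (h : {poly C}) :
  \det B = \prod_(t <- ts) ('X - t%:P) * h ->
  {in ts, forall t, `|t| = 1} -> (forall z, `|z| = 1 -> h.[z] != 0) ->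
  (size ts < 2 * n1 * n2)%N ->
  exists c : {bipoly R}, [/\ c != 0, (size c <= n1)%N, (sizeY c <= n2)%N &
    L2_torus (fun z => eval2 c z / eval2 p z)].
Proof.
move=> detB ts1 h0 sz.
have [m [L [m2 Llin Ldom]]] := torus_root_conditions bezoutian_psd_circle detB ts1 h0.
have mn : (m < n1 * n2)%N by move: sz; rewrite -m2 -mulnA ltn_pmul2l.
have [x [x0 xs Lx]] := common_zero_conditions Llin mn.
exists (poly_of_col x); split; last by apply: dominated_L2; apply: Ldom.
- apply: contraNneq x0 => c0; apply/eqP/colP => j.
  by rewrite -coef_poly_of_col c0 coef0 mxE.
- exact: size_poly_of_col.
- apply/bigmax_leqP => i _; have il : (i < n1)%N := leq_trans (ltn_ord i) (size_poly_of_col x).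
  by rewrite (coef_poly_of_col x (Ordinal il)).
Qed.

End FixedP.
End Existence.

(** * Passing to a numerator equal to its reflection *)

Section Symmetrize.
Variable R : realType.
Local Notation C := R[i].
Local Notation normc := ComplexField.Normc.normc.
Implicit Types (p u v : {bipoly R}).

Lemma L2_torus_le (u v p : {bipoly R}) (K : R) :
  (forall z, torus z -> normc (eval2 v z) <= K * normc (eval2 u z)) ->
  L2_torus (fun z => eval2 u z / eval2 p z) ->
  L2_torus (fun z => eval2 v z / eval2 p z).
Proof.
move=> vu [mRe mIm fin].
have [mRe' mIm'] := cmeasM (eval2_meas v) (cmeasV (eval2_meas p)).
split; [exact: measurable_funTS|exact: measurable_funTS|].
have meas w := @quot_sqr_meas R w p (@unit_square R).
have nn (z : C) : 0 <= normc z by case: z => a b; exact: sqrtr_ge0.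
apply: (@le_lt_trans _ _ (\int[(lebesgue_measure \x lebesgue_measure)%E]_(t in @unit_square R)
   ((K ^+ 2)%:E * (quot_sqr u p (torus_param t))%:E))%E).
  apply: ge0_le_integral => //.
  - exact: unit_square_meas.
  - by move=> t _; rewrite lee_fin quot_sqr_ge0.
  - exact: meas.
  - by apply: measurable_funeM; exact: meas.
  move=> t _; rewrite -EFinM lee_fin /quot_sqr -exprMn /=.
  have tt : torus (torus_param t) by split; rewrite /= normr_unit_circle.
  have := vu _ tt; rewrite !ComplexField.Normc.normcM !ComplexField.Normc.normcV => h.
  have h2 : normc (eval2 v (torus_param t)) / normc (eval2 p (torus_param t)) <=
     K * (normc (eval2 u (torus_param t)) / normc (eval2 p (torus_param t))).
    by rewrite mulrA ler_wpM2r // invr_ge0.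
  have q0 : 0 <= normc (eval2 v (torus_param t)) / normc (eval2 p (torus_param t)).
    by rewrite divr_ge0.
  by rewrite lerXn2r ?nnegrE // (le_trans q0).
have u0 t : unit_square t -> (0 <= (quot_sqr u p (torus_param t))%:E)%E.
  by move=> _; rewrite lee_fin quot_sqr_ge0.
have K20 : (0 <= (K ^+ 2)%:E)%E by rewrite lee_fin sqr_ge0.
rewrite (ge0_integralZl _ (@unit_square_meas R) (meas u) u0 K20).
by rewrite lte_mul_pinfty.
Qed.

Variables (n1 n2 : nat).
Let n := (n1, n2).

Lemma reflectionD u v : reflection n (u + v) = reflection n u + reflection n v.
Proof.
apply/polyP => i; apply/polyP => j; rewrite !coefD !coef_poly.
case: ifP => _; last by rewrite !coef0 addr0.
by rewrite !coef_poly; case: ifP => _; rewrite ?addr0 // coefD coefD rmorphD.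
Qed.

Lemma reflectionZ (a : C) u : reflection n (a%:P%:P * u) = (conjc a)%:P%:P * reflection n u.
Proof.
apply/polyP => i; apply/polyP => j; rewrite !coefCM !coef_poly.
case: ifP => _; last by rewrite coef0 mulr0.
by rewrite !coef_poly; case: ifP => _; rewrite ?mulr0 // !coefCM rmorphM.
Qed.

Lemma reflectionK u : (size u <= n1.+1)%N -> (sizeY u <= n2.+1)%N ->
  reflection n (reflection n u) = u.
Proof.
move=> s1 s2; apply/polyP => i; apply/polyP => j; rewrite coef_poly.
case: ltnP => [in1|ni]; last first.
  by rewrite (@nth_default _ 0 u) // (leq_trans s1).
rewrite coef_poly; case: ltnP => [jn|nj]; last first.
  by rewrite nth_default // (leq_trans (max_size_coefXY _ _)) // (leq_trans s2).
rewrite coef_reflection ?leq_subr //= conjcK.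
by rewrite !subKn.
Qed.

Lemma norm_reflection_torus u z : (size u <= n1.+1)%N -> (sizeY u <= n2.+1)%N ->
  torus z -> `|eval2 (reflection n u) z| = `|eval2 u z|.
Proof.
move=> s1 s2 [z1 z2].
have un : bidegree_le (bidegree u) n by rewrite /bidegree_le /bidegree /= -!subn1 !leq_subLR !add1n s1 s2.
rewrite eval2_reflection ?circle_neq0 //= !normrM normcJ !normrX z1 z2 !expr1n !mul1r.
by rewrite -[conjc z.1]/(z.1^*) -[conjc z.2]/(z.2^*) !circle_conj // !invrK; case: z {z1 z2}.
Qed.

(** Multiplying c by z_1 kills the constant coefficient, and the coefficient at (n1, n2) is 0
    because c has degree below n2 in z_2; hence z_1 c plus its reflection vanishes at the origin.
    Should this sum be 0, then i z_1 c is its own reflection and its double is taken. Reflection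
    preserves the modulus on the torus, so square integrability survives. *)
Lemma symmetrize p (c : {bipoly R}) : c != 0 -> (size c <= n1)%N -> (sizeY c <= n2)%N ->
  L2_torus (fun z => eval2 c z / eval2 p z) ->
  exists v, [/\ v != 0, L2_torus (fun z => eval2 v z / eval2 p z),
    bidegree_le (bidegree v) n, v = reflection n v & eval2 v (0, 0) = 0].
Proof.
move=> c0 sc1 sc2 L2c.
have main u : (size u <= n1.+1)%N -> (sizeY u <= n2.+1)%N ->
    (forall z, torus z -> `|eval2 u z| = `|eval2 c z|) ->
    u`_0`_0 = 0 -> u`_n1`_n2 = 0 ->
    u + reflection n u != 0 -> exists v, [/\ v != 0, L2_torus (fun z => eval2 v z / eval2 p z),
    bidegree_le (bidegree v) n, v = reflection n v & eval2 v (0, 0) = 0].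
  move=> su1 su2 uc u00 unn v0; exists (u + reflection n u).
  have [sr1 sr2] := reflection_size n u.
  split => //.
  - apply: (@L2_torus_le c _ p 2) => // z tz.
    rewrite -lecR rmorphM /= -!normr_normc (rmorph_nat (real_complex R)) /eval2 !hornerD.
    rewrite (le_trans (ler_normD _ _)) // -/(eval2 _ z) norm_reflection_torus //.
    by rewrite !uc // mulr2n mulrDl mul1r.
  - rewrite /bidegree_le /bidegree /=; apply/andP; split.
      have : (size (u + reflection n u)%R <= n1.+1)%N.
        by apply: leq_trans (size_polyD _ _) _; rewrite geq_max su1.
      by rewrite -subn1 leq_subLR add1n.
    have : (sizeY (u + reflection n u) <= n2.+1)%N.
      rewrite sizeYE rmorphD; apply: leq_trans (size_polyD _ _) _.
      by rewrite geq_max -!sizeYE su2.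
    by rewrite -subn1 leq_subLR add1n.
  - by rewrite reflectionD reflectionK // addrC.
  rewrite eval2_00 !coefD u00 coef_reflection //= !subn0 unn.
  by rewrite rmorph0 addr0.
pose g := c * 'X.
have sg1 : (size g <= n1.+1)%N by rewrite size_mulX.
have sg2 : (sizeY g <= n2.+1)%N by rewrite sizeY_mulX leqW.
have gc z : torus z -> `|eval2 g z| = `|eval2 c z|.
  by move=> [z1 _]; rewrite /eval2 /g hornerM hornerX hornerM hornerC normrM z1 mulr1.
have g00 : g`_0`_0 = 0 by rewrite coefMX /= coef0.
have gnn : g`_n1`_n2 = 0.
  rewrite coefMX; case: ifP => _; first by rewrite coef0.
  by rewrite nth_default // (leq_trans (max_size_coefXY _ _)).
have [gr|gr] := eqVneq (g + reflection n g) 0; last exact: (main g).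
pose ig := ('i%C : C)%:P%:P * g.
have i0 : ('i%C : C)%:P%:P != 0 by rewrite !polyC_eq0 complexiE neq0Ci.
apply: (main ig).
- by rewrite /ig mul_polyC; apply: leq_trans (size_scale_leq _ _) _.
- rewrite sizeYE rmorphM /= swapXY_polyC map_polyC /= mul_polyC.
  by apply: leq_trans (size_scale_leq _ _) _; rewrite -sizeYE.
- move=> z tz; have -> : eval2 ig z = 'i%C * eval2 g z.
    by rewrite /eval2 [ig.[_]]hornerM hornerM !hornerC.
  by rewrite normrM gc // complexiE normCi mul1r.
- by rewrite !coefCM g00 mulr0.
- by rewrite !coefCM gnn mulr0.
rewrite /ig reflectionZ.
have -> : reflection n g = - g by apply/eqP; rewrite -addr_eq0 addrC gr.
have -> : conjc ('i%C : C) = - 'i%C by apply/eqP; rewrite eq_complex /= oppr0 !eqxx.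
rewrite !polyCN mulrNN -mulrDl mulf_neq0 //; last by rewrite /g mulf_neq0 // polyX_eq0.
rewrite -!polyCD !polyC_eq0 -mulr2n -mulr_natl mulf_neq0 ?pnatr_eq0 //.
by rewrite complexiE neq0Ci.
Qed.

End Symmetrize.

(** * Common zeros and multiplicities *)

Section CommonFactor.
Variable C : numClosedFieldType.
Implicit Types (p q g d : {poly {poly C}}) (c : {poly C}) (z : C).

Lemma slice_eq0_factor z p : slice z p = 0 -> exists p', p = ('X - z%:P) *: p'.
Proof.
move=> p0; exists (map_poly (fun c => c %/ ('X - z%:P)) p).
apply/polyP => i; rewrite coefZ coef_map_id0 ?div0p // mulrC divpK //.
by rewrite dvdp_XsubCl rootE -coef_slice p0 coef0.
Qed.

Lemma sliceM z p q : slice z (p * q) = slice z p * slice z q.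
Proof. exact: rmorphM. Qed.

Lemma sliceZ z c p : slice z (c *: p) = c.[z] *: slice z p.
Proof. by apply/polyP => i; rewrite !(coef_slice, coefZ) hornerM. Qed.

(* Gauss' lemma: a root of the content c is cancelled against either g or both
   cofactors. *)
Lemma common_factor_clear c p q g a b : c != 0 -> (1 < size g)%N ->
  c *: p = a * g -> c *: q = b * g ->
  exists d a' b', [/\ (1 < size d)%N, p = a' * d & q = b' * d].
Proof.
have [n] := ubnP (size c); elim: n c g a b => // n IH c g a b szc c0 g1 pE qE.
have [sc1|sc1] := leqP (size c) 1.
  have /size_poly1P [k k0 cE] : size c == 1 by rewrite eqn_leq sc1 lt0n size_poly_eq0.
  have inv u v : c *: u = v * g -> u = (k^-1%:P *: v) * g.
    by move=> uE; rewrite -scalerAl -uE cE scalerA -polyCM mulVf // scale1r.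
  by exists g, (k^-1%:P *: a), (k^-1%:P *: b); split => //; exact: inv.
have [z] : exists z, root c z.
  by apply/closed_rootP; rewrite neq_ltn sc1 orbT.
move=> /factor_theorem [c' cE].
have c'0 : c' != 0 by apply: contraNneq c0 => c'0; rewrite cE c'0 mul0r.
have X0 : 'X - z%:P != 0 :> {poly C} by rewrite polyXsubC_eq0.
have sc' : (size c' < n)%N.
  by move: szc; rewrite cE size_Mmonic ?monicXsubC // size_XsubC addn2.
have cancelX (u v : {poly {poly C}}) : ('X - z%:P) *: u = ('X - z%:P) *: v -> u = v.
  by rewrite -!mul_polyC; apply: mulfI; rewrite polyC_eq0.
have [/slice_eq0_factor [g' gE]|g0] := eqVneq (slice z g) 0.
  apply: (IH c' g' a b) => //.
  - by rewrite gE size_scale in g1.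
  - by apply: cancelX; rewrite scalerA mulrC -cE pE gE scalerAr.
  by apply: cancelX; rewrite scalerA mulrC -cE qE gE scalerAr.
have fac u v : c *: u = v * g -> exists v', v = ('X - z%:P) *: v'.
  move=> uE; apply: slice_eq0_factor; apply/eqP.
  have := congr1 (slice z) uE; rewrite sliceZ sliceM cE hornerM hornerXsubC subrr mulr0 scale0r.
  by move/esym/eqP; rewrite mulf_eq0 (negbTE g0) orbF.
have [a' aE] := fac _ _ pE; have [b' bE] := fac _ _ qE.
apply: (IH c' g a' b') => //.
- by apply: cancelX; rewrite scalerA mulrC -cE pE aE scalerAl.
by apply: cancelX; rewrite scalerA mulrC -cE qE bE scalerAl.
Qed.

(** A pseudo-gcd of positive degree in z_1 would give a genuine common factor by
    [common_factor_clear]. So p and q are coprime over the fraction field in z_2, and Bezout's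
    identity cleared of denominators leaves a nonzero polynomial in z_2 alone. *)
Lemma coprime_ideal_constant p q :
  (forall d a b, p = a * d -> q = b * d -> (size d <= 1)%N) ->
  p != 0 -> exists c u v, c != 0 /\ u * p + v * q = c%:P.
Proof.
move=> cop p0.
have [s1|s1] := leqP (size (gcdp p q)) 1.
  have /Pdiv.Idomain.Bezout_coprimepP [[u v] /= /eqpP [[c1 c2]] /= /andP[c10 c20] e] : coprimep p q.
    by rewrite coprimep_def eqn_leq s1 lt0n size_poly_eq0 gcdp_eq0 (negbTE p0).
  exists c2, (c1 *: u), (c1 *: v); split => //.
  by rewrite -!scalerAl -scalerDr e alg_polyC.
have /Pdiv.Idomain.dvdpP [[c1 a] /= c10 pE] := dvdp_gcdl p q.
have /Pdiv.Idomain.dvdpP [[c2 b] /= c20 qE] := dvdp_gcdr p q.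
have [||||d [a' [b' [sd pE' qE']]]] := @common_factor_clear (c1 * c2) p q (gcdp p q) (c2 *: a) (c1 *: b).
- exact: mulf_neq0.
- exact: s1.
- by rewrite mulrC -scalerA pE scalerAl.
- by rewrite -scalerA qE scalerAl.
by have := cop _ _ _ pE' qE'; rewrite leqNgt sd.
Qed.

Lemma coprimep_closed (f g : {poly C}) : (forall z, f.[z] = 0 -> g.[z] = 0 -> False) -> coprimep f g.
Proof.
move=> h; rewrite coprimep_def; apply/negPn/negP => /closed_rootP [z].
by rewrite root_gcd => /andP[/eqP f0 /eqP g0]; exact: (h z).
Qed.

Lemma exists_nonroot (c : {poly C}) : c != 0 -> exists z, c.[z] != 0.
Proof.
move=> c0; apply: contrapT => h.
have : c = 0.
  apply: (@roots_geq_poly_eq0 _ c [seq i%:R | i <- iota 0 (size c)]).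
  - by apply/allP => z _; apply/negPn/negP => z0; apply: h; exists z.
  - by rewrite map_inj_uniq ?iota_uniq // => i j /eqP; rewrite eqr_nat => /eqP.
  by rewrite size_map size_iota.
by move/eqP; rewrite (negbTE c0).
Qed.

(** At a point z where neither c nor the leading coefficient of q vanishes, the identity of
    [coprime_ideal_constant] makes the slices coprime and the Bezoutian at z invertible. *)
Lemma det_bezoutian_neq0 n p q : (size p <= n.+1)%N -> size q = n.+1 -> p != 0 ->
  (forall d a b, p = a * d -> q = b * d -> (size d <= 1)%N) ->
  \det (bezoutian n p q) != 0.
Proof.
move=> sp sq p0 cop; have [c [u [v [c0 cE]]]] := coprime_ideal_constant cop p0.
have q0 : q`_n != 0.
  by have := lead_coef_eq0 q; rewrite lead_coefE sq /= => ->; rewrite -size_poly_eq0 sq.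
have [z] := exists_nonroot (mulf_neq0 c0 q0); rewrite hornerM mulf_eq0 negb_or => /andP[cz qz].
suff : (\det (bezoutian n p q)).[z] != 0 by apply: contraNneq => ->; rewrite horner0.
rewrite -det_evm /evm map_bezoutian -!/(slice _ _) -unitfE -unitmxE; apply: bezoutian_unit.
- exact: leq_trans (size_slice _ _) _.
- apply/eqP; rewrite eqn_leq -{1}sq size_slice /= ltnNge.
  by apply: contra qz => h; rewrite -coef_slice nth_default.
apply: coprimep_closed => x px qx.
have := congr1 (fun f => (slice z f).[x]) cE.
rewrite /slice rmorphD !rmorphM hornerD !hornerM -!/(slice _ _) px qx !mulr0 addr0.
by rewrite /slice map_polyC hornerC => /esym/eqP; rewrite (negbTE cz).
Qed.

End CommonFactor.

Lemma coefM_top (A : nzRingType) (f g : {poly A}) m n :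
  (size f <= m.+1)%N -> (size g <= n.+1)%N -> (f * g)`_(m + n) = f`_m * g`_n.
Proof.
move=> sf sg; rewrite coefM (bigD1 (Ordinal (leq_addr n m : (m < (m + n).+1)%N))) //=.
rewrite addKn big1 ?addr0 // => i im.
have [mi|im'] := ltnP m i.
  by rewrite [f`_i]nth_default ?mul0r // (leq_trans sf).
have {im im'} im : (i < m)%N.
  by rewrite ltn_neqAle im' andbT; apply: contraNneq im => im; apply/eqP/val_inj.
by rewrite [g`__]nth_default ?mulr0 // (leq_trans sg) //; move: im; lia.
Qed.

Lemma size_top_eq0 (A : nzRingType) (f : {poly A}) n :
  (size f <= n.+1)%N -> f`_n = 0 -> (size f <= n)%N.
Proof.
move=> sf fn; apply/leq_sizeP => i; rewrite leq_eqVlt => /orP[/eqP <- //|ni].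
by rewrite nth_default // (leq_trans sf).
Qed.

Section PolyOfCol.
Variables (A : comNzRingType) (n : nat).

Lemma poly_of_col_coef (f : {poly A}) : (size f <= n)%N -> poly_of_col (\col_(j < n) f`_j) = f.
Proof.
move=> sf; apply/polyP => i; have [il|li] := ltnP i n.
  by rewrite (coef_poly_of_col _ (Ordinal il)) mxE.
by rewrite !nth_default // ?(leq_trans sf) // (leq_trans (size_poly_of_col _)).
Qed.

Lemma poly_of_col_linear (a : A) (x y : 'cV[A]_n) :
  poly_of_col (a *: x + y) = a%:P * poly_of_col x + poly_of_col y.
Proof.
rewrite /poly_of_col mulr_sumr -big_split; apply: eq_bigr => j _ /=.
by rewrite !mxE polyCD polyCM mulrDl mulrA.
Qed.

Lemma poly_of_colB (x y : 'cV[A]_n) : poly_of_col (x - y) = poly_of_col x - poly_of_col y.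
Proof. by rewrite -scaleN1r addrC poly_of_col_linear polyCN polyC1 mulN1r addrC. Qed.

Lemma poly_of_col_inj : injective (@poly_of_col A n).
Proof. by move=> x y xy; apply/colP => j; rewrite -!coef_poly_of_col xy. Qed.

Lemma poly_of_col_bezoutian (f g : {poly A}) (c : 'cV[A]_n) :
  (size f <= n.+1)%N -> (size g <= n.+1)%N ->
  poly_of_col (bezoutian n f g *m c) = \sum_(k < n) (c k 0)%:P * bez_col n f g k.
Proof.
move=> sf sg; apply/polyP => i; have [il|li] := ltnP i n; last first.
  rewrite nth_default ?(leq_trans (size_poly_of_col _)) // coef_sum big1 // => k _.
  by rewrite coefCM nth_default ?mulr0 // (leq_trans (bez_col_size _ _ _)).
rewrite (coef_poly_of_col _ (Ordinal il)) mxE coef_sum; apply: eq_bigr => k _.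
by rewrite coefCM mulrC mxE.
Qed.

End PolyOfCol.

Definition in_ideal2 (A : nzRingType) (p q f : A) := exists a b, f = a * p + b * q.

Section Ideal2.
Variables (A : comNzRingType) (p q : A).
Local Notation I := (in_ideal2 p q).

Lemma in_ideal2D f g : I f -> I g -> I (f + g).
Proof. by move=> [a [b ->]] [c [d ->]]; exists (a + c), (b + d); ring. Qed.

Lemma in_ideal2Ml h f : I f -> I (h * f).
Proof. by move=> [a [b ->]]; exists (h * a), (h * b); ring. Qed.

Lemma in_ideal2_0 : I 0. Proof. by exists 0, 0; ring. Qed.

Lemma in_ideal2_sum (J : Type) (r : seq J) (h : J -> A) : (forall j, I (h j)) -> I (\sum_(j <- r) h j).
Proof. by move=> hI; elim/big_ind: _ => //; [exact: in_ideal2_0|exact: in_ideal2D]. Qed.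

End Ideal2.

(** * A basis of the quotient by two polynomials *)

Section QuotientBasis.
Variable F : fieldType.
Variables (p q : {poly {poly F}}) (n d : nat).
Implicit Types (f g a b : {poly {poly F}}).
Let B := bezoutian n p q.
Let I := in_ideal2 p q.
Hypotheses (sp : (size p <= n.+1)%N) (sq : (size q <= n.+1)%N).
Hypothesis q_top : q`_n != 0.
Hypothesis cop : coprimep p`_n q`_n.
Hypothesis sB : forall j k, (size (B j k) <= d.+1)%N.
Let Btop : 'M[F]_n := \matrix_(j, k) (B j k)`_d.
Hypothesis Btop_unit : Btop \in unitmx.

Lemma ideal2_bez_col k : I (bez_col n p q k).
Proof. by exists (drop_poly (n - k) q), (- drop_poly (n - k) p); rewrite /bez_col; ring. Qed.

Lemma ideal2_bezoutian (c : 'cV[{poly F}]_n) : I (poly_of_col (B *m c)).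
Proof.
rewrite poly_of_col_bezoutian //; apply: in_ideal2_sum => k.
by apply: in_ideal2Ml; exact: ideal2_bez_col.
Qed.

(** Bezout coefficients u, v with u p_n + v q_n = 1 allow any top coefficient of degree at least n
    in z_1 to be removed by an element of the ideal. *)
Lemma reduce_outer f : exists2 g : {poly {poly F}}, (size g <= n)%N & I (f - g).
Proof.
have [m] := ubnP (size f); elim: m f => // m IH f sf.
have [sn|sn] := leqP (size f) n.
  by exists f => //; rewrite subrr; exact: in_ideal2_0.
have [k kE] : exists k, size f = (n + k).+1.
  by exists (size f - n.+1)%N; rewrite -addSn subnKC.
have /Bezout_eq1_coprimepP [[u v] /= uv] := cop.
pose h := (f`_(n + k) * u) *: 'X^k * p + (f`_(n + k) * v) *: 'X^k * q.
have top (c : {poly F}) (r : {poly {poly F}}) : (size r <= n.+1)%N ->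
    (size (c *: 'X^k * r)%R <= (n + k).+1)%N /\ (c *: 'X^k * r)`_(n + k) = c * r`_n.
  move=> sr; have sX : (size (c *: 'X^k : {poly {poly F}}) <= k.+1)%N.
    by apply: leq_trans (size_scale_leq _ _) _; rewrite size_polyXn.
  split; last by rewrite addnC coefM_top // coefZ coefXn eqxx mulr1.
  apply: leq_trans (size_polyMleq _ _) _; rewrite -subn1 leq_subLR add1n.
  by rewrite -addSn (leq_trans (leq_add sX sr)) //; lia.
have [sh1 th1] := top (f`_(n + k) * u) p sp; have [sh2 th2] := top (f`_(n + k) * v) q sq.
have [|g sg Ig] := IH (f - h).
  rewrite -ltnS; apply: leq_trans sf; rewrite kE ltnS; apply/leq_sizeP => j.
  rewrite leq_eqVlt => /orP[/eqP <-|kj].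
    by rewrite coefB coefD th1 th2 -!mulrA -mulrDr uv mulr1 subrr.
  rewrite coefB coefD [f`_j]nth_default ?kE // sub0r.
  by rewrite (nth_default _ (leq_trans sh1 kj)) (nth_default _ (leq_trans sh2 kj)) addr0 oppr0.
exists g => //; have -> : f - g = h + (f - h - g) by ring.
apply: in_ideal2D => //; by exists ((f`_(n + k) * u) *: 'X^k), ((f`_(n + k) * v) *: 'X^k).
Qed.

Lemma mulmx_top e (c : 'cV[{poly F}]_n) j : (forall k, (size (c k 0%R) <= e.+1)%N) ->
  ((B *m c) j 0)`_(d + e) = (Btop *m (\col_k (c k 0)`_e)) j 0.
Proof.
move=> sc; rewrite mxE coef_sum mxE; apply: eq_bigr => k _.
by rewrite coefM_top // !mxE.
Qed.

Lemma mulmx_size e (c : 'cV[{poly F}]_n) j : (forall k, (size (c k 0%R) <= e.+1)%N) ->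
  (size ((B *m c) j 0)%R <= (d + e).+1)%N.
Proof.
move=> sc; rewrite mxE; apply: leq_trans (size_sum _ _ _) _; apply/bigmax_leqP => k _.
apply: leq_trans (size_polyMleq _ _) _.
rewrite -subn1 leq_subLR add1n; apply: leq_trans (leq_add (sB j k) (sc k)) _.
by rewrite addSn addnS.
Qed.

(** Euclidean division by the matrix polynomial B, whose leading coefficient [Btop] is
    invertible. *)
Lemma reduce_inner (x : 'cV[{poly F}]_n) :
  exists c r : 'cV[{poly F}]_n, x = B *m c + r /\ forall j, (size (r j 0%R) <= d)%N.
Proof.
have [m] : exists m, forall j, (size (x j 0%R) <= d + m)%N.
  exists (\max_j size (x j 0%R))%N => j; apply: leq_trans (leq_addl _ _).
  exact: (leq_bigmax j).
elim: m x => [|m IH] x sx.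
  by exists 0, x; split => [|j]; [rewrite mulmx0 add0r|have := sx j; rewrite addn0].
pose a : 'cV[F]_n := invmx Btop *m (\col_j (x j 0)`_(d + m)).
pose c : 'cV[{poly F}]_n := \col_j (a j 0 *: 'X^m).
have sc k : (size (c k 0%R) <= m.+1)%N.
  by rewrite mxE; apply: leq_trans (size_scale_leq _ _) _; rewrite size_polyXn.
have [j|c' [r [xE rE]]] := IH (x - B *m c).
  have -> : (x - B *m c) j 0 = x j 0 - (B *m c) j 0 by rewrite !mxE.
  apply/leq_sizeP => i; rewrite leq_eqVlt => /orP[/eqP <-|mi]; rewrite coefB.
    rewrite mulmx_top // (_ : \col_k _ = a); first by rewrite mulKVmx // mxE subrr.
    by apply/colP => k; rewrite !mxE coefZ coefXn eqxx mulr1.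
  rewrite [(x j 0)`_i]nth_default; last by rewrite (leq_trans (sx j)) // addnS.
  by rewrite nth_default ?subr0 // (leq_trans (mulmx_size j sc)).
exists (c' + c), r; split => //.
by rewrite mulmxDr addrAC -xE subrK.
Qed.

Lemma reduce_inner_unique (c : 'cV[{poly F}]_n) :
  (forall j, (size ((B *m c) j 0)%R <= d)%N) -> c = 0.
Proof.
move=> sBc; have [m] : exists m, forall j, (size (c j 0%R) <= m)%N.
  by exists (\max_j size (c j 0%R))%N => j; exact: (leq_bigmax j).
elim: m => [|m IH] sc.
  by apply/colP => j; have := sc j; rewrite leqn0 size_poly_eq0 mxE => /eqP.
apply: IH => j; apply/leq_sizeP => i; rewrite leq_eqVlt => /orP[/eqP <-|mi]; last first.
  by rewrite nth_default // (leq_trans (sc j)).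
have c0 : Btop *m (\col_k (c k 0)`_m) = 0.
  apply/colP => k; rewrite -mulmx_top // [RHS]mxE nth_default //.
  by rewrite (leq_trans (sBc k)) // leq_addr.
have := congr1 (mulmx (invmx Btop)) c0; rewrite mulKmx // mulmx0 => /colP/(_ j).
by rewrite !mxE.
Qed.

(* A syzygy (Q, -P) of the leading coefficients lifts to a Bezoutian column in
   low degree and to the trivial syzygy of p and q in high degree. *)
Lemma ideal2_low_degree f : I f -> (size f <= n)%N -> exists c, f = poly_of_col (B *m c).
Proof.
move=> [a [b fE]] sf.
have [m] : exists m, (size a <= m)%N /\ (size b <= m)%N.
  by exists (maxn (size a) (size b)); rewrite leq_maxl leq_maxr.
elim: m a b f fE sf => [|m IH] a b f fE sf [sa sb].
  exists 0; rewrite mulmx0 fE.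
  move: sa sb; rewrite !leqn0 !size_poly_eq0 => /eqP-> /eqP->.
  rewrite !mul0r addr0; apply/polyP => i; rewrite /poly_of_col coef_sum coef0 big1 // => j _.
  by rewrite mxE mul0r coef0.
have top : a`_m * p`_n + b`_m * q`_n = 0.
  by rewrite -!coefM_top // -coefD -fE nth_default // (leq_trans sf) // leq_addl.
have [g aE bE] : exists2 g, a`_m = g * q`_n & b`_m = - g * p`_n.
  have : q`_n %| a`_m.
    rewrite -(Gauss_dvdpl _ (_ : coprimep q`_n p`_n)); last by rewrite coprimep_sym.
    have -> : a`_m * p`_n = (- b`_m) * q`_n by apply/eqP; rewrite mulNr -addr_eq0 top.
    exact: dvdp_mulIr.
  move/dvdpP => [g aE]; exists g => //; apply: (mulIf q_top).
  by apply/eqP; rewrite -subr_eq0 -[X in _ == X]top aE; apply/eqP; ring.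
have finish a' b' (c : 'cV[{poly F}]_n) :
    (size a' <= m.+1)%N -> (size b' <= m.+1)%N -> a'`_m = 0 -> b'`_m = 0 ->
    f = a' * p + b' * q + poly_of_col (B *m c) -> exists c, f = poly_of_col (B *m c).
  move=> sa' sb' a'm b'm fE'.
  have [|||c' c'E] := IH a' b' (f - poly_of_col (B *m c)).
  - by rewrite fE' addrK.
  - rewrite (leq_trans (size_polyD _ _)) // geq_max sf size_polyN.
    exact: size_poly_of_col.
  - by split; apply: size_top_eq0.
  exists (c' + c); rewrite -(subrK (poly_of_col (B *m c)) f) c'E mulmxDr.
  by have := poly_of_col_linear 1 (B *m c') (B *m c); rewrite scale1r polyC1 mul1r.
have [mn|nm] := ltnP m n.
  pose k := Ordinal mn.
  apply: (finish (a - g *: drop_poly (n - m) q) (b + g *: drop_poly (n - m) p) (g *: delta_mx k 0)).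
  - rewrite (leq_trans (size_polyD _ _)) // geq_max sa size_polyN.
    apply: leq_trans (size_scale_leq _ _) _; by rewrite size_drop_poly leq_subLR addnS subnK ?(ltnW mn).
  - rewrite (leq_trans (size_polyD _ _)) // geq_max sb.
    apply: leq_trans (size_scale_leq _ _) _; by rewrite size_drop_poly leq_subLR addnS subnK ?(ltnW mn).
  - by rewrite coefB coefZ coef_drop_poly subnKC ?(ltnW mn) // aE subrr.
  - by rewrite coefD coefZ coef_drop_poly subnKC ?(ltnW mn) // bE mulNr addNr.
  rewrite poly_of_col_bezoutian // (bigD1 k) //= !mxE !eqxx mulr1 big1 => [|j jk]; last first.
    by rewrite !mxE (negbTE jk) andFb mulr0 polyC0 mul0r.
  by rewrite fE /bez_col -!mul_polyC; ring.
apply: (finish (a - g *: 'X^(m - n) * q) (b + g *: 'X^(m - n) * p) 0).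
- rewrite (leq_trans (size_polyD _ _)) // geq_max sa size_polyN -scalerAl.
  apply: leq_trans (size_scale_leq _ _) _; rewrite mulrC.
  by apply: leq_trans (size_polyMleq _ _) _; rewrite size_polyXn addnS (leq_trans (leq_add sq (leqnn _))) // addSn subnKC.
- rewrite (leq_trans (size_polyD _ _)) // geq_max sb -scalerAl.
  apply: leq_trans (size_scale_leq _ _) _; rewrite mulrC.
  by apply: leq_trans (size_polyMleq _ _) _; rewrite size_polyXn addnS (leq_trans (leq_add sp (leqnn _))) // addSn subnKC.
- by rewrite coefB -scalerAl coefZ coefXnM ltnNge leq_subr /= subKn // aE subrr.
- by rewrite coefD -scalerAl coefZ coefXnM ltnNge leq_subr /= subKn // bE mulNr addNr.
rewrite mulmx0 fE; have := poly_of_colB (0 : 'cV[{poly F}]_n) 0; rewrite !subrr => ->.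
by rewrite -!mul_polyC; ring.
Qed.

(** The basis consists of z_1^j z_2^l with j < n and l < d. Degrees in z_1 are lowered with p and q,
    degrees in z_2 with the columns of B. Elements of the ideal of degree below n in z_1 are
    combinations of these columns, and no nonzero combination has degree below d in z_2. *)
Theorem quotient_basis : exists rho : 'rV[F]_(n * d) -> {poly {poly F}},
  [/\ forall (k : F) u v, rho (k *: u + v) = k%:P%:P * rho u + rho v,
      forall f, exists v, I (f - rho v) &
      forall v, I (rho v) -> v = 0].
Proof.
exists (fun v => poly_of_col (poly_col v)); split.
- by move=> k u v; rewrite poly_col_linear poly_of_col_linear.
- move=> f; have [g sg Ig] := reduce_outer f.
  have [c [r [gE sr]]] := reduce_inner (\col_(j < n) g`_j).
  pose v : 'rV[F]_(n * d) := mxvec (\matrix_j poly_rV (r j 0)); exists v.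
  have -> : poly_col v = r.
    by apply/colP => j; rewrite mxE mxvecK rowK poly_rV_K.
  have -> : f - poly_of_col r = f - g + poly_of_col (B *m c).
    rewrite -[in RHS](poly_of_col_coef sg) gE.
    have := poly_of_col_linear 1 (B *m c) r; rewrite scale1r polyC1 mul1r => ->.
    by rewrite opprD addrA addrAC subrK.
  by apply: in_ideal2D => //; exact: ideal2_bezoutian.
move=> v Iv; have [c cE] := ideal2_low_degree Iv (size_poly_of_col _).
have vE : poly_col v = B *m c := poly_of_col_inj cE.
apply: poly_col_eq0; rewrite vE (reduce_inner_unique (c := c)) ?mulmx0 // => j.
by rewrite -vE size_poly_col.
Qed.

End QuotientBasis.

(** [phi] stands for P |-> P(N), given only by Horner's recursion, so that n need not be a
    successor. *)
Lemma kermxpoly_ker (F : fieldType) n (N : 'M[F]_n) (phi : {poly F} -> 'M[F]_n) :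
  phi 0 = 0 -> (forall P c, phi (P * 'X + c%:P) = phi P *m N + c%:M) ->
  forall P, kermxpoly N P = kermx (phi P).
Proof.
case: n N phi => [|n] N phi phi0 phiX P; first by rewrite !thinmx0.
rewrite /kermxpoly; congr (kermx _).
elim/poly_ind: P => [|P c IH]; first by rewrite phi0 rmorph0.
by rewrite phiX -IH rmorphD rmorphM /= horner_mx_X horner_mx_C.
Qed.

(** All n roots of the characteristic polynomial are roots of Q, so it divides Q^n, and
    Cayley-Hamilton applies. *)
Lemma kermxpoly_full (F : closedFieldType) n (N : 'M[F]_n) (Q : {poly F}) :
  (forall a, eigenvalue N a -> root Q a) -> \rank (kermxpoly N (Q ^+ n)) = n.
Proof.
case: n N => [|n] N hQ; first by rewrite thinmx0 mxrank0.
rewrite kermxpoly_min ?mxrank1 // (dvdp_trans (mxminpoly_dvd_char N)) //.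
have [rs rsE] := closed_field_poly_normal (char_poly N).
rewrite (monicP (char_poly_monic N)) scale1r in rsE.
have rsz : size rs = n.+1.
  by have := size_char_poly N; rewrite rsE size_prod_XsubC => -[].
have {}hQ a : a \in rs -> 'X - a%:P %| Q.
  move=> ars; rewrite dvdp_XsubCl; apply: hQ.
  by rewrite eigenvalue_root_char rsE root_prod_XsubC.
rewrite rsE -rsz; elim: rs {rsE rsz} hQ => [|a rs IH] hQ.
  by rewrite big_nil dvd1p.
rewrite big_cons exprS dvdp_mul ?hQ ?mem_head // IH // => b brs.
by rewrite hQ // in_cons brs orbT.
Qed.

(** * Local factors of a finite-dimensional quotient ring *)

Section FiniteQuotient.
Variable F : numClosedFieldType.
Local Notation A := {poly {poly F}}.
Implicit Types (f g s : A) (z : F * F).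
Variable I : A -> Prop.
Hypothesis idealD : forall f g, I f -> I g -> I (f + g).
Hypothesis idealMl : forall h f, I f -> I (h * f).
Variables (D : nat) (rho : 'rV[F]_D -> A).
Implicit Types (u v w : 'rV[F]_D).
Hypothesis rho_lin : forall (k : F) u v, rho (k *: u + v) = k%:P%:P * rho u + rho v.
Hypothesis rho_onto : forall f, exists v, I (f - rho v).
Hypothesis rho_inj : forall v, I (rho v) -> v = 0.

Let idealN f : I f -> I (- f). Proof. by rewrite -mulN1r; exact: idealMl. Qed.
Let idealB f g : I f -> I g -> I (f - g). Proof. by move=> If Ig; apply: idealD => //; exact: idealN. Qed.
Let ideal0 : I 0.
Proof. by have [v h] := rho_onto 0; have := idealB h h; rewrite subrr. Qed.

Lemma rhoD u v : rho (u + v) = rho u + rho v.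
Proof. by have := rho_lin 1 u v; rewrite scale1r !polyC1 mul1r. Qed.
Lemma rho0 : rho 0 = 0.
Proof. by apply: (addrI (rho 0)); rewrite -rhoD !addr0. Qed.
Lemma rhoZ (k : F) v : rho (k *: v) = k%:P%:P * rho v.
Proof. by rewrite -[k *: v]addr0 rho_lin rho0 addr0. Qed.
Lemma rhoN v : rho (- v) = - rho v.
Proof. by rewrite -scaleN1r rhoZ !polyCN !polyC1 mulN1r. Qed.
Lemma rho_sum J (r : seq J) (h : J -> 'rV[F]_D) : rho (\sum_(j <- r) h j) = \sum_(j <- r) rho (h j).
Proof. exact: (big_morph rho rhoD rho0). Qed.

Definition coords f : 'rV[F]_D := sval (cid (rho_onto f)).

Lemma coordsP f : I (f - rho (coords f)).
Proof. by rewrite /coords; case: cid. Qed.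

Definition mulmat f : 'M[F]_D := \matrix_i coords (f * rho (delta_mx 0 i)).

Lemma mulmatP f v : I (f * rho v - rho (v *m mulmat f)).
Proof.
rewrite mulmx_sum_row rho_sum {1}[v]row_sum_delta rho_sum mulr_sumr -sumrB.
elim/big_ind: _ => [||i _]; [exact: ideal0|exact: idealD|].
rewrite !rhoZ mulrCA -mulrBr rowK; apply: idealMl; exact: coordsP.
Qed.

Lemma rho_eq f u v : I (f - rho u) -> I (f - rho v) -> u = v.
Proof.
move=> fu fv; apply/eqP; rewrite -subr_eq0; apply/eqP/rho_inj.
rewrite rhoD rhoN; have -> : rho u - rho v = (f - rho v) - (f - rho u) by ring.
exact: idealB.
Qed.

Lemma mulmat_unique f (N : 'M[F]_D) : (forall v, I (f * rho v - rho (v *m N))) -> mulmat f = N.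
Proof.
by move=> h; apply/row_matrixP => i; rewrite !rowE; apply: rho_eq (mulmatP _ _) (h _).
Qed.

Lemma mulmatM f g : mulmat (f * g) = mulmat f *m mulmat g.
Proof.
apply: mulmat_unique => v; rewrite mulmxA.
have -> : f * g * rho v - rho (v *m mulmat f *m mulmat g) =
   g * (f * rho v - rho (v *m mulmat f)) + (g * rho (v *m mulmat f) - rho (v *m mulmat f *m mulmat g)).
  by ring.
by apply: idealD; [apply: idealMl|]; exact: mulmatP.
Qed.

Lemma mulmatD f g : mulmat (f + g) = mulmat f + mulmat g.
Proof.
apply: mulmat_unique => v; rewrite mulmxDr rhoD.
have -> : (f + g) * rho v - (rho (v *m mulmat f) + rho (v *m mulmat g)) =
   (f * rho v - rho (v *m mulmat f)) + (g * rho v - rho (v *m mulmat g)) by ring.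
by apply: idealD; exact: mulmatP.
Qed.

Lemma mulmatC (k : F) : mulmat k%:P%:P = k%:M.
Proof. by apply: mulmat_unique => v; rewrite mul_mx_scalar rhoZ subrr; exact: ideal0. Qed.

Lemma mulmat_ideal f : I f -> mulmat f = 0.
Proof. by move=> If; apply: mulmat_unique => v; rewrite mulmx0 rho0 subr0 mulrC; exact: idealMl. Qed.

Lemma mulmat_comm f g : comm_mx (mulmat f) (mulmat g).
Proof. by rewrite /comm_mx -!mulmatM mulrC. Qed.

Let one := coords 1.

Lemma coords_mulmat f : I (f - rho (one *m mulmat f)).
Proof.
have -> : f - rho (one *m mulmat f) = f * (1 - rho one) + (f * rho one - rho (one *m mulmat f)).
  by ring.
by apply: idealD; [apply: idealMl; exact: coordsP|exact: mulmatP].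
Qed.

Lemma ideal_mulmat f : one *m mulmat f = 0 -> I f.
Proof. by move=> h; have := coords_mulmat f; rewrite h rho0 subr0. Qed.

Lemma mulmat_rho v : one *m mulmat (rho v) = v.
Proof. by apply: rho_eq (coords_mulmat _) _; rewrite subrr; exact: ideal0. Qed.

Local Notation ev f z := (f.[z.1, z.2]).

Lemma eigenrow f a b w : w *m mulmat 'X = a *: w -> w *m mulmat 'X%:P = b *: w ->
  w *m mulmat f = f.[a, b] *: w.
Proof.
move=> wX wY; elim/poly_ind: f => [|f c IH].
  by rewrite mulmat_ideal ?mulmx0 ?horner0 ?scale0r //; exact: ideal0.
rewrite mulmatD mulmatM mulmxDr mulmxA IH -scalemxAl wX scalerA.
rewrite hornerMXaddC hornerD hornerM hornerC scalerDl; congr (_ + _).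
elim/poly_ind: c => [|c k IHc].
  by rewrite polyC0 mulmat_ideal ?mulmx0 ?horner0 ?scale0r //; exact: ideal0.
rewrite polyCD polyCM mulmatD mulmatM mulmatC mulmxDr mulmxA IHc -scalemxAl wY scalerA.
by rewrite hornerMXaddC mul_mx_scalar scalerDl.
Qed.

(** Multiplications by z_1 and z_2 commute, so they share an eigenvector in K; it is then an
    eigenvector for every polynomial, with the value at (a, b) as eigenvalue. By [eigenrow_zero]
    such a point is a zero of the ideal. *)
Lemma common_eigenrow (K : 'M[F]_D) : K != 0 -> (forall f, stablemx K (mulmat f)) ->
  exists z w, [/\ w != 0, (w <= K)%MS & forall f, w *m mulmat f = ev f z *: w].
Proof.
move=> K0 Kst.
have [||u u0 /andP[uX uY]] := @common_eigenvector2 _ _ (restrictmx K (mulmat 'X)) (restrictmx K (mulmat 'X%:P)).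
- by rewrite lt0n mxrank_eq0.
- by rewrite -!conjmxM ?inE ?stablemx_row_base // -!mulmatM mulrC.
have w0 : u *m row_base K != 0 by rewrite mulmx_free_eq0 ?row_base_free.
move: uX uY; rewrite !stablemx_restrict // => /eigenvectorP [a /eigenspaceP wX] /eigenvectorP [b /eigenspaceP wY].
exists (a, b), (u *m row_base K); split => //.
  by rewrite mulmx_sub // eq_row_base.
by move=> f; exact: eigenrow.
Qed.

(** Evaluation at z factors through the quotient; its values on the basis form the column. *)
Lemma zero_eigencolumn z : (forall f, I f -> ev f z = 0) ->
  exists2 w : 'cV[F]_D, w != 0 & forall f, mulmat f *m w = ev f z *: w.
Proof.
move=> zI; pose w : 'cV[F]_D := \col_i ev (rho (delta_mx 0 i)) z.
have evB f g : ev (f - g) z = ev f z - ev g z by rewrite !hornerD !hornerN.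
have evM f g : ev (f * g) z = ev f z * ev g z by rewrite !hornerM.
have wE v : ev (rho v) z = (v *m w) 0 0.
  rewrite {1}[v]row_sum_delta rho_sum !horner_sum mxE; apply: eq_bigr => i _.
  by rewrite rhoZ evM !hornerC mxE.
have wM f : mulmat f *m w = ev f z *: w.
  apply/colP => i; have := zI _ (mulmatP f (delta_mx 0 i)).
  rewrite evB evM (wE (_ *m _)) -mulmxA -rowE !mxE => /eqP; rewrite subr_eq0 => /eqP ->.
  by apply: eq_bigr => j _; rewrite mxE.
exists w => //; apply: contraTneq (oner_neq0 F) => w0.
have := zI _ (coordsP 1); rewrite evB wE w0 mulmx0 mxE subr0 !hornerC => ->.
by rewrite eqxx.
Qed.

Lemma root_char_poly_eigencolumn (M : 'M[F]_D) (w : 'cV[F]_D) a :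
  w != 0 -> M *m w = a *: w -> root (char_poly M) a.
Proof.
move=> w0 wE; rewrite -eigenvalue_root_char /eigenvalue kermx_eq0 row_free_unit.
apply: contra w0 => U; rewrite -[w](mulKmx U) mulmxBl mul_scalar_mx wE subrr.
by rewrite mulmx0.
Qed.

Definition zero_of z := forall f, I f -> ev f z = 0.

Lemma eigenrow_zero z w : w != 0 -> (forall f, w *m mulmat f = ev f z *: w) -> zero_of z.
Proof.
move=> w0 wf f If; have := wf f; rewrite mulmat_ideal // mulmx0 => /esym/eqP.
by rewrite scaler_eq0 (negbTE w0) orbF => /eqP.
Qed.

Lemma finite_zero_set : exists2 Z : seq (F * F), uniq Z & forall z, zero_of z <-> z \in Z.
Proof.
have [ra ra_mem] : exists ra : seq F, forall z, zero_of z -> z.1 \in ra.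
  have [ra raE] := closed_field_poly_normal (char_poly (mulmat 'X)).
  exists ra => z /zero_eigencolumn [w w0 /(_ 'X)]; rewrite hornerX hornerC => wE.
  have := root_char_poly_eigencolumn w0 wE; rewrite {1}raE rootZ ?root_prod_XsubC //.
  by rewrite (monicP (char_poly_monic _)) oner_neq0.
have [rb rb_mem] : exists rb : seq F, forall z, zero_of z -> z.2 \in rb.
  have [rb rbE] := closed_field_poly_normal (char_poly (mulmat 'X%:P)).
  exists rb => z /zero_eigencolumn [w w0 /(_ 'X%:P)]; rewrite hornerC hornerX => wE.
  have := root_char_poly_eigencolumn w0 wE; rewrite {1}rbE rootZ ?root_prod_XsubC //.
  by rewrite (monicP (char_poly_monic _)) oner_neq0.
exists (undup [seq z <- [seq (a, b) | a <- ra, b <- rb] | `[< zero_of z >]]); first exact: undup_uniq.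
move=> z; rewrite mem_undup mem_filter; split => [zz|/andP[/asboolP //]].
apply/andP; split; first exact/asboolP.
by case: z zz => a b zz; apply: allpairs_f; [exact: (ra_mem (a, b))|exact: (rb_mem (a, b))].
Qed.

Lemma separating_form (Z : seq (F * F)) : exists t : F,
  {in Z &, injective (fun z => z.1 + t * z.2)}.
Proof.
pose s := [seq (z.1 - z'.1) / (z'.2 - z.2) | z <- Z, z' <- Z].
have [|t st] := @exists_nonroot _ (\prod_(a <- s) ('X - a%:P)).
  by rewrite monic_neq0 ?monic_prod_XsubC.
exists t => -[a b] [a' b'] zZ zZ' /= ab.
have [bb|bb] := eqVneq b b'; first by move: ab; rewrite bb => /addIr ->.
suff : root (\prod_(a <- s) ('X - a%:P)) t by rewrite rootE (negbTE st).
rewrite root_prod_XsubC; apply/allpairsP; exists ((a, b), (a', b')); split => //=.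
apply: (@mulIf _ (b' - b)); first by rewrite subr_eq0 eq_sym.
rewrite divfK ?subr_eq0 1?eq_sym //.
have -> : t * (b' - b) = (a' + t * b') - t * b - a' by ring.
by rewrite -ab; ring.
Qed.

(** Vanishing of f in the quotient localized at z, expressed without fractions. *)
Definition local_zero z f := exists2 s, ev s z != 0 & I (s * f).

Definition local_independent k z (a : 'I_k -> A) :=
  forall c : 'I_k -> F, local_zero z (\sum_i (c i)%:P%:P * a i) -> forall i, c i = 0.

Definition local_dim z N :=
  (forall k (a : 'I_k -> A), local_independent z a -> (k <= N)%N) /\
  (exists a : 'I_N -> A, local_independent z a).

Lemma mulmat_sum k (c : 'I_k -> F) (a : 'I_k -> A) v :
  v *m mulmat (\sum_i (c i)%:P%:P * a i) = (\row_i c i) *m \matrix_i (v *m mulmat (a i)).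
Proof.
have mulmat0 : mulmat 0 = 0 by apply: mulmat_ideal; exact: ideal0.
rewrite (big_morph mulmat mulmatD mulmat0) mulmx_sumr mulmx_sum_row; apply: eq_bigr => i _.
by rewrite rowK mxE mulmatM mulmatC mul_scalar_mx scalemxAr.
Qed.

(** If the classes that vanish locally at z are the kernel of [S], the local quotient is the row
    space of [S]; the rows of [row_base S *m pinvmx S] lift a basis of it. *)
Lemma local_dim_rank z (S : 'M[F]_D) :
  (forall f, local_zero z f <-> one *m mulmat f *m S = 0) -> local_dim z (\rank S).
Proof.
move=> zS; split => [k a aind|].
  pose R := \matrix_i (one *m mulmat (a i)) *m S.
  suff : row_free R by rewrite -row_leq_rank => /leq_trans; apply; exact: mxrankM_maxr.
  rewrite -kermx_eq0; apply/rowV0P => u /sub_kermxP uR.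
  apply/rowP => i; rewrite mxE; apply: (aind (fun i => u 0 i)); apply/zS.
  rewrite mulmat_sum -mulmxA -[RHS]uR; congr (_ *m _).
  by apply/rowP => j; rewrite mxE.
pose W := row_base S *m pinvmx S.
exists (fun i => rho (row i W)) => c /zS.
rewrite mulmat_sum.
have -> : \matrix_i (one *m mulmat (rho (row i W))) = W.
  by apply/row_matrixP => i; rewrite rowK mulmat_rho.
rewrite -mulmxA mulmxKpV ?eq_row_base // => /eqP.
rewrite mulmx_free_eq0 ?row_base_free // => /eqP/rowP c0 i.
by have := c0 i; rewrite !mxE.
Qed.

Lemma local_dim_nonzero z : ~ zero_of z -> local_dim z 0.
Proof.
move=> nz; have [f If fz] : exists2 f, I f & ev f z != 0.
  apply: contrapT => h; apply: nz => f If; apply/eqP/negPn/negP => fz.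
  by apply: h; exists f.
have lz g : local_zero z g by exists f => //; rewrite mulrC; exact: idealMl.
have := @local_dim_rank z 0; rewrite mxrank0; apply => g.
by split => // _; rewrite mulmx0.
Qed.

(* A linear form [l] separating the common zeros is chosen: the generalized
   eigenspaces of multiplication by [l] are the local factors of the quotient. *)
Theorem local_dims : exists Z : seq (F * F), exists N : F * F -> nat,
  [/\ uniq Z, forall z, z \in Z -> zero_of z,
      forall z, z \notin Z -> N z = 0,
      forall z, local_dim z (N z) & \sum_(z <- Z) N z = D]%N.
Proof.
have [Z Zu Z0] := finite_zero_set; have [t t_sep] := separating_form Z.
pose lam z : F := z.1 + t * z.2; pose l : A := 'X + (t *: 'X)%:P.
have lE z : ev l z = lam z by rewrite /l hornerD hornerX hornerC hornerD hornerC hornerZ hornerX.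
pose L := mulmat l; pose z_ (i : 'I_(size Z)) := nth (0, 0) Z i.
have zZ i : z_ i \in Z by rewrite mem_nth.
have lam_inj : injective (lam \o z_).
  move=> i j /= /t_sep; rewrite !zZ => /(_ isT isT) /eqP.
  by rewrite nth_uniq // => /eqP/val_inj.
pose at_l (P : {poly F}) : A := (map_poly polyC (map_poly polyC P)).[l].
have at_lX P c : at_l (P * 'X + c%:P) = at_l P * l + c%:P%:P.
  by rewrite /at_l !rmorphD !rmorphM /= !map_polyX !map_polyC /= hornerMXaddC.
have at_l0 : at_l 0 = 0 by rewrite /at_l !rmorph0 horner0.
have at_lM P Q : at_l (P * Q) = at_l P * at_l Q by rewrite /at_l !rmorphM /= hornerM.
have ev_at_l P z : ev (at_l P) z = P.[lam z].
  elim/poly_ind: P => [|P c IH]; first by rewrite at_l0 !horner0.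
  by rewrite at_lX !hornerD !hornerM IH lE !hornerC hornerX.
have ker_at_l P : kermxpoly L P = kermx (mulmat (at_l P)).
  apply: (@kermxpoly_ker _ _ _ (fun P => mulmat (at_l P))) => [|{}P c]; first by rewrite at_l0 mulmat_ideal //; exact: ideal0.
  by rewrite at_lX mulmatD mulmatM mulmatC.
pose Q : {poly F} := \prod_i ('X - (lam (z_ i))%:P).
have eigL a : eigenvalue L a -> root Q a.
  rewrite /eigenvalue => La; have [f|z [w [w0 wL wf]]] := common_eigenrow La.
    by apply: comm_mx_stable_eigenspace; exact: mulmat_comm.
  have zz : z \in Z by apply/Z0; exact: eigenrow_zero w0 wf.
  have aE : a = lam z.
    apply/eqP; have := wf l; rewrite (eigenspaceP wL) lE => /eqP.
    by rewrite -subr_eq0 -scalerBl scaler_eq0 (negbTE w0) orbF subr_eq0.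
  have iz : (index z Z < size Z)%N by rewrite index_mem.
  rewrite /Q (bigD1 (Ordinal iz)) //= rootM /z_ /= nth_index // aE root_XsubC eqxx.
  by [].
pose p_ i : {poly F} := ('X - (lam (z_ i))%:P) ^+ D.
have QE : Q ^+ D = \prod_i p_ i by rewrite /Q -prodrXl.
have p_cop i j : j != i -> coprimep (p_ i) (p_ j).
  move=> ij; rewrite coprimep_expr ?coprimep_expl // coprimep_XsubC root_XsubC.
  by rewrite (inj_eq lam_inj).
(* Multiplication by S i maps onto the generalized eigenspace for lam (z_ i), and S i does not
   vanish at z_ i, hence is a local unit there. *)
pose S i := at_l (\prod_(j | j != i) p_ j).
have rank_sum (P : pred 'I_(size Z)) : \rank (kermxpoly L (\prod_(i | P i) p_ i)) =
    (\sum_(i | P i) \rank (kermxpoly L (p_ i)))%N.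
  rewrite kermxpoly_prod => [|i j _ _]; last exact: p_cop.
  by apply/mxdirectP => /=; apply: mxdirect_sum_kermx => i j _ _; exact: p_cop.
have total : (\sum_i \rank (kermxpoly L (p_ i)))%N = D.
  by rewrite -rank_sum -QE kermxpoly_full.
have rankS i : \rank (mulmat (S i)) = \rank (kermxpoly L (p_ i)).
  have := rank_sum (predC1 i); rewrite ker_at_l mxrank_ker -/(S i) => E.
  have := total; rewrite (bigD1 i) //= -E.
  by have := rank_leq_row (mulmat (S i)); lia.
have dimS i : local_dim (z_ i) (\rank (mulmat (S i))).
  apply: local_dim_rank => f; rewrite -mulmxA -mulmatM; split; last first.
    move=> h; exists (S i); last by rewrite mulrC; exact: ideal_mulmat.
    rewrite ev_at_l horner_prod; apply/prodf_neq0 => j ji.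
    by rewrite horner_exp expf_neq0 // hornerXsubC subr_eq0 (inj_eq lam_inj) eq_sym.
  (* A nonzero class killed by both s and (l - lam (z_ i))^D would yield a common zero z with s(z) =
     0 and lam z = lam (z_ i); then z = z_ i, although s does not vanish at z_ i. *)
  move=> [s sz Is]; apply/eqP/negPn/negP => v0.
  set v := one *m mulmat (f * S i) in v0.
  pose K := (kermx (mulmat s) :&: kermx (mulmat (at_l (p_ i))))%MS.
  have vK : (v <= K)%MS.
    rewrite sub_capmx; apply/andP; split; apply/sub_kermxP; rewrite -mulmxA -mulmatM.
      rewrite mulmat_ideal ?mulmx0 //; have -> : f * S i * s = S i * (s * f) by ring.
      exact: idealMl.
    have SQ : S i * at_l (p_ i) = at_l (Q ^+ D).
      by rewrite QE (bigD1 i) //= [RHS]at_lM mulrC.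
    rewrite -mulrA SQ mulmatM (_ : mulmat (at_l (Q ^+ D)) = 0) ?mulmx0 //.
    apply/eqP; rewrite -mxrank_eq0 -leqn0; have := kermxpoly_full eigL.
    rewrite ker_at_l mxrank_ker; have := rank_leq_row (mulmat (at_l (Q ^+ D))). move: (\rank _) => r; lia.
  have K0 : K != 0 by apply: contraNneq v0 => K0; rewrite K0 submx0 in vK.
  have [g|z [w [w0 wK wf]]] := common_eigenrow K0.
    rewrite /K; apply: submx_trans (capmxMr _ _ _) _; apply: capmxS.
      by apply: comm_mx_stable_ker; exact: mulmat_comm.
    by apply: comm_mx_stable_ker; exact: mulmat_comm.
  move: wK; rewrite sub_capmx => /andP[/sub_kermxP ws /sub_kermxP wp].
  have zz : z \in Z by apply/Z0; exact: eigenrow_zero w0 wf.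
  move: ws wp; rewrite !wf => /eqP; rewrite scaler_eq0 (negbTE w0) orbF => /eqP sz0 /eqP.
  rewrite scaler_eq0 (negbTE w0) orbF ev_at_l horner_exp expf_eq0 => /andP[_].
  rewrite hornerXsubC subr_eq0 => /eqP zE.
  by move: sz; rewrite -(t_sep _ _ zz (zZ i) zE) sz0 eqxx.
exists Z, (fun z => if z \in Z then \rank (kermxpoly L (('X - (lam z)%:P) ^+ D)) else 0%N).
split => // [z /Z0 //|z /negbTE -> //|z|].
- case: ifPn => zz; last by apply: local_dim_nonzero; apply: contraNnot zz => /Z0.
  have iz : (index z Z < size Z)%N by rewrite index_mem.
  have := dimS (Ordinal iz); rewrite rankS /p_ /z_ /= nth_index //.
rewrite (big_nth (0, 0)) big_mkord -[RHS]total; apply: eq_bigr => i _.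
by rewrite zZ.
Qed.

End FiniteQuotient.

Section FieldIdentities.
Variable K : fieldType.
Implicit Types (a b f p q s t : K).

Lemma divf_combination a b f p q s t : t != 0 -> s != 0 ->
  t * f = a * p + b * q -> f / s = a / (t * s) * p + b / (t * s) * q.
Proof.
move=> t0 s0 E; apply: (mulfI t0); rewrite mulrA E; field.
by rewrite s0 t0.
Qed.

Lemma combination_divf a a' b b' p q : b != 0 -> b' != 0 ->
  b * b' * (a / b * p + a' / b' * q) = a * b' * p + a' * b * q.
Proof. by move=> b0 b'0; field; rewrite b0 b'0. Qed.

Lemma divf_common a b t : b != 0 -> t != 0 -> a / b = a * t / (b * t).
Proof. by move=> b0 t0; field; rewrite b0 t0. Qed.

End FieldIdentities.

(** * Intersection multiplicities through polynomials *)

Section Multiplicity.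
Variable R : realType.
Local Notation C := R[i].
Local Notation "x %:F" := (tofrac x).
Implicit Types (p q f s : {bipoly R}) (z : C * C).

Lemma eval2M f s z : eval2 (f * s) z = eval2 f z * eval2 s z.
Proof. by rewrite /eval2 !hornerM. Qed.

Lemma eval2_neq0 f z : eval2 f z != 0 -> f%:F != 0.
Proof. by rewrite tofrac_eq0; apply: contraNneq => ->; rewrite /eval2 !horner0. Qed.

Lemma local_ideal_fraction p q z f s :
  eval2 s z != 0 -> local_zero (in_ideal2 p q) z f -> local_ideal p q z (f%:F / s%:F).
Proof.
move=> sz [t tz [a [b ab]]]; exists (a%:F / (t * s)%:F), (b%:F / (t * s)%:F).
have tsz : eval2 (t * s) z != 0 by rewrite eval2M mulf_neq0.
split; [by exists a, (t * s)|by exists b, (t * s)|].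
have s0 := eval2_neq0 sz; have t0 := eval2_neq0 tz.
have E : t%:F * f%:F = a%:F * p%:F + b%:F * q%:F by rewrite -!tofracM -tofracD ab.
have -> : (t * s)%:F = t%:F * s%:F by exact: tofracM.
exact: (divf_combination t0 s0 E).
Qed.

Lemma local_ideal_polynomial p q z f :
  local_ideal p q z f%:F -> local_zero (in_ideal2 p q) z f.
Proof.
move=> [_ [_ [[a1 [b1 [b1z ->]]] [a2 [b2 [b2z ->]]] fE]]].
have b10 := eval2_neq0 b1z; have b20 := eval2_neq0 b2z.
exists (b1 * b2); first by rewrite -/(eval2 _ z) eval2M mulf_neq0.
exists (a1 * b2), (a2 * b1); apply/eqP; rewrite -tofrac_eq tofracD.
have -> : (b1 * b2 * f)%:F = b1%:F * b2%:F * f%:F by rewrite -!tofracM.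
have -> : (a1 * b2 * p)%:F = a1%:F * b2%:F * p%:F by rewrite -!tofracM.
have -> : (a2 * b1 * q)%:F = a2%:F * b1%:F * q%:F by rewrite -!tofracM.
have E := combination_divf a1%:F a2%:F p%:F q%:F b10 b20.
by apply/eqP; rewrite -fE in E; exact: E.
Qed.

(** Fractions are brought to a common denominator, a unit of the local ring, so that independence
    modulo the local ideal can be tested on polynomial families. *)
Lemma intersection_multiplicity_local_dim p q z N :
  local_dim (in_ideal2 p q) z N -> intersection_multiplicity p q z = N%:R%:E.
Proof.
move=> [Nmax [a aind]]; apply/eqP; rewrite eq_le; apply/andP; split.
  apply: ge_ereal_sup => _ [k [f [fV find]] <-]; rewrite lee_fin ler_nat.
  have /choice [n nP] : forall i, exists n : {bipoly R} * {bipoly R},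
      eval2 n.2 z != 0 /\ f i = n.1%:F / n.2%:F.
    by move=> i; have [u [v [vz fE]]] := fV i; exists (u, v).
  pose s := \prod_i (n i).2.
  have sz : eval2 s z != 0.
    rewrite /s; elim/big_ind: _ => [|u v uz vz|i _]; last exact: (nP i).1.
      by rewrite /eval2 !hornerC oner_neq0.
    by rewrite eval2M mulf_neq0.
  pose b i := (n i).1 * \prod_(j | j != i) (n j).2.
  have fE i : f i = (b i)%:F / s%:F.
    have [nz ->] := nP i; pose r := \prod_(j | j != i) (n j).2.
    have -> : s = (n i).2 * r by rewrite /s (bigD1 i).
    have r0 : r%:F != 0.
      rewrite tofrac_eq0; apply/prodf_neq0 => j _.
      by rewrite -tofrac_eq0; exact: eval2_neq0 (nP j).1.
    have -> : (b i)%:F = (n i).1%:F * r%:F by exact: tofracM.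
    have -> : ((n i).2 * r)%:F = (n i).2%:F * r%:F by exact: tofracM.
    exact: (divf_common _ (eval2_neq0 nz) r0).
  apply: (Nmax _ b) => c cb i; apply: (find c).
  have -> : \sum_i (c i)%:P%:P%:F * f i = (\sum_i (c i)%:P%:P * b i)%:F / s%:F.
    rewrite rmorph_sum mulr_suml; apply: eq_bigr => j _ /=.
    have -> : ((c j)%:P%:P * b j)%:F = (c j)%:P%:P%:F * (b j)%:F by exact: tofracM.
    by rewrite fE mulrA.
  exact: (local_ideal_fraction sz cb).
apply: ereal_sup_ubound; exists N => //; exists (fun i => (a i)%:F); split.
  move=> i; exists (a i), 1; split; first by rewrite /eval2 !hornerC oner_neq0.
  by rewrite tofrac1 divr1.
move=> c cW; apply: aind; apply: local_ideal_polynomial.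
rewrite rmorph_sum (eq_bigr (fun i => (c i)%:P%:P%:F * (a i)%:F)) // => i _.
exact: tofracM.
Qed.

(** Nonzero multiplicities occur only at common zeros, all of them on the torus by hypothesis, so
    the sum is the finite sum of the dimensions in [local_dims]. *)
Lemma esum_multiplicity p q D (rho : 'rV[C]_D -> {bipoly R}) :
  (forall (k : C) u v, rho (k *: u + v) = k%:P%:P * rho u + rho v) ->
  (forall f, exists v, in_ideal2 p q (f - rho v)) ->
  (forall v, in_ideal2 p q (rho v) -> v = 0) ->
  (forall z, eval2 p z = 0 -> eval2 q z = 0 -> torus z) ->
  (\esum_(z in @torus R) intersection_multiplicity p q z)%E = (D%:R%:E)%E.
Proof.
move=> rho_lin rho_onto rho_inj pqT.
have [Z [N [Zu Z0 N0 NZ ND]]] := local_dims (@in_ideal2D _ p q) (@in_ideal2Ml _ p q) rho_lin rho_onto rho_inj.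
have ZT : [set` Z] `<=` @torus R.
  move=> z /= /Z0 zz; apply: pqT; apply: zz; [exists 1, 0|exists 0, 1]; ring.
have -> : (\esum_(z in @torus R) intersection_multiplicity p q z)%E =
    (\esum_(z in @torus R `&` [set` Z]) (N z)%:R%:E)%E.
  rewrite [RHS]esum_mkcondr; apply: eq_esum => z _.
  rewrite (intersection_multiplicity_local_dim (NZ z)).
  have [zZ|zZ] := boolP (z \in Z); first by rewrite mem_set.
  by rewrite memNset ?N0 //=; apply/negP.
have fZ : finite_set [set` Z] by exact: finite_seq.
rewrite (setIidr ZT) (esum_fset fZ); last by move=> i _; rewrite lee_fin ler0n.
by rewrite -fsbig_seq // sumEFin -natr_sum ND.
Qed.

End Multiplicity.

(** * The determinant of the Bezoutian *)

Section DetDegree.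
Variable A : comNzRingType.

Lemma prod_top n d (f : 'I_n -> {poly A}) : (forall i, (size (f i) <= d.+1)%N) ->
  (size (\prod_i f i)%R <= (n * d).+1)%N /\ (\prod_i f i)`_(n * d) = \prod_i (f i)`_d.
Proof.
elim: n f => [|n IH] f sf.
  by rewrite !big_ord0 size_poly1 mul0n coefC.
have [sp topE] := IH _ (fun i => sf (lift ord0 i)).
rewrite !big_ord_recl mulSn; split; last by rewrite coefM_top // topE.
apply: leq_trans (size_polyMleq _ _) _; rewrite -subn1 leq_subLR add1n.
by apply: leq_trans (leq_add (sf ord0) sp) _; rewrite addSn addnS.
Qed.

(** In each term of the permutation expansion the coefficient of degree n d involves only
    coefficients of degree d. This bounds the degree of det B and identifies its top coefficient
    with the determinant of [Btop]. *)
Lemma det_top n d (B : 'M[{poly A}]_n) : (forall j k, (size (B j k) <= d.+1)%N) ->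
  (size (\det B) <= (n * d).+1)%N /\ (\det B)`_(n * d) = \det (\matrix_(j, k) (B j k)`_d).
Proof.
move=> sB; have top (s : {perm 'I_n}) := prod_top (fun i => sB i (s i)).
have signC (s : {perm 'I_n}) (f : {poly A}) : (-1) ^+ s * f = ((-1) ^+ s : A) *: f.
  by rewrite -mul_polyC polyC_exp polyCN polyC1.
split.
  apply: leq_trans (size_sum _ _ _) _; apply/bigmax_leqP => s _.
  by rewrite signC; apply: leq_trans (size_scale_leq _ _) _; have [] := top s.
rewrite coef_sum; apply: eq_bigr => s _; rewrite signC coefZ; congr (_ * _).
by have [_ ->] := top s; apply: eq_bigr => i _; rewrite mxE.
Qed.

End DetDegree.

Lemma bezoutian_entry_size (A : comNzRingType) n d (f g : {poly {poly A}}) (j k : 'I_n) :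
  (sizeY f <= d.+1)%N -> (sizeY g <= d.+1)%N -> (size (bezoutian n f g j k) <= (2 * d).+1)%N.
Proof.
move=> sf sg; rewrite mxE /bez_col.
have sM (u v : {poly {poly A}}) m : (sizeY u <= d.+1)%N -> (sizeY v <= d.+1)%N ->
    (size ((u * drop_poly m v)`_j)%R <= (2 * d).+1)%N.
  move=> su sv; rewrite coefM; apply: leq_trans (size_sum _ _ _) _; apply/bigmax_leqP => i _.
  rewrite coef_drop_poly; apply: leq_trans (size_polyMleq _ _) _.
  rewrite -subn1 leq_subLR add1n.
  apply: leq_trans (leq_add (leq_trans (max_size_coefXY _ _) su) (leq_trans (max_size_coefXY _ _) sv)) _.
  by rewrite addSn addnS mul2n addnn.
rewrite coefB (leq_trans (size_polyD _ _)) // geq_max size_polyN.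
by rewrite !sM.
Qed.

(** * The dichotomy for scattering stable polynomials *)

Section ScatteringStable.
Variable R : realType.
Local Notation C := R[i].
Variable p : {bipoly R}.
Let n1 := (bidegree p).1.
Let n2 := (bidegree p).2.
Let q := reflection (n1, n2) p.
Let B := bezoutian n1 p q.
Hypothesis p_stable : scattering_stable p.

Let no_zero : stable2 p. Proof. by apply: stable2_no_zeros; case: p_stable. Qed.

Lemma coef00_neq0 : p`_0`_0 != 0.
Proof. by rewrite -eval2_00; case: p_stable => h _; apply: h; split; rewrite /= normr0 ltr01. Qed.

Let p_neq0 : p != 0.
Proof. by apply: contraNneq coef00_neq0 => ->; rewrite !coef0. Qed.

Let sp : size p = n1.+1.
Proof. by rewrite /n1 /= prednK // lt0n size_poly_eq0. Qed.

Let sYp : (sizeY p <= n2.+1)%N.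
Proof. by rewrite /n2 /= leqSpred. Qed.

Let sizes_q := reflection_size (n1, n2) p.

Let q_top : q`_n1 != 0.
Proof.
apply: contraNneq coef00_neq0 => q0; have := @coef_reflection R (n1, n2) p n1 n2 (leqnn _) (leqnn _).
rewrite -/q q0 coef0 /= !subnn => /esym h.
by rewrite -[p`_0`_0]conjcK h conjc0.
Qed.

Let sq : size q = n1.+1.
Proof.
apply/eqP; rewrite eqn_leq sizes_q.1 /= ltnNge; apply: contra q_top => h.
by rewrite nth_default.
Qed.

Let cofactor_size d a b : p = a * d -> q = b * d -> (size d <= 1)%N.
Proof.
move=> pE qE; case: p_stable => _ /(_ d a b pE qE) [c ->].
exact: size_polyC_leq1.
Qed.

Let no_common_slice z : slice z p = 0 -> slice z q = 0 -> False.
Proof.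
move=> /slice_eq0_factor [p' pE] /slice_eq0_factor [q' qE].
have [c] : exists c : C, ('X - z%:P)%:P = c%:P%:P.
  case: p_stable => _ h; apply: (h _ p' q').
    by rewrite mulrC mul_polyC.
  by rewrite mulrC mul_polyC.
move/polyC_inj/(congr1 (fun f : {poly C} => size f)); rewrite size_XsubC.
by have := size_polyC_leq1 c => /[swap] <-.
Qed.

Let slice_stable1 z : `|z| = 1 -> stable1 (slice z p).
Proof.
move=> z1; have [sz0|//] := slice_torus_stable no_zero z1.
case: (no_common_slice sz0); rewrite slice_reflection // sz0.
apply/polyP => i; rewrite coefZ coef_poly !coef0.
by case: ifP => _; rewrite ?rmorph0 ?mulr0.
Qed.

Let det_neq0 : \det B != 0.
Proof. by apply: det_bezoutian_neq0 cofactor_size; rewrite ?sp ?sq. Qed.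

Let entry_size j k : (size (B j k) <= (2 * n2).+1)%N.
Proof. by apply: bezoutian_entry_size => //; exact: sizes_q.2. Qed.

(** [ts] lists the circle roots of det B with multiplicity. If there are fewer than 2 n1 n2, the
    linear conditions do not use up the n1 n2 coefficients; otherwise the degree bound is attained
    and leaves no room for roots elsewhere. *)
Lemma L2_or_torus_roots :
  (exists v, [/\ v != 0, L2_torus (fun z => eval2 v z / eval2 p z),
    bidegree_le (bidegree v) (n1, n2), v = reflection (n1, n2) v & eval2 v (0, 0) = 0]) \/
  ((\det B)`_(n1 * (2 * n2)) != 0 /\ forall z, (\det B).[z] = 0 -> `|z| = 1).
Proof.
have [rs rsE] := closed_field_poly_normal (\det B).
have lc0 : lead_coef (\det B) != 0 by rewrite lead_coef_eq0.
pose ts := [seq t <- rs | `|t| == 1].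
pose h := lead_coef (\det B) *: \prod_(t <- rs | `|t| != 1) ('X - t%:P).
have detE : \det B = \prod_(t <- ts) ('X - t%:P) * h.
  by rewrite {1}rsE (bigID (fun t => `|t| == 1)) /= big_filter scalerAr.
have ts1 : {in ts, forall t, `|t| = 1} by move=> t; rewrite mem_filter => /andP[/eqP].
have h0 z : `|z| = 1 -> h.[z] != 0.
  move=> z1; rewrite hornerZ mulf_neq0 // horner_prod; elim/big_ind: _ => [|u v u0 v0|t t1].
  - exact: oner_neq0.
  - exact: mulf_neq0.
  by rewrite hornerXsubC subr_eq0; apply: contraNneq t1 => <-; rewrite z1.
have sp' : (size p <= n1.+1)%N by rewrite sp.
have [sz|sz] := ltnP (size ts) (2 * n1 * n2).
  left; have [c [c0 sc1 sc2 cL2]] := exists_L2_quotient sp' sYp slice_stable1 detE ts1 h0 sz.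
  exact: symmetrize c0 sc1 sc2 cL2.
right; have [sdet _] := det_top entry_size.
have srs : size rs = (size (\det B)).-1.
  by rewrite [in RHS]rsE size_scale // size_prod_XsubC.
have E : (n1 * (2 * n2) = 2 * n1 * n2)%N by rewrite mulnCA mulnA.
have szle : (size ts <= size rs)%N by rewrite size_filter count_size.
have sdE : size (\det B) = (n1 * (2 * n2)).+1.
  apply/eqP; rewrite eqn_leq sdet /=.
  by rewrite -(prednK (n := size (\det B))) ?lt0n ?size_poly_eq0 // ltnS -srs E (leq_trans sz).
split; first by have := lc0; rewrite lead_coefE sdE.
move=> z; rewrite rsE hornerZ => /eqP; rewrite mulf_eq0 (negbTE lc0) /=.
rewrite -rootE root_prod_XsubC => zrs.
have /all_filterP tsE : all (fun t => `|t| == 1) rs.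
  rewrite all_count -size_filter eqn_leq szle /=.
  by rewrite srs sdE /= E.
by apply: ts1; rewrite /ts tsE.
Qed.

Hypothesis det_top_neq0 : (\det B)`_(n1 * (2 * n2)) != 0.
Hypothesis det_roots : forall z, (\det B).[z] = 0 -> `|z| = 1.

Let det_slice z : \det (bezoutian n1 (slice z p) (slice z q)) = 0 -> `|z| = 1.
Proof. by move=> h; apply: det_roots; rewrite -det_evm /evm map_bezoutian. Qed.

Let size_slice_le z : (size (slice z p) <= n1.+1)%N /\ (size (slice z q) <= n1.+1)%N.
Proof. by split; apply: leq_trans (size_slice _ _) _; rewrite ?sp ?sq. Qed.

(** At a common zero z both slices lose degree, so for n1 > 0 the Bezoutian is singular and |z| = 1.
    There the top coefficient of the slice of q is conj f(0) up to a unimodular factor, f being the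
    slice of p, and stability keeps it nonzero. For n1 = 0 both slices would vanish. *)
Lemma coprime_tops : coprimep p`_n1 q`_n1.
Proof.
apply: coprimep_closed => z; rewrite -!coef_slice => pz qz.
have [/size_top_eq0/(_ pz) sp0 /size_top_eq0/(_ qz) sq0] := size_slice_le z.
have [n10|n10] := posnP n1.
  move: sp0 sq0; rewrite n10 !leqn0 !size_poly_eq0 => /eqP sp0 /eqP sq0.
  exact: no_common_slice sp0 sq0.
have z1 := det_slice (bezoutian_lead0 n10 sp0 sq0).
move: qz; rewrite /q slice_reflection // coefZ crev_coef // subnn => /eqP.
rewrite mulf_eq0 expf_eq0 (negbTE (circle_neq0 z1)) andbF /= conjC_eq0 => /eqP f0.
have := slice_stable1 z1 (x := 0); rewrite normr0 ltr01 horner_coef0 f0 eqxx.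
by move=> /(_ isT).
Qed.

(** For n1 > 0 the row (x^j) is a kernel vector of the Bezoutian at y, so y is a root of det B and
    |y| = 1. Then |x| < 1 contradicts stability of the slice at x, and |x| > 1 contradicts it at
    1/conj x, where p vanishes because q vanishes at (x, y). *)
Lemma common_zero_torus z : eval2 p z = 0 -> eval2 q z = 0 -> torus z.
Proof.
case: z => x y; rewrite /eval2 /= -!horner_slice => px qx.
have [sp0 sq0] := size_slice_le y.
have y1 : `|y| = 1.
  have [n10|n10] := posnP n1.
    move: px qx sp0 sq0; rewrite n10 => px qx /size1_polyC pE /size1_polyC qE.
    case: (@no_common_slice y).
      by move: px; rewrite {1}pE hornerC => p0; rewrite pE p0.
    by move: qx; rewrite {1}qE hornerC => q0; rewrite qE q0.
  apply: det_slice; apply/eqP/negPn/negP => d0.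
  have U : bezoutian n1 (slice y p) (slice y q) \in unitmx by rewrite unitmxE unitfE.
  have := bezoutian_root sp0 sq0 px qx => /(congr1 (mulmx^~ (invmx (bezoutian n1 (slice y p) (slice y q))))).
  rewrite mulmxK // mul0mx => /rowP/(_ (Ordinal n10)); rewrite !mxE /= expr0 => /eqP.
  by rewrite oner_eq0.
split => //=; apply/eqP; rewrite eq_le; apply/andP; split; last first.
  rewrite real_leNgt ?realE ?ler01 ?normr_ge0 //; apply/negP => x1.
  by have := slice_stable1 y1 x1; rewrite px eqxx.
rewrite real_leNgt ?realE ?ler01 ?normr_ge0 //; apply/negP => x1.
have x0 : x != 0 by rewrite -normr_gt0 (lt_trans ltr01).
have pn : bidegree_le (bidegree p) (n1, n2) by rewrite /bidegree_le !leqnn.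
have := eval2_reflection (z := (x, y)) pn x0 (circle_neq0 y1).
rewrite -/q {1}/eval2 /= -horner_slice qx => /esym/eqP.
rewrite !mulf_eq0 !expf_eq0 (negbTE x0) (negbTE (circle_neq0 y1)) !andbF /= conjc_eq0.
rewrite -[conjc y]/(y^*) circle_conj // invrK /eval2 /= -horner_slice => /eqP px'.
have x'1 : `|(conjc x)^-1| < 1 by rewrite normfV normcJ invf_lt1 ?(lt_trans ltr01).
by have := slice_stable1 y1 x'1; rewrite px' eqxx.
Qed.

(** [quotient_basis] applies with d = 2 n2, because the entries of B are bilinear in the
    coefficients of p and q; the dimension is therefore 2 n1 n2. *)
Lemma saturated_of_torus_roots : torus_saturated p.
Proof.
have [rho [rho_lin rho_onto rho_inj]] : exists rho : 'rV[C]_(n1 * (2 * n2)) -> {bipoly R},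
    [/\ forall (k : C) u v, rho (k *: u + v) = k%:P%:P * rho u + rho v,
      forall f, exists v, in_ideal2 p q (f - rho v) &
      forall v, in_ideal2 p q (rho v) -> v = 0].
  apply: quotient_basis => //.
  - by rewrite sp.
  - by rewrite sq.
  - exact: coprime_tops.
  by rewrite unitmxE unitfE; have [_ <-] := det_top entry_size.
rewrite /torus_saturated -/n1 -/n2 (esum_multiplicity rho_lin rho_onto rho_inj common_zero_torus).
by rewrite mulnCA mulnA.
Qed.

End ScatteringStable.

Theorem theorem1p9 (R : realType) (p : {bipoly R})
    (p_stable : scattering_stable p)
    (p_refl0 : eval2 (reflection (bidegree p) p) (0, 0) = 0) :
  (forall v : {bipoly R},
     bidegree_le (bidegree v) (bidegree (reflection (bidegree p) p)) ->
     eval2 v (0, 0) = 0 ->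
     v = reflection (bidegree p) v ->
     no_zeros_in_bidisk (p + v) ->
     no_zeros_in_bidisk (p - v) ->
     L2_torus (fun z => eval2 v z / eval2 p z))
  /\
  (~ torus_saturated p ->
   exists v : {bipoly R},
     [/\ v != 0,
         L2_torus (fun z => eval2 v z / eval2 p z),
         bidegree_le (bidegree v) (bidegree (reflection (bidegree p) p)),
         v = reflection (bidegree p) v &
         eval2 v (0, 0) = 0]).
Proof.
rewrite (bidegree_reflection (coef00_neq0 p_stable)); split => [v vn v0 vr pv mv|nsat].
  by apply: stable_perturbation_L2 => //; case: p_stable.
have [//|[dtop droots]] := L2_or_torus_roots p_stable.
by case: nsat; exact: saturated_of_torus_roots dtop droots.
Qed.
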